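(* Let $Z$ be the typical cell of a stationary Poisson hyperplane tessellation in $\mathbb{R}^d$ ($d\ge 2$) with intensity $\gamma>0$ and directional distribution $\varphi$. Assume that $\varphi$ is well spread. Then there exists a constant $c>0$, depending on $d$ and $\varphi$, such that for all integers $n\ge d+1$, $$\mathbb{P}(f(Z)=n) > c^{\,n}\, n^{-\frac{2n}{d-1}} .$$
   Context: For $u\in\mathbb{S}^{d-1}$ and $t>0$ put $H(u,t)=\{x\in\mathbb{R}^d:\langle x,u\rangle=t\}$. Let $\varphi$ be an even Borel probability measure on $\mathbb{S}^{d-1}$ (the directional distribution) whose support is not contained in a great subsphere (the intersection of $\mathbb{S}^{d-1}$ with a hyperplane through the origin $o$), and let $\gamma>0$. Let $\eta$ be the Poisson point process on the space of affine hyperplanes of $\mathbb{R}^d$ with intensity measure $\gamma\mu$, where $\mu(\cdot)=\int_{\mathbb{S}^{d-1}}\int_0^\infty \mathbf{1}(H(u,t)\in\cdot)\,dt\,d\varphi(u)$; it is stationary. The closures of the connected components of $\mathbb{R}^d\setminus\bigcup_{H\in\eta}H$ are almost surely polytopes, called cells; $X$ denotes the random collection of cells. Let $\mathfrak{c}$ be a center function: a measurable map from convex bodies (compact convex sets with non-empty interior) to $\mathbb{R}^d$ with $\mathfrak{c}(K)\in K$ and $\mathfrak{c}(tK+x)=t\,\mathfrak{c}(K)+x$ for $t>0$, $x\in\mathbb{R}^d$. The typical cell $Z$ is a random polytope with $\mathfrak{c}(Z)=o$ whose law $\mathbb{Q}$ is defined by $\mathbb{E}\,\#\{P\in X: P-\mathfrak{c}(P)\in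 C,\ \mathfrak{c}(P)\in A\}=\gamma^{(d)}\lambda_d(A)\,\mathbb{Q}(C)$ for Borel $A\subset\mathbb{R}^d$ and Borel sets $C$ of polytopes with center $o$, where $\lambda_d$ is Lebesgue measure and $\gamma^{(d)}=\mathbb{E}\,\#\{P\in X:\mathfrak{c}(P)\in[0,1]^d\}$. The law of translation-invariant functionals of $Z$ does not depend on the choice of $\mathfrak{c}$. $f(P)$ denotes the number of facets of a polytope $P$. A cap of radius $r$ is the intersection of $\mathbb{S}^{d-1}$ with a ball of radius $r$ centred at a point of $\mathbb{S}^{d-1}$. $\varphi$ is called well spread if there is a cap of $\mathbb{S}^{d-1}$ (of positive radius) on which $\varphi$ is bounded from below by a positive multiple of the surface area measure. *)

(* Defs.v *)
From HB Require Import structures.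
From mathcomp Require Import all_boot all_order all_algebra.
From mathcomp Require Import all_classical all_reals all_analysis.
From mathcomp Require Import measurable_realfun.

Set Implicit Arguments.
Unset Strict Implicit.
Unset Printing Implicit Defensive.

Import Order.TTheory GRing.Theory Num.Theory.
Import numFieldNormedType.Exports.

Local Open Scope classical_set_scope.
Local Open Scope ring_scope.

(* The norm that the library puts on ['rV[R]_d] is the maximum norm; it gives
   the usual topology, but metric notions below use [enorm]. *)
Definition dotp (R : realType) (d : nat) (x y : 'rV[R]_d) : R :=
  \sum_(i < d) x 0 i * y 0 i.

Definition enorm (R : realType) (d : nat) (x : 'rV[R]_d) : R :=
  Num.sqrt (dotp x x).

Definition sphere (R : realType) (d : nat) : set 'rV[R]_d :=
  [set u | enorm u = 1].

Definition cap (R : realType) (d : nat) (v : 'rV[R]_d) (r : R)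
    : set 'rV[R]_d :=
  [set u | @sphere R d u /\ enorm (u - v) <= r].

Definition hplane (R : realType) (d : nat) (u : 'rV[R]_d) (t : R)
    : set 'rV[R]_d :=
  [set x | dotp x u = t].

Definition borelRV (R : realType) (d : nat) :=
  g_sigma_algebraType (@open 'rV[R]_d).

(* Only meant for Borel sets: the d-fold product of the one-dimensional
   Lebesgue measure, obtained by integrating the measures of the sections. *)
Fixpoint lebesgueRV (R : realType) (d : nat) : set 'rV[R]_d -> \bar R :=
  match d with
  | 0 => fun A => (\1_A (0 : 'rV[R]_0))%:E
  | d'.+1 => fun A => (\int[lebesgue_measure]_x
      @lebesgueRV R d' [set v | A (row_mx (x%:M : 'rV[R]_1) v)])%E
  end.

(* Spherical Lebesgue measure of a Borel subset of the unit sphere, in polar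
   coordinates: d times the volume of the cone over the set. *)
Definition surface_area (R : realType) (d : nat) (A : set 'rV[R]_d) : \bar R :=
  (d%:R%:E * lebesgueRV
     [set x | exists s u, [/\ (0 < s <= 1)%R, A u & x = (s *: u)%R]])%E.

Section directional_distribution.
Variables (R : realType) (d : nat).

(* Measures on the sphere are Borel measures on R^d carried by the sphere. *)
Variable phi : probability (borelRV R d) R.

Definition msupport : set 'rV[R]_d :=
  [set u | forall U : set 'rV[R]_d, open U -> U u -> (0 < phi U)%E].

Definition directional_distribution : Prop :=
  [/\ phi (@sphere R d) = 1%E,
      forall A : set (borelRV R d), measurable A ->
        phi [set - u | u in (A : set 'rV[R]_d)] = phi A
    & ~ exists2 v : 'rV[R]_d, v != 0 & msupport `<=` hplane v 0].

Definition well_spread : Prop :=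
  exists (v : 'rV[R]_d) (r a : R),
    [/\ @sphere R d v, 0 < r, 0 < a
      & forall A : set (borelRV R d), measurable A -> A `<=` cap v r ->
          (a%:E * surface_area A <= phi A)%E].

Definition hyperplane : set (set 'rV[R]_d) :=
  [set H | exists u t, @sphere R d u /\ H = hplane u t].

(* Subbase of the trace on hyperplanes of the Fell topology on closed sets;
   that topology has a countable base, so the subbase generates the Borel
   sets. *)
Definition fell_subbase : set (set (set 'rV[R]_d)) :=
  [set B | exists2 C : set 'rV[R]_d, compact C &
     B = [set H | hyperplane H /\ H `&` C = set0]] `|`
  [set B | exists2 G : set 'rV[R]_d, open G &
     B = [set H | hyperplane H /\ H `&` G !=set0]].

Definition borel_hyperplane : set (set (set 'rV[R]_d)) :=
  <<s hyperplane, fell_subbase >>.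

Definition hyperplane_measure (B : set (set 'rV[R]_d)) : \bar R :=
  (\int[phi]_(u in @sphere R d)
     \int[lebesgue_measure]_(t in `]0%R, +oo[)
        (\1_B (hplane (u : 'rV[R]_d) t))%:E)%E.

End directional_distribution.

Definition mutually_independent (R : realType) (dO : measure_display)
    (Omega : measurableType dO) (P : probability Omega R) (k : nat)
    (X : 'I_k -> Omega -> \bar R) : Prop :=
  forall S : 'I_k -> set (\bar R), (forall i, measurable (S i)) ->
    P (\bigcap_(i in [set: 'I_k]) (X i @^-1` S i)) =
    (\prod_(i < k) P (X i @^-1` S i))%E.

(* A point process is given by its random set of points; this loses nothing
   because a Poisson process with diffuse intensity is almost surely simple.
   The second argument of [poisson_prob] is a dummy. *)
Record poisson_hyperplane_process (R : realType) (d : nat)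
    (phi : probability (borelRV R d) R) (gamma : R) (dO : measure_display)
    (Omega : measurableType dO) (P : probability Omega R)
    (eta : Omega -> set (set 'rV[R]_d)) : Prop := {
  php_hyperplane : forall w, eta w `<=` @hyperplane R d ;
  php_measurable : forall B, borel_hyperplane B ->
    measurable_fun [set: Omega]
      (fun w => counting (eta w `&` B) : \bar R) ;
  php_poisson : forall B, borel_hyperplane B ->
    (gamma%:E * hyperplane_measure phi B < +oo)%E ->
    forall k : nat,
      P [set w | counting (eta w `&` B) = k%:R%:E :> \bar R] =
      poisson_prob (fine (gamma%:E * hyperplane_measure phi B)%E) 0 [set k] ;
  php_independent : forall (k : nat) (B : 'I_k -> set (set 'rV[R]_d)),
    (forall i, borel_hyperplane (B i)) -> trivIset [set: 'I_k] B ->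
    mutually_independent P (fun i w => counting (eta w `&` B i))
}.

Section convex_bodies.
Variables (R : realType) (d : nat).

Definition convex_body (K : set 'rV[R]_d) : Prop :=
  [/\ compact K, convex_set (K : set (convex_lmodType 'rV[R]_d))
    & interior K !=set0].

Definition conv_hull (S : set 'rV[R]_d) : set 'rV[R]_d :=
  smallest (fun K => convex_set (K : set (convex_lmodType 'rV[R]_d))) S.

Definition polytope (K : set 'rV[R]_d) : Prop :=
  exists2 S : set 'rV[R]_d, finite_set S & K = conv_hull S.

Definition aff_indep (k : nat) (p : 'I_k.+1 -> 'rV[R]_d) : bool :=
  row_free (\matrix_(i < k) (p (lift ord0 i) - p ord0)).

Definition has_affdim (F : set 'rV[R]_d) (k : nat) : Prop :=
  (exists2 p : 'I_k.+1 -> 'rV[R]_d, (forall i, F (p i)) & aff_indep p) /\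
  ~ (exists2 p : 'I_k.+2 -> 'rV[R]_d, (forall i, F (p i)) & aff_indep p).

(* Facets of a d-dimensional polytope: its (d-1)-dimensional faces. *)
Definition facet (K : set 'rV[R]_d) : set (set 'rV[R]_d) :=
  [set F | exists (u : 'rV[R]_d) (t : R),
    [/\ u != 0, K `<=` [set x | dotp x u <= t], F = K `&` hplane u t
      & has_affdim F d.-1]].

Definition nfacets (K : set 'rV[R]_d) : \bar R := counting (facet K).

Definition parallel_set (K : set 'rV[R]_d) (e : R) : set 'rV[R]_d :=
  [set x | exists2 y, K y & enorm (x - y) <= e].

Definition hausdorff_dist (K L : set 'rV[R]_d) : R :=
  inf [set e : R | [/\ 0 <= e, K `<=` parallel_set L e
                    & L `<=` parallel_set K e]].

Definition hausdorff_open : set (set (set 'rV[R]_d)) :=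
  [set U | U `<=` convex_body /\
     forall K, U K -> exists2 e : R, 0 < e &
       forall L, convex_body L -> hausdorff_dist K L < e -> U L].

Definition borel_body : set (set (set 'rV[R]_d)) :=
  <<s convex_body, hausdorff_open >>.

(* The values of [c] outside the convex bodies are irrelevant. *)
Record center_function (c : set 'rV[R]_d -> 'rV[R]_d) : Prop := {
  cf_measurable : forall A : set (borelRV R d), measurable A ->
    borel_body (convex_body `&` c @^-1` A) ;
  cf_in : forall K, convex_body K -> K (c K) ;
  cf_affine : forall K (t : R) (x : 'rV[R]_d), convex_body K -> 0 < t ->
    c [set t *: y + x | y in K] = t *: c K + x
}.

Definition cells (E : set (set 'rV[R]_d)) : set (set 'rV[R]_d) :=
  let U : set 'rV[R]_d := ~` (\bigcup_(H in E) H) in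
  [set K | exists2 x, U x & K = closure (connected_component U x)].

End convex_bodies.

Section typical_cell.
Variables (R : realType) (d : nat) (dO : measure_display).
Variables (Omega : measurableType dO) (P : probability Omega R).
Variables (eta : Omega -> set (set 'rV[R]_d)) (c : set 'rV[R]_d -> 'rV[R]_d).

Definition cell_intensity : \bar R :=
  (\int[P]_w counting [set K | cells (eta w) K /\
     (forall i, 0 <= c K 0 i <= 1)%R])%E.

(* Z is a random element of the space of polytopes with center at the origin;
   it may live on a probability space other than that of the tessellation. *)
Record typical_cell (dZ : measure_display) (OmegaZ : measurableType dZ)
    (PZ : probability OmegaZ R) (Z : OmegaZ -> set 'rV[R]_d) : Prop := {
  tc_polytope : forall w, [/\ convex_body (Z w), polytope (Z w) & c (Z w) = 0] ;
  tc_measurable : forall C, borel_body C -> measurable (Z @^-1` C) ;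
  tc_law : forall (A : set (borelRV R d)) (C : set (set 'rV[R]_d)),
    measurable A -> borel_body C ->
    C `<=` [set K | polytope K /\ c K = 0] ->
    (\int[P]_w counting [set K | [/\ cells (eta w) K,
        C [set (x - c K)%R | x in K] & (A : set 'rV[R]_d) (c K)]])%E =
    (cell_intensity * lebesgueRV A * PZ (Z @^-1` C))%E
}.

End typical_cell.

(* Main.v *)
Require Import Defs.
From HB Require Import structures.
From mathcomp Require Import all_boot all_order all_algebra.
From mathcomp Require Import finmap.
From mathcomp Require Import all_classical all_reals all_analysis.
From mathcomp Require Import measurable_realfun.
From mathcomp Require Import ring lra.

Import Order.TTheory GRing.Theory Num.Theory.
Import numFieldNormedType.Exports.

Local Open Scope classical_set_scope.
Local Open Scope ring_scope.

Set Implicit Arguments.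
Unset Strict Implicit.
Unset Printing Implicit Defensive.


(* Scale lengths by r = n / gamma and let W be a ball of radius C r.  A fixed
   polytope whose n facets are the d faces of a simplicial cone and n - d tangents, at
   the points of a grid of mesh of order n^(-1/(d-1)), to a flat paraboloid
   cutting off the cone keeps its n facets when each of them is moved
   slightly.  All normals lie in the cap where phi is bounded from below, and
   the hyperplanes close to a facet have intensity at least
   c n * mesh^(d-1) * mesh^2, that is, of order n^(-2/(d-1)).  If each of these
   n disjoint classes contains exactly one hyperplane of the process and no
   other hyperplane hits W, then there is a cell with n facets in W; this has
   probability at least e^(-Cn) c^n n^(-2n/(d-1)).  Conversely, the probability
   that f(Z) = n, multiplied by the intensity of the cells with center in W, is
   the mean number of such cells with n facets, and that intensity is at most
   the mean of 2^(number of hyperplanes hitting W), which is at most e^(Cn).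
   The set of bodies with n facets is Borel because the intersections of at
   most n halfspaces are closed under Hausdorff limits. *)

(** A hyperplane has no orientation, so normals from one small cap can bound a polytope: in a chart
    of the cap the hyperplanes are graphs of affine functions over R^(d-1), and the polytope lies
    above the cone faces and below the tangents. The bound [s0] on the slopes is absorbed into the
    vertical unit, so the ideal polytope does not depend on [phi].

    The tolerance mesh^2 comes from the curvature: a tangent at one node passes above another node
    by at least a multiple of mesh^2. Slopes may thus vary by order mesh and levels by order mesh^2.

    The scale n / gamma decides the exponent. At scale 1 / gamma each class would have mean of order
    n^(-1-2/(d-1)), and a factor n^(-n) would be lost. Enlarging lengths by n multiplies each mean
    by n and costs only e^(-Cn), because the mean number of hyperplanes hitting a ball is linear in
    its radius. It also cancels gamma, so the constant depends on d and [phi] alone.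

    The cell intensity and the volume of the window enter only through their product, the mean
    number of centers in the window, of which only an upper bound is used. *)

Section lower_integral.
Context dT (T : measurableType dT) (R : realType).
Variable mu : {measure set T -> \bar R}.
Local Open Scope ereal_scope.

(* The integral of a nonnegative function is a supremum over the simple
   functions below it, so no measurability is needed here. *)
Lemma le_lower_integral (D : set T) (f g : T -> \bar R) :
  (forall x, D x -> 0 <= f x) -> (forall x, D x -> f x <= g x) ->
  \int[mu]_(x in D) f x <= \int[mu]_(x in D) g x.
Proof.
move=> f0 fg; rewrite !ge0_integralE//; last first.
  by move=> x Dx; apply: le_trans (f0 _ Dx) (fg _ Dx).
apply: ereal_sup_le => _ [h hf <-]; exists h => // x.
apply: le_trans (hf x) _; rewrite /patch; case: ifPn => //.
by rewrite inE => /fg.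
Qed.

(** Compares [f] with [c] times the indicator of [A]. The inner integrals to which this is applied
    are not known to be measurable functions of the outer variable. *)
Lemma integral_ge_on (D A : set T) (f : T -> \bar R) (c : R) :
  measurable D -> measurable A -> A `<=` D -> (0 <= c)%R ->
  (forall x, D x -> 0 <= f x) -> (forall x, A x -> c%:E <= f x) ->
  c%:E * mu A <= \int[mu]_(x in D) f x.
Proof.
move=> mD mA AD c0 f0 cf.
apply: (@le_trans _ _ (\int[mu]_(x in D) (c%:E * (\1_A x)%:E))).
  rewrite ge0_integralZl//; last exact/measurable_EFinP.
  by rewrite integral_indic// (_ : A `&` D = A)//; apply/setIidPl.
apply: le_lower_integral => x Dx.
  by rewrite -EFinM lee_fin mulr_ge0.
rewrite indicE -EFinM; have [|xA] := boolP (x \in A); rewrite ?inE.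
  by rewrite mulr1 => /cf.
by rewrite mulr0; exact: f0.
Qed.

Lemma integral_le_on (D A : set T) (f : T -> \bar R) (c : R) :
  measurable D -> measurable A -> (0 <= c)%R ->
  (forall x, D x -> 0 <= f x) -> (forall x, D x -> f x <= c%:E) ->
  (forall x, D x -> ~ A x -> f x = 0) ->
  \int[mu]_(x in D) f x <= c%:E * mu (A `&` D).
Proof.
move=> mD mA c0 f0 fc fA.
apply: (@le_trans _ _ (\int[mu]_(x in D) (c%:E * (\1_A x)%:E))); last first.
  rewrite ge0_integralZl//; last exact/measurable_EFinP.
  by rewrite integral_indic.
apply: le_lower_integral => // x Dx.
rewrite indicE -EFinM; have [|/negP xA] := boolP (x \in A); rewrite ?inE.
  by rewrite mulr1 => _; exact: fc.
by rewrite mulr0 fA// => Ax; apply: xA; rewrite inE.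
Qed.

End lower_integral.

(** * Volumes of cubes *)

Section lebesgueRV.
Variable R : realType.
Local Open Scope ereal_scope.

Lemma lebesgueRV_ge0 d (A : set 'rV[R]_d) : 0 <= lebesgueRV A.
Proof.
elim: d A => [|d ih] A /=; first by rewrite lee_fin.
by apply: integral_ge0 => x _; exact: ih.
Qed.

Lemma le_lebesgueRV d (A B : set 'rV[R]_d) :
  A `<=` B -> lebesgueRV A <= lebesgueRV B.
Proof.
elim: d A B => [|d ih] A B AB /=.
  rewrite lee_fin !indicE ler_nat.
  by have [/set_mem/AB/mem_set->|] := boolP (_ \in A).
apply: le_lower_integral => x _; first exact: lebesgueRV_ge0.
by apply: ih => v; exact: AB.
Qed.

Lemma row_mx_ord0 d (x : R) (v : 'rV[R]_d) :
  (row_mx (x%:M : 'rV[R]_1) v : 'rV[R]_d.+1) 0%R ord0 = x.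
Proof.
rewrite mxE; case: splitP => j //= _.
by rewrite mxE ord1.
Qed.

Lemma row_mx_lift d (x : R) (v : 'rV[R]_d) (k : 'I_d) :
  (row_mx (x%:M : 'rV[R]_1) v : 'rV[R]_d.+1) 0%R (lift ord0 k) = v 0%R k.
Proof.
rewrite mxE; case: splitP => j /=; first by rewrite ord1.
by move=> [kj]; congr (v 0%R _); exact/val_inj.
Qed.

(** Fubini by hand: over an interval of length [l] in the first coordinate every section contains a
    cube, which the induction bounds from below. *)
Lemma lebesgueRV_cube d (v : 'rV[R]_d) (l : R) : (0 <= l)%R ->
  (l ^+ d)%:E <= lebesgueRV [set x | forall k, (v 0 k <= x 0 k <= v 0 k + l)%R].
Proof.
move=> l0; elim: d v => [|d ih] v /=.
  by rewrite expr0 indicE mem_set//= => -[].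
pose I := `[v 0%R ord0, (v 0%R ord0 + l)%R]%classic.
rewrite exprSr EFinM.
have -> : l%:E = lebesgue_measure I.
  rewrite lebesgue_measure_itv/= lte_fin ltrDl.
  case: ltP => [l_gt0|l_le0]; first by rewrite -EFinB addrAC subrr add0r.
  by congr _%:E; apply/eqP; rewrite eq_le l0 l_le0.
apply: integral_ge_on => //.
- exact: measurable_itv.
- exact: exprn_ge0.
- by move=> x _; exact: lebesgueRV_ge0.
move=> x; rewrite /I/= in_itv/= => xI.
apply: le_trans (ih (\row_k v 0%R (lift ord0 k))) _.
apply: le_lebesgueRV => y /= yI k.
have [->|[j ->]] : k = ord0 \/ exists j, k = lift ord0 j.
- by case: (unliftP ord0 k) => [j ->|->]; [right; exists j|left].
- by rewrite row_mx_ord0.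
- by rewrite row_mx_lift; have := yI j; rewrite !mxE.
Qed.

End lebesgueRV.

Section continuous_real.
Variables (R : realType) (T : topologicalType).
Implicit Types f g : T -> R.

(* Quantified over the point: at a fixed one the neighbourhoods of a matrix
   unfold and the pointwise lemmas of the library do not unify. *)
Lemma continuous_addr f g :
  continuous f -> continuous g -> continuous (fun x => f x + g x).
Proof. by move=> cf cg x; exact: continuousD (cf x) (cg x). Qed.

Lemma continuous_mulr f g :
  continuous f -> continuous g -> continuous (fun x => f x * g x).
Proof. by move=> cf cg x; exact: continuousM (cf x) (cg x). Qed.

Lemma continuous_subr f g :
  continuous f -> continuous g -> continuous (fun x => f x - g x).
Proof. by move=> cf cg x; exact: continuousB (cf x) (cg x). Qed.

Lemma continuous_constr (a : R) : continuous (fun _ : T => a).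
Proof. by move=> x; exact: cst_continuous. Qed.

Lemma continuous_sumr (I : Type) (r : seq I) (f : I -> T -> R) :
  (forall i, continuous (f i)) -> continuous (fun x => \sum_(i <- r) f i x).
Proof.
move=> cf; elim: r => [|i r ih].
  by under eq_fun do rewrite big_nil; exact: continuous_constr.
by under eq_fun do rewrite big_cons; exact: continuous_addr.
Qed.

Lemma closed_le_fun f g :
  continuous f -> continuous g -> closed [set x | f x <= g x].
Proof.
move=> cf cg; rewrite (_ : mkset _ = (fun x => f x - g x) @^-1` [set y | y <= 0]).
  apply: preimage_closed; last exact: closed_le.
  by move=> x _; exact: (continuous_subr cf cg).
by apply/seteqP; split => x /=; rewrite subr_le0.
Qed.

Lemma open_lt_fun f g :
  continuous f -> continuous g -> open [set x | f x < g x].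
Proof.
move=> cf cg; rewrite -closedC (_ : ~` _ = [set x | g x <= f x]).
  exact: closed_le_fun.
by apply/seteqP; split => x /=; rewrite leNgt => /negP.
Qed.

End continuous_real.

(** * Euclidean geometry and Borel sets *)

Section euclid.
Variables (R : realType) (d : nat).
Implicit Types x y u v : 'rV[R]_d.

Lemma dotpC x y : dotp x y = dotp y x.
Proof. by apply: eq_bigr => i _; rewrite mulrC. Qed.

Lemma dotpDl x y u : dotp (x + y) u = dotp x u + dotp y u.
Proof. by rewrite -big_split; apply: eq_bigr => i _; rewrite mxE mulrDl. Qed.

Lemma dotpZl (s : R) x u : dotp (s *: x) u = s * dotp x u.
Proof. by rewrite /dotp mulr_sumr; apply: eq_bigr => i _; rewrite mxE mulrA. Qed.

Lemma dotpDr x y u : dotp u (x + y) = dotp u x + dotp u y.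
Proof. by rewrite !(dotpC u) dotpDl. Qed.

Lemma dotpZr (s : R) x u : dotp u (s *: x) = s * dotp u x.
Proof. by rewrite !(dotpC u) dotpZl. Qed.

Lemma dotpNr x u : dotp u (- x) = - dotp u x.
Proof. by rewrite -scaleN1r dotpZr mulN1r. Qed.

Lemma dotpNl x u : dotp (- x) u = - dotp x u.
Proof. by rewrite -scaleN1r dotpZl mulN1r. Qed.

Lemma dotpBr x y u : dotp u (x - y) = dotp u x - dotp u y.
Proof. by rewrite dotpDr dotpNr. Qed.

Lemma dotpBl x y u : dotp (x - y) u = dotp x u - dotp y u.
Proof. by rewrite dotpDl dotpNl. Qed.

Lemma dotp0r u : dotp u 0 = 0.
Proof. by rewrite /dotp big1// => i _; rewrite mxE mulr0. Qed.

Lemma dotp0l u : dotp 0 u = 0.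
Proof. by rewrite dotpC dotp0r. Qed.

Lemma dotp_deltal k x : dotp (delta_mx 0 k) x = x 0 k.
Proof.
rewrite /dotp (bigD1 k)//= mxE !eqxx mul1r big1 ?addr0// => i ik.
by rewrite mxE (negbTE ik) andbF mul0r.
Qed.

Lemma dotp_ge0 x : 0 <= dotp x x.
Proof. by apply: sumr_ge0 => i _; rewrite -expr2 sqr_ge0. Qed.

Lemma dotp_eq0 x : (dotp x x == 0) = (x == 0).
Proof.
apply/eqP/eqP => [|->]; last by rewrite dotp0r.
move/eqP; rewrite psumr_eq0 => [/allP h|i _]; last by rewrite -expr2 sqr_ge0.
apply/rowP => i; rewrite mxE; have := h i (mem_index_enum i).
by rewrite /= mulf_eq0 orbb => /eqP.
Qed.

Lemma sqr_enorm x : enorm x ^+ 2 = dotp x x.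
Proof. by rewrite sqr_sqrtr// dotp_ge0. Qed.

Lemma enorm_ge0 x : 0 <= enorm x. Proof. exact: sqrtr_ge0. Qed.

Lemma enorm_gt0 x : (0 < enorm x) = (x != 0).
Proof. by rewrite sqrtr_gt0 lt_def dotp_ge0 dotp_eq0 andbT. Qed.

Lemma enormZ (s : R) x : enorm (s *: x) = `|s| * enorm x.
Proof.
by rewrite /enorm dotpZl dotpZr mulrA -expr2 sqrtrM ?sqr_ge0// sqrtr_sqr.
Qed.

Lemma enormN x : enorm (- x) = enorm x.
Proof. by rewrite -scaleN1r enormZ normrN1 mul1r. Qed.

Lemma coord_le_enorm x k : `|x 0 k| <= enorm x.
Proof.
rewrite -sqrtr_sqr ler_wsqrtr// /dotp (bigD1 k)//= -expr2 lerDl.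
by apply: sumr_ge0 => i _; rewrite -expr2 sqr_ge0.
Qed.

Lemma enorm_le_sum x : enorm x <= \sum_k `|x 0 k|.
Proof.
have s0 (P : pred 'I_d) : 0 <= \sum_(k | P k) `|x 0 k| by exact: sumr_ge0.
rewrite -(@ler_pXn2r _ 2)// ?nnegrE ?enorm_ge0// sqr_enorm expr2 /dotp mulr_suml.
apply: ler_sum => i _.
rewrite -expr2 -[leLHS]real_normK ?num_real// expr2 ler_wpM2l//.
by rewrite (bigD1 i)//= lerDl.
Qed.

Lemma norm_dotp_le x y : `|dotp x y| <= (\sum_k `|x 0 k|) * enorm y.
Proof.
apply: le_trans (ler_norm_sum _ _ _) _; rewrite mulr_suml.
by apply: ler_sum => i _; rewrite normrM ler_wpM2l// coord_le_enorm.
Qed.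

Lemma enorm_sphere_neq0 u : sphere u -> u != 0.
Proof. by move=> u1; rewrite -enorm_gt0 u1. Qed.

Lemma dotp_continuous y : continuous (fun x => dotp x y).
Proof.
apply: continuous_sumr => i; apply: continuous_mulr.
  exact: coord_continuous.
exact: continuous_constr.
Qed.

Lemma enorm_continuous : continuous (@enorm R d).
Proof.
move=> x; apply: (@continuous_comp _ _ _ (fun x => dotp x x) Num.sqrt);
  last exact: sqrt_continuous.
move: x; apply: continuous_sumr => i.
by apply: continuous_mulr; exact: coord_continuous.
Qed.

Lemma open_borelRV (A : set 'rV[R]_d) : open A -> measurable (A : set (borelRV R d)).
Proof. exact: sub_sigma_algebra. Qed.

Lemma closed_borelRV (A : set 'rV[R]_d) :
  closed A -> measurable (A : set (borelRV R d)).
Proof.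
move=> Ac; rewrite -[A]setCK; apply: measurableC; apply: open_borelRV.
exact: closed_openC.
Qed.

Lemma sphere_measurable : measurable (@sphere R d : set (borelRV R d)).
Proof.
apply: closed_borelRV; rewrite (_ : @sphere R d = @enorm R d @^-1` [set 1])//.
apply: preimage_closed => [x _|]; [exact: enorm_continuous|exact: closed_eq].
Qed.

End euclid.

(** * Hyperplanes with normals in a cap *)

Section chart.
Variables (R : realType) (q : nat).
Implicit Types (x u w : 'rV[R]_q.+1) (z c p : 'rV[R]_q).

(** Affine chart of directions: if the first coordinate of [w] is nonzero, every vector with nonzero
    first coordinate is a multiple of exactly one [tilt w z]. Normals are left unnormalized to keep
    the chart affine. *)
Definition tilt w z : 'rV[R]_q.+1 := w + row_mx (0%:M : 'rV[R]_1) z.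

Lemma tilt_ord0 w z : tilt w z 0 ord0 = w 0 ord0.
Proof. by rewrite mxE row_mx_ord0 addr0. Qed.

Lemma tilt_lift w z k : tilt w z 0 (lift ord0 k) = w 0 (lift ord0 k) + z 0 k.
Proof. by rewrite mxE row_mx_lift. Qed.

Lemma rowP1 x u : x 0 ord0 = u 0 ord0 ->
  (forall k : 'I_q, x 0 (lift ord0 k) = u 0 (lift ord0 k)) -> x = u.
Proof.
move=> h0 h; apply/rowP => i.
by case: (unliftP ord0 i) => [j ->|->].
Qed.

Definition base x : 'rV[R]_q := \row_k x 0 (lift ord0 k).

Lemma dotp_tilt x w z : dotp x (tilt w z) = dotp x w + dotp (base x) z.
Proof.
rewrite dotpDr; congr (_ + _); rewrite /dotp big_ord_recl row_mx_ord0 mulr0 add0r.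
by apply: eq_bigr => k _; rewrite row_mx_lift mxE.
Qed.

(* The unit normals proportional to [tilt w z] with [z] in a cube. *)
Definition dirs w c (l : R) : set 'rV[R]_q.+1 :=
  [set u | [/\ sphere u, 0 < u 0 ord0 / w 0 ord0
    & forall k, c 0 k * (u 0 ord0 / w 0 ord0)
         <= u 0 (lift ord0 k) - w 0 (lift ord0 k) * (u 0 ord0 / w 0 ord0)
         <= (c 0 k + l) * (u 0 ord0 / w 0 ord0)]].

Lemma dirs_measurable w c l : measurable (dirs w c l : set (borelRV R q.+1)).
Proof.
have cc i : continuous (fun u : 'rV[R]_q.+1 => u 0 i) by exact: coord_continuous.
have ca (s : R) : continuous (fun u : 'rV[R]_q.+1 => s * (u 0 ord0 / w 0 ord0)).
  apply: continuous_mulr; first exact: continuous_constr.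
  by apply: continuous_mulr; [exact: cc|exact: continuous_constr].
have cb k : continuous (fun u : 'rV[R]_q.+1 => u 0 (lift ord0 k) -
    w 0 (lift ord0 k) * (u 0 ord0 / w 0 ord0)).
  by apply: continuous_subr; [exact: cc|exact: ca].
rewrite (_ : dirs w c l = @sphere R q.+1 `&` ([set u | 0 < 1 * (u 0 ord0 / w 0 ord0)] `&`
  \bigcap_(k in [set: 'I_q]) ([set u | c 0 k * (u 0 ord0 / w 0 ord0)
         <= u 0 (lift ord0 k) - w 0 (lift ord0 k) * (u 0 ord0 / w 0 ord0)] `&`
   [set u | u 0 (lift ord0 k) - w 0 (lift ord0 k) * (u 0 ord0 / w 0 ord0)
         <= (c 0 k + l) * (u 0 ord0 / w 0 ord0)]))).
  apply: measurableI; first exact: sphere_measurable.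
  apply: measurableI.
    by apply: open_borelRV; apply: open_lt_fun => //; exact: continuous_constr.
  apply: fin_bigcap_measurable; first exact: finite_finset.
  move=> k _; apply: measurableI; apply: closed_borelRV; exact: closed_le_fun.
apply/seteqP; split => u /=.
  move=> [h1 h2 h3]; split => //; split; first by rewrite mul1r.
  by move=> k _; have /andP[] := h3 k.
move=> [h1 [h2 h3]]; split => //; first by rewrite mul1r in h2.
by move=> k; apply/andP; exact: h3.
Qed.
End chart.

Section chart_measure.
Variables (R : realType) (q : nat).
Implicit Types (x u v w : 'rV[R]_q.+1) (z c p : 'rV[R]_q).

Definition cube c (l : R) : set 'rV[R]_q :=
  [set z | forall k, c 0 k <= z 0 k <= c 0 k + l].

Definition unit_tilt w z : 'rV[R]_q.+1 := (enorm (tilt w z))^-1 *: tilt w z.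

Lemma tilt_dirs w c l z : w 0 ord0 != 0 -> 0 < enorm (tilt w z) ->
  cube c l z -> dirs w c l (unit_tilt w z).
Proof.
move=> w0 n0 zc; have n1 := n0; rewrite -invr_gt0 in n1.
have aE : unit_tilt w z 0 ord0 / w 0 ord0 = (enorm (tilt w z))^-1.
  by rewrite mxE tilt_ord0 mulfK.
split => [||k]; rewrite ?aE//.
  by rewrite /sphere/= enormZ gtr0_norm// mulVf// gt_eqF.
rewrite mxE tilt_lift [_^-1 * _]mulrC -mulrBl [w 0 _ + _]addrC addrK.
by rewrite !ler_pM2r//; exact: zc.
Qed.

Lemma dirs_tilt w c l u : w 0 ord0 != 0 -> dirs w c l u ->
  exists z, [/\ cube c l z, 0 < enorm (tilt w z) & u = unit_tilt w z].
Proof.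
move=> w0 [u1 a0 uc]; set a := u 0 ord0 / w 0 ord0 in a0 uc.
pose z : 'rV[R]_q := \row_k (u 0 (lift ord0 k) / a - w 0 (lift ord0 k)).
have uE : u = a *: tilt w z.
  apply: rowP1 => [|k]; rewrite mxE ?tilt_ord0 ?tilt_lift ?mxE.
    by rewrite /a divfK.
  by rewrite addrC subrK mulrC divfK// gt_eqF.
have nE : a * enorm (tilt w z) = 1.
  by rewrite -[a in LHS]gtr0_norm// -enormZ -uE.
have aE : a = (enorm (tilt w z))^-1.
  apply: (@mulIf _ (enorm (tilt w z))); last rewrite nE mulVf//.
    by apply: contra_eq_neq nE => ->; rewrite mulr0 eq_sym oner_eq0.
  by apply: contra_eq_neq nE => ->; rewrite mulr0 eq_sym oner_eq0.
exists z; split.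
- move=> k; rewrite mxE.
  have /andP[h1 h2] := uc k.
  by apply/andP; split; rewrite -(ler_pM2r a0) mulrBl divfK ?gt_eqF.
- by rewrite -invr_gt0 -aE.
- by rewrite /unit_tilt -aE.
Qed.

Lemma tilt_cap v (r : R) : sphere v -> 0 < r ->
  exists w (rho : R), [/\ w 0 ord0 != 0, 0 < rho
    & forall z, (forall k, `|z 0 k| <= rho) ->
        0 < enorm (tilt w z) /\ cap v r (unit_tilt w z)].
Proof.
move=> v1 r0.
pose h x : R := \sum_k `|x 0 k - enorm x * v 0 k|.
have hc : continuous h.
  apply: continuous_sumr => k.
  have cf : continuous (fun x => x 0 k - enorm x * v 0 k).
    apply: continuous_subr; first exact: coord_continuous.
    apply: continuous_mulr; first exact: enorm_continuous.
    exact: continuous_constr.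
  move=> x; apply: (@continuous_comp _ _ _ _ (fun y : R => `|y|) x (cf x)).
  exact: norm_continuous.
have o1 : open ([set x | h x < r / 2] `&` [set x | 1 / 2 < enorm x]).
  apply: openI; apply: open_lt_fun => //; first exact: continuous_constr.
    exact: continuous_constr.
  exact: enorm_continuous.
have : nbhs v ([set x | h x < r / 2] `&` [set x | 1 / 2 < enorm x]).
  apply: open_nbhs_nbhs; split => //; split => /=; last by rewrite v1; lra.
  rewrite /h big1 ?divr_gt0// => k _; rewrite v1 mul1r subrr normr0 //.
move=> /nbhs_ballP[e e0 eb].
have e0' : 0 < e by [].
(* The chart needs a nonzero first coordinate. If that of [v] vanishes, [w] moves away by half of
   the radius [e], and [e / 3] remains for [z]. *)
pose w := if v 0 ord0 != 0 then v else v + (e / 2) *: delta_mx 0 ord0.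
have wv k : `|v 0 k - w 0 k| <= e / 2.
  rewrite /w; case: ifPn => _; first by rewrite subrr normr0 divr_ge0// ltW.
  rewrite !mxE opprD addrA subrr sub0r normrN eqxx /=.
  have e2 : 0 <= e / 2 by rewrite divr_ge0// ltW.
  by case: (k == ord0); [rewrite mulr1 (ger0_norm e2)|rewrite mulr0 normr0].
exists w, (e / 3); split.
- rewrite /w; case: ifPn => // /negPn/eqP v0.
  by rewrite !mxE v0 add0r !eqxx mulr1 gt_eqF// divr_gt0.
- by rewrite divr_gt0.
move=> z zr.
have : ball v e (tilt w z).
  split => // i j; rewrite ord1 /ball/=.
  case: (unliftP ord0 j) => [k ->|->].
    rewrite tilt_lift opprD addrA; apply: le_lt_trans (ler_normB _ _) _.
    apply: le_lt_trans (lerD (wv _) (zr k)) _; lra.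
  by rewrite tilt_ord0; apply: le_lt_trans (wv _) _; lra.
move=> /eb [/= h1 h2]; set t := tilt w z in h1 h2 *.
have t0 : 0 < enorm t by apply: lt_trans h2; lra.
split => //; split; first by rewrite /sphere/= enormZ gtr0_norm ?invr_gt0// mulVf// gt_eqF.
apply: le_trans (enorm_le_sum _) _.
have -> : \sum_k `|(unit_tilt w z - v) 0 k| = (enorm t)^-1 * h t.
  rewrite /h mulr_sumr; apply: eq_bigr => k _.
  rewrite -[X in X * _](@gtr0_norm _ (enorm t)^-1) ?invr_gt0// -normrM.
  by rewrite mulrBr !mxE mulKf// gt_eqF.
rewrite mulrC ler_pdivrMr//; apply: ltW; apply: lt_trans h1 _.
by rewrite ltr_pM2l// -[X in X < _]mul1r.
Qed.

Lemma le_enorm_tilt w (rho : R) z : 0 <= rho -> (forall k, `|z 0 k| <= rho) ->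
  enorm (tilt w z) <= \sum_k (`|w 0 k| + rho).
Proof.
move=> r0 zr; apply: le_trans (enorm_le_sum _) _; apply: ler_sum => i _.
case: (unliftP ord0 i) => [k ->|->]; last by rewrite tilt_ord0 lerDl.
by rewrite tilt_lift; apply: le_trans (ler_normD _ _) _; rewrite lerD2l.
Qed.

(** The cone over [dirs] contains [t *: tilt w z] for [0 < t <= M^-1] and [z] in the cube, so its
    section at first coordinate [t * w 0 ord0] contains a cube of side [t * l]. The sections with
    [t] between [t0 / 2] and [t0] give enough volume. *)
Lemma surface_area_dirs w (rho : R) : w 0 ord0 != 0 -> 0 < rho ->
  (forall z, (forall k, `|z 0 k| <= rho) -> 0 < enorm (tilt w z)) ->
  exists2 a : R, 0 < a & forall c (l : R), 0 <= l ->
    (forall k, - rho <= c 0 k /\ c 0 k + l <= rho) ->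
    ((a * l ^+ q)%:E <= surface_area (dirs w c l))%E.
Proof.
move=> w0 r0 wr.
pose M : R := \sum_k (`|w 0 k| + rho).
have z0 k : `|(0 : 'rV[R]_q) 0 k| <= rho by rewrite mxE normr0 ltW.
have M0 : 0 < M by exact: lt_le_trans (wr 0 z0) (le_enorm_tilt w (ltW r0) z0).
pose t0 : R := M^-1; have t00 : 0 < t0 by rewrite invr_gt0.
pose b : R := `|w 0 ord0| * t0 / 2.
have b0 : 0 < b by rewrite divr_gt0// mulr_gt0// normr_gt0.
exists ((t0 / 2) ^+ q * b); first by rewrite mulr_gt0// exprn_gt0// divr_gt0.
move=> c l l0 cr.
rewrite /surface_area -[leLHS]mul1e; apply: lee_pmul => //.
- by rewrite lee_fin !mulr_ge0// ?exprn_ge0// ?divr_ge0// ltW.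
- by rewrite lee_fin ler1n.
(* Centred at [3 / 4 * w 0 ord0 * t0], the interval corresponds to [t] in [[t0 / 2, t0]] for either
   sign of [w 0 ord0]. *)
pose y0 : R := 3 / 4 * w 0 ord0 * t0 - b / 2.
pose I := `[y0, y0 + b]%classic.
have -> : ((t0 / 2) ^+ q * b * l ^+ q)%:E = (((t0 / 2 * l) ^+ q)%:E * lebesgue_measure I)%E.
  rewrite lebesgue_measure_itv/= lte_fin ltrDl b0 -EFinB addrAC subrr add0r.
  by rewrite -EFinM; congr _%:E; rewrite [in RHS]exprMn mulrAC.
apply: integral_ge_on => //.
- exact: measurable_itv.
- by rewrite exprn_ge0// mulr_ge0// divr_ge0// ltW.
- by move=> x _; exact: lebesgueRV_ge0.
move=> x; rewrite /I/= in_itv/= => xI.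
pose t : R := x / w 0 ord0.
have tb : `|t - 3 / 4 * t0| <= t0 / 4.
  have -> : t - 3 / 4 * t0 = (x - 3 / 4 * w 0 ord0 * t0) / w 0 ord0.
    by rewrite /t; field.
  rewrite normrM normfV ler_pdivrMr ?normr_gt0// ler_distl.
  have -> : t0 / 4 * `|w 0 ord0| = b / 2 by rewrite /b; field.
  by move: xI; rewrite /y0; lra.
have /andP[t1 t2] : t0 / 2 <= t <= t0 by move: tb; rewrite ler_distl; lra.
have tp : 0 < t by apply: lt_le_trans t1; rewrite divr_gt0.
have t2l : 0 <= t0 / 2 * l by rewrite mulr_ge0// divr_ge0// ltW.
apply: le_trans (lebesgueRV_cube (t *: (base w + c)) t2l) _.
apply: le_lebesgueRV => y yc.
pose z := t^-1 *: y - base w.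
have zc : cube c l z.
  move=> k; have := yc k; rewrite !mxE => /andP[h1 h2].
  have yt : y 0 k = t * (t^-1 * y 0 k) by rewrite mulVKf ?gt_eqF.
  apply/andP; split; rewrite -(ler_pM2l tp) mulrBr -yt; first by rewrite lerBrDl -mulrDr.
  rewrite lerBlDl; apply: le_trans h2 _.
  by rewrite !mulrDr addrA lerD2l ler_wpM2r.
have zr k : `|z 0 k| <= rho.
  by have := cr k; have := zc k; rewrite ler_norml; lra.
have n0 := wr z zr.
exists (t * enorm (tilt w z)), (unit_tilt w z); split.
- rewrite mulr_gt0//=; apply: (@le_trans _ _ (t0 * M)).
    by apply: ler_pM => //; [exact: ltW|exact: enorm_ge0|exact: le_enorm_tilt (ltW r0) zr].
  by rewrite mulVf// gt_eqF.
- exact: tilt_dirs.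
rewrite /unit_tilt scalerA mulfK ?gt_eqF//.
apply: rowP1 => [|k]; rewrite ?row_mx_ord0 ?row_mx_lift mxE ?tilt_ord0 ?tilt_lift.
  by rewrite divfK.
by rewrite !mxE addrCA subrr addr0 mulVKf// gt_eqF.
Qed.

(** For a fixed [z] the levels fill an interval of length [dl], and still at least [dl / M] once the
    normal is normalized. The start [s z] may vary with [z], which lets the hyperplanes turn about a
    prescribed point; it is positive because [hyperplane_measure] sees only positive levels. *)
Lemma hyperplane_measure_ge (phi : probability (borelRV R q.+1) R) :
  well_spread phi -> exists w (rho a : R),
    [/\ w 0 ord0 != 0, 0 < rho, 0 < a &
     forall c (l dl : R) (s : 'rV[R]_q -> R) (B : set (set 'rV[R]_q.+1)),
       0 <= l -> 0 <= dl ->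
       (forall k, - rho <= c 0 k /\ c 0 k + l <= rho) ->
       (forall z, cube c l z -> 0 < s z) ->
       (forall z s', cube c l z -> s z <= s' <= s z + dl ->
          B [set x | dotp x (tilt w z) = s']) ->
       ((a * l ^+ q * dl)%:E <= hyperplane_measure phi B)%E].
Proof.
move=> [v [r [a [v1 r0 a0 phia]]]].
have [w [rho [w0 rho0 wr]]] := tilt_cap v1 r0.
have [z zr|a1 a10 surf] := surface_area_dirs w0 rho0; first by have [] := wr z zr.
pose M : R := \sum_k (`|w 0 k| + rho).
have z0 k : `|(0 : 'rV[R]_q) 0 k| <= rho by rewrite mxE normr0 ltW.
have M0 : 0 < M by exact: lt_le_trans (wr 0 z0).1 (le_enorm_tilt w (ltW rho0) z0).
exists w, rho, (a * a1 / M); split => //; first by rewrite divr_gt0// mulr_gt0.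
move=> c l dl s B l0 dl0 cr s0 BH.
have zcr z : cube c l z -> forall k, `|z 0 k| <= rho.
  by move=> zc k; have := cr k; have := zc k; rewrite ler_norml; lra.
have mD := dirs_measurable w c l.
have phiD : ((a * (a1 * l ^+ q))%:E <= phi (dirs w c l))%E.
  apply: le_trans (phia _ mD _).
    by rewrite EFinM lee_pmul2l//; exact: surf.
  by move=> u /(dirs_tilt w0)[z [zc n0 ->]]; apply: (wr z _).2; exact: zcr.
have -> : a * a1 / M * l ^+ q * dl = dl / M * (a * (a1 * l ^+ q)) by ring.
have dM : 0 <= dl / M by rewrite divr_ge0// ltW.
apply: (@le_trans _ _ ((dl / M)%:E * phi (dirs w c l))%E).
  by rewrite EFinM lee_wpmul2l.
apply: integral_ge_on => //.
- exact: sphere_measurable.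
- by move=> u [].
- by move=> u _; apply: integral_ge0.
move=> u /(dirs_tilt w0)[z [zc n0 uE]].
have nM : enorm (tilt w z) <= M by apply: le_enorm_tilt (ltW rho0) (zcr _ zc).
pose n := enorm (tilt w z).
pose I := `[s z / n, (s z + dl) / n]%classic.
apply: (@le_trans _ _ (1%:E * lebesgue_measure I)%E).
  rewrite mul1e lebesgue_measure_itv/= lte_fin ltr_pM2r ?invr_gt0// ltrDl.
  case: ltP => h.
    rewrite -EFinB lee_fin -mulrBl addrAC subrr add0r ler_wpM2l//.
    by rewrite lef_pV2.
  have -> : dl = 0 by apply/eqP; rewrite eq_le h dl0.
  by rewrite mul0r.
apply: integral_ge_on => //.
- exact: measurable_itv.
- move=> t; rewrite /I/= !in_itv/= andbT => /andP[+ _]; apply: lt_le_trans.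
  by rewrite divr_gt0// s0.
move=> t; rewrite /I/= in_itv/= => tI.
rewrite indicE mem_set//.
have -> : hplane u t = [set x | dotp x (tilt w z) = t * n].
  apply/seteqP; split => x; rewrite /hplane/= uE dotpZr.
    by move=> <-; rewrite mulrAC mulVf ?mul1r// gt_eqF.
  by move=> ->; rewrite mulrCA mulVf ?mulr1// gt_eqF.
apply: BH => //.
by rewrite -ler_pdivrMr// -[_ <= s z + dl]ler_pdivlMr.
Qed.

End chart_measure.

(** * Sigma-algebras on a set, and counting *)

Section sigma_algebra_on.
Variables (T : Type) (D : set T) (G : set (set T)).

Lemma sigma_algebra_onU (A B : set T) :
  <<s D, G >> A -> <<s D, G >> B -> <<s D, G >> (A `|` B).
Proof.
move=> sA sB; rewrite (_ : _ `|` _ = \bigcup_k (if k is 0 then A else B)).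
  by apply: sigma_algebra_bigcup => -[|k].
apply/seteqP; split => [x [Ax|Bx]|x [[|k] _]]; [by exists 0%N|by exists 1%N| |].
  by left.
by right.
Qed.

Lemma sigma_algebra_onD (A B : set T) : A `<=` D ->
  <<s D, G >> A -> <<s D, G >> B -> <<s D, G >> (A `\` B).
Proof.
move=> AD sA sB; rewrite (_ : A `\` B = D `\` ((D `\` A) `|` B)).
  apply: sigma_algebraCD; apply: sigma_algebra_onU => //; exact: sigma_algebraCD.
apply/seteqP; split => [x [Ax nB]|x [Dx h]].
  by split; [exact: AD|move=> [[]|]].
split; first by apply: contrapT => nA; apply: h; left.
by move=> Bx; apply: h; right.
Qed.

Lemma sigma_algebra_onI (A B : set T) : A `<=` D ->
  <<s D, G >> A -> <<s D, G >> B -> <<s D, G >> (A `&` B).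
Proof.
move=> AD sA sB; rewrite -setDD.
by apply: sigma_algebra_onD => //; exact: sigma_algebra_onD.
Qed.

Lemma sigma_algebra_on_bigcupfin (n : nat) (B : 'I_n -> set T) :
  (forall i, <<s D, G >> (B i)) -> <<s D, G >> (\bigcup_(i in [set: 'I_n]) B i).
Proof.
move=> sB.
rewrite (_ : \bigcup_(i in _) _ =
  \bigcup_k (if insub k is Some i then B i else set0)).
  apply: sigma_algebra_bigcup => k; case: insubP => [i _ _|_]; first exact: sB.
  exact: sigma_algebra0.
apply/seteqP; split => [x [i _ Bi]|x [k _]].
  by exists (val i) => //; rewrite valK.
by case: insubP => // i _ _ Bi; exists i.
Qed.

End sigma_algebra_on.

Lemma sigma_algebra_sub (T : Type) (D : set T) (G : set (set T)) :
  (forall A, G A -> A `<=` D) -> forall A, <<s D, G >> A -> A `<=` D.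
Proof.
move=> GD A /(_ [set B | B `<=` D]); apply; split => //; split => //.
  by move=> B _ x [].
by move=> B BD x [k _]; exact: BD.
Qed.

Section counting.
Variables (R : realType) (T : choiceType).
Local Open Scope ereal_scope.

Lemma counting_ge0 (A : set T) : 0 <= counting A :> \bar R.
Proof. by rewrite /counting; case: ifP. Qed.

Lemma countingP (A : set T) :
  counting A = +oo :> \bar R \/
  exists2 k : nat, counting A = k%:R%:E :> \bar R & finite_set A.
Proof.
rewrite /counting; case: asboolP => fA; [right|by left].
by exists #|` fset_set A|.
Qed.

Lemma counting_finite (A : set T) (k : nat) :
  (counting A = k%:R%:E :> \bar R) <-> (A #= `I_k)%card.
Proof.
rewrite /counting; case: asboolP => [fA|nfA].
  split => [[] /eqP|Ak]; last by rewrite (card_fset_set Ak).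
  by rewrite eqr_nat => /eqP kE; rewrite -(fset_setK fA); apply/card_eq_fsetP.
split => // Ak; case: nfA; exists k; exact: Ak.
Qed.

End counting.

(** * Poisson processes *)

Section poisson.
Variable R : realType.
Local Open Scope ereal_scope.

Lemma poisson_prob_set1 (m : R) (k : nat) : (0 <= m)%R ->
  poisson_prob m 0 [set k] = (m ^+ k / k`!%:R * expR (- m))%:E.
Proof.
rewrite le_eqVlt => /predU1P[<-|m0]; rewrite /poisson_prob.
  rewrite ltxx diracE oppr0 expR0 mulr1; case: k => [|k].
    by rewrite mem_set// expr0 fact0 divr1.
  by rewrite memNset// exprS !mul0r.
by rewrite m0 esum_set1 ?lee_fin ?poisson_pmf_ge0// /poisson_pmf m0.
Qed.

Lemma nneseries_poisson (m : R) :
  \sum_(k <oo) poisson_prob m 0 [set k] = 1.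
Proof.
rewrite -measure_semi_bigcup//=.
  rewrite (_ : \bigcup_(n in _) [set n] = setT) ?probability_setT//.
  by apply/seteqP; split => // k _; exists k.
by apply/trivIsetP => i j _ _ /eqP ij; apply/seteqP; split => // x [-> ] /ij.
Qed.

End poisson.

Section poisson_process.
Context (R : realType) (d : nat) (phi : probability (borelRV R d) R) (gamma : R).
Context (dO : measure_display) (Omega : measurableType dO).
Variables (P : probability Omega R) (eta : Omega -> set (set 'rV[R]_d)).
Hypothesis etaP : poisson_hyperplane_process phi gamma P eta.
Hypothesis gamma0 : 0 < gamma.
Local Open Scope ereal_scope.

Let N B w : \bar R := counting (eta w `&` B).
Let m B : R := fine (gamma%:E * hyperplane_measure phi B).

Let expr_fact0 (x y : R) : (x ^+ 0 / 0`!%:R * y = y)%R.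
Proof. by rewrite expr0 fact0 divr1 mul1r. Qed.

Let expr_fact1 (x y : R) : (x ^+ 1 / 1`!%:R * y = x * y)%R.
Proof. by rewrite expr1 factS fact0 muln1 divr1. Qed.

Lemma hyperplane_measure_ge0 B : 0 <= hyperplane_measure phi B.
Proof.
by apply: integral_ge0 => u _; apply: integral_ge0 => t _; rewrite lee_fin.
Qed.

Lemma le_hyperplane_measure A B : A `<=` B ->
  hyperplane_measure phi A <= hyperplane_measure phi B.
Proof.
move=> AB; apply: le_lower_integral => u _.
  by apply: integral_ge0 => t _; rewrite lee_fin.
apply: le_lower_integral => t _; first by rewrite lee_fin.
rewrite lee_fin !indicE ler_nat.
by have [/set_mem/AB/mem_set->|] := boolP (_ \in A).
Qed.

Lemma borel_hyperplane_sub B : borel_hyperplane B -> B `<=` @hyperplane R d.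
Proof.
by apply: sigma_algebra_sub => A [[C _ ->]|[G _ ->]] H [].
Qed.

Lemma measurable_count B k : borel_hyperplane B -> measurable [set w | N B w = k%:R%:E].
Proof.
move=> bB; have := php_measurable etaP bB.
by move=> /(_ measurableT [set k%:R%:E]); rewrite setTI; apply.
Qed.

Let mean_ge0 B : (0 <= m B)%R.
Proof.
by rewrite fine_ge0// mule_ge0 ?hyperplane_measure_ge0// lee_fin ltW.
Qed.

Let count_prob B k : borel_hyperplane B ->
  gamma%:E * hyperplane_measure phi B < +oo ->
  P (N B @^-1` [set k%:R%:E]) = (m B ^+ k / k`!%:R * expR (- m B))%:E.
Proof.
move=> bB fB; rewrite -[_ @^-1` _]/[set w | N B w = k%:R%:E].
by rewrite (php_poisson etaP bB fB) poisson_prob_set1// mean_ge0.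
Qed.

(** The remainder [V] of [W] becomes one more class, of index [ord0], that has to be empty. The
    weights are [m * expR (- m)] for one point and [expR (- m)] for none, and the exponentials
    multiply to that of [W]. *)
Lemma prob_one_each (n : nat) (B : 'I_n -> set (set 'rV[R]_d)) W :
  borel_hyperplane W -> (forall i, borel_hyperplane (B i)) ->
  (forall i, B i `<=` W) -> trivIset [set: 'I_n] B ->
  gamma%:E * hyperplane_measure phi W < +oo ->
  measurable [set w | (forall i, N (B i) w = 1) /\
    N (W `\` \bigcup_(i in [set: 'I_n]) B i) w = 0] /\
  P [set w | (forall i, N (B i) w = 1) /\
    N (W `\` \bigcup_(i in [set: 'I_n]) B i) w = 0] =
  (expR (- m W) * \prod_(i < n) m (B i))%:E.
Proof.
move=> bW bB BW tB fW.
pose V := W `\` \bigcup_(i in [set: 'I_n]) B i.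
pose C (i : 'I_n.+1) := if unlift ord0 i is Some j then B j else V.
have C0 : C ord0 = V by rewrite /C unlift_none.
have CS j : C (lift ord0 j) = B j by rewrite /C liftK.
have bV : borel_hyperplane V.
  apply: sigma_algebra_onD => //; first exact: borel_hyperplane_sub.
  exact: sigma_algebra_on_bigcupfin.
have bC i : borel_hyperplane (C i) by rewrite /C; case: unlift.
have CW i : C i `<=` W.
  by rewrite /C; case: unlift => [j|]; [exact: BW|exact: subDsetl].
have fC i : gamma%:E * hyperplane_measure phi (C i) < +oo.
  apply: le_lt_trans fW; apply: lee_wpmul2l; first by rewrite lee_fin ltW.
  exact: le_hyperplane_measure.
have tC : trivIset [set: 'I_n.+1] C.
  apply/trivIsetP => i j _ _; rewrite /C.
  case: (unliftP ord0 i) => [i' ->|->]; case: (unliftP ord0 j) => [j' ->|->].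
  - rewrite (inj_eq lift_inj) => ij; have /trivIsetP := tB; exact.
  - by move=> _; apply/seteqP; split => // x [Bx [_ []]]; exists i'.
  - by move=> _; apply/seteqP; split => // x [[_ h] Bx]; apply: h; exists j'.
  - by rewrite eqxx.
have ind S := php_independent etaP bC tC (S := S).
have Pall (k : 'I_n.+1 -> nat) :
    P (\bigcap_(i in [set: 'I_n.+1]) (N (C i) @^-1` [set (k i)%:R%:E])) =
    \prod_(i < n.+1) (m (C i) ^+ k i / (k i)`!%:R * expR (- m (C i)))%:E.
  rewrite (ind (fun i => [set (k i)%:R%:E]))//.
  by apply: eq_bigr => i _; exact: (count_prob (k i) (bC i) (fC i)).
pose k (i : 'I_n.+1) : nat := if unlift ord0 i is Some j then 1%N else 0%N.
have k0 : k ord0 = 0%N by rewrite /k unlift_none.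
have kS j : k (lift ord0 j) = 1%N by rewrite /k liftK.
have E1 : [set w | (forall i, N (B i) w = 1) /\ N V w = 0] =
    \bigcap_(i in [set: 'I_n.+1]) (N (C i) @^-1` [set (k i)%:R%:E]).
  apply/seteqP; split => [w [h1 h2] i _ /=|w h].
    by case: (unliftP ord0 i) => [j ->|->]; rewrite ?CS ?kS ?C0 ?k0.
  split => [i|]; first by have := h (lift ord0 i) I; rewrite /= CS kS.
  by have := h ord0 I; rewrite /= C0 k0.
split.
  rewrite E1; apply: fin_bigcap_measurable; first exact: finite_finset.
  by move=> i _; exact: measurable_count.
rewrite E1 Pall.
(* Comparing the two void probabilities of [W] replaces the additivity of
   [hyperplane_measure], which is not available for lower integrals. *)
have E0 : N W @^-1` [set 0%:R%:E] =
    \bigcap_(i in [set: 'I_n.+1]) (N (C i) @^-1` [set 0%:R%:E]).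
  apply/seteqP; split => w /=.
    move=> /counting_finite; rewrite II0 card_eq0 => /eqP W0 i _ /=.
    apply/counting_finite; rewrite II0 card_eq0; apply/eqP.
    by apply/seteqP; split => // H [eH CH]; rewrite -W0; split => //; exact: CW CH.
  move=> h; apply/counting_finite; rewrite II0 card_eq0; apply/eqP.
  apply/seteqP; split => // H [eH WH].
  have Ci0 i : eta w `&` C i = set0.
    by have /counting_finite := h i I; rewrite II0 card_eq0 => /eqP.
  have [[i _ Bi]|nB] := pselect ((\bigcup_(i in [set: 'I_n]) B i) H).
    by rewrite -(Ci0 (lift ord0 i)) CS; split.
  by rewrite -(Ci0 ord0) C0; split.
have exp_prod : (\prod_(i < n.+1) expR (- m (C i)) = expR (- m W))%R.
  apply: EFin_inj; have := Pall (fun=> 0%N); rewrite -E0.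
  rewrite (count_prob 0 bW fW) prodEFin => -[e]; congr _%:E.
  transitivity (m W ^+ 0 / 0`!%:R * expR (- m W))%R; last exact: expr_fact0.
  by rewrite e; apply: eq_bigr => i _; exact/esym/expr_fact0.
rewrite prodEFin; congr _%:E.
transitivity ((\prod_(i < n.+1) expR (- m (C i))) * \prod_(i < n) m (B i))%R.
  rewrite !big_ord_recl k0 expr_fact0 -mulrA; congr (_ * _)%R.
  rewrite mulrC -big_split/=.
  by apply: eq_bigr => i _; rewrite kS expr_fact1 CS.
by congr (_ * _)%R; exact: exp_prod.
Qed.

(** Here [f] stands for a number of cells, which may fail to be measurable. It is dominated by a
    measurable function: the sum of [2 ^+ k] over the events [A k], plus [+oo] on the null event [I]
    of an infinite count. *)
Lemma integral_count_le W (f : Omega -> \bar R) :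
  borel_hyperplane W -> gamma%:E * hyperplane_measure phi W < +oo ->
  (forall w, 0 <= f w) ->
  (forall w k, N W w = k%:R%:E -> f w <= (2 ^+ k)%:E) ->
  \int[P]_w f w <= (expR (m W))%:E.
Proof.
move=> bW fW f0 fN.
pose A k := [set w | N W w = k%:R%:E].
have mA k : measurable (A k) by exact: measurable_count.
have tA : trivIset [set: nat] A.
  apply/trivIsetP => i j _ _ ij; apply/seteqP; split => // w [].
  by rewrite /A/= => -> [] /eqP; rewrite eqr_nat (negbTE ij).
have PA k : P (A k) = poisson_prob (m W) 0 [set k].
  by rewrite /A (php_poisson etaP bW fW).
pose I := ~` \bigcup_k A k.
have mI : measurable I by apply: measurableC; exact: bigcupT_measurable.
have PI : P I = 0.
  rewrite probability_setC; last exact: bigcupT_measurable.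
  rewrite measure_semi_bigcup//; last exact: bigcupT_measurable.
  rewrite (eq_eseriesr (fun k _ => PA k)).
  by rewrite nneseries_poisson subee.
have fI w : I w -> N W w = +oo.
  move=> Iw; have [h|[k kE _]] := countingP R (eta w `&` W); first exact: h.
  by exfalso; apply: Iw; exists k.
pose g k w : \bar R := (2 ^+ k)%:E * (\1_(A k) w)%:E.
have g0 k w : 0 <= g k w by rewrite /g -EFinM lee_fin mulr_ge0// exprn_ge0.
have mg k : measurable_fun setT (g k).
  by apply: measurable_funeM; exact/measurable_EFinP.
have msg : measurable_fun setT (fun w => \sum_(k <oo) g k w).
  exact: ge0_emeasurable_sum.
have mi : measurable_fun setT (fun w => (\1_I w)%:E : \bar R).
  exact/measurable_EFinP.
have yi0 w : 0 <= +oo * (\1_I w)%:E :> \bar R by rewrite mule_ge0// lee_fin.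
apply: (@le_trans _ _ (\int[P]_w (\sum_(k <oo) g k w + +oo * (\1_I w)%:E))).
  apply: le_lower_integral => w _ //.
  have [Iw|/contrapT[k _ Ak]] := pselect (I w).
    rewrite indicE mem_set// mule1 addey ?leey// gt_eqF//.
    by rewrite (@lt_le_trans _ _ 0)// nneseries_ge0.
  rewrite -[leLHS]adde0; apply: leeD => //.
  apply: le_trans (fN _ _ Ak) _.
  apply: le_trans (nneseries_lim_ge k.+1 _) => //.
  rewrite big_nat_recr//= -[leLHS]add0e; apply: leeD; first exact: sume_ge0.
  by rewrite /g indicE mem_set// mule1.
rewrite ge0_integralD//; last 2 first.
  by move=> w _; exact: nneseries_ge0.
  exact: measurable_funeM.
have PIT : \int[P]_w (\1_I w)%:E = 0 by rewrite integral_indic// setIT; exact: PI.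
rewrite ge0_integralZl// PIT mule0 adde0.
rewrite integral_nneseries//.
have m0 : (0 <= m W)%R by exact: mean_ge0.
(* [2 ^+ k] times the Poisson weight of mean [m W] is [expR (m W)] times the weight of mean
   [2 * m W], and the latter weights sum to one. *)
have -> : \sum_(k <oo) (\int[P]_w g k w) =
    \sum_(k <oo) ((expR (m W))%:E * poisson_prob (2 * m W) 0 [set k]).
  apply: eq_eseriesr => k _.
  rewrite ge0_integralZl//; last by first [exact/measurable_EFinP | rewrite lee_fin exprn_ge0].
  have -> : \int[P]_w (\1_(A k) w)%:E = poisson_prob (m W) 0 [set k].
    by rewrite integral_indic// setIT; exact: PA.
  rewrite !poisson_prob_set1 ?mulr_ge0//.
  rewrite -!EFinM; congr _%:E.
  have -> : (- (2 * m W) = - m W + - m W)%R by ring.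
  rewrite exprMn expRD.
  have e1 : (expR (m W) * expR (- m W) = 1)%R by rewrite -expRD subrr expR0.
  by rewrite -[LHS]mul1r -e1; ring.
rewrite nneseriesZl; last first.
  move=> k _; rewrite poisson_prob_set1 ?mulr_ge0// lee_fin mulr_ge0 ?expR_ge0//.
  by rewrite divr_ge0 ?exprn_ge0 ?mulr_ge0.
by rewrite nneseries_poisson mule1.
Qed.

End poisson_process.

(** * Polytopes as intersections of halfspaces *)

Section convexity.
Variables (R : realType) (d : nat).
Implicit Types (x y : 'rV[R]_d) (A : set 'rV[R]_d).

Definition convexR A := forall x y (t : R), 0 <= t <= 1 -> A x -> A y ->
  A (t *: x + (1 - t) *: y).

Lemma convex_setP A :
  convex_set (A : set (convex_lmodType 'rV[R]_d)) <-> convexR A.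
Proof.
split => [cA x y t /andP[t0 t1] Ax Ay|cA x y t /set_mem Ax /set_mem Ay].
  by have /set_mem := cA x y (Itv01 t0 t1) (mem_set Ax) (mem_set Ay).
by apply: mem_set; apply: cA => //; rewrite ge0 le1.
Qed.

Lemma sub_conv_hull (S : set 'rV[R]_d) : S `<=` conv_hull S.
Proof. exact: sub_smallest. Qed.

Lemma convex_conv_hull (S : set 'rV[R]_d) : convexR (conv_hull S).
Proof.
move=> x y t t01 hx hy C [/convex_setP cC SC]; apply: (cC) => //.
  by apply: hx; split => //; exact/convex_setP.
by apply: hy; split => //; exact/convex_setP.
Qed.

Lemma conv_hull_min (S C : set 'rV[R]_d) : convexR C -> S `<=` C -> conv_hull S `<=` C.
Proof. by move=> /convex_setP cC SC x; apply. Qed.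

End convexity.

Section finite_cone.
Variables (R : realType) (m : nat).
Implicit Types (x y v a : 'rV[R]_m) (l s : seq 'rV[R]_m).

(** Conical hull of a list, with the coefficient of the head split off so that induction can
    eliminate it. *)
Fixpoint gcone l : set 'rV[R]_m :=
  if l is v :: l' then [set x | exists2 t : R, 0 <= t & gcone l' (x - t *: v)]
  else [set 0].

Lemma gcone0 l : gcone l 0.
Proof.
by elim: l => [//|v l ih]; exists 0 => //; rewrite scale0r subr0.
Qed.

Lemma gconeD l x y : gcone l x -> gcone l y -> gcone l (x + y).
Proof.
elim: l x y => [|v l ih] x y /=; first by move=> -> ->; rewrite addr0.
move=> [t t0 hx] [s s0 hy]; exists (t + s); first exact: addr_ge0.
by rewrite scalerDl opprD addrACA; exact: ih.
Qed.

Lemma gconeZ l x (s : R) : 0 <= s -> gcone l x -> gcone l (s *: x).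
Proof.
move=> s0; elim: l x => [|v l ih] x /=; first by move=> ->; rewrite scaler0.
move=> [t t0 hx]; exists (s * t); first exact: mulr_ge0.
by rewrite -scalerA -scalerBr; exact: ih.
Qed.

Lemma gcone_mem l v : v \in l -> gcone l v.
Proof.
elim: l => [//|w l ih]; rewrite inE => /predU1P[->|vl].
  by exists 1 => //; rewrite scale1r subrr; exact: gcone0.
by exists 0 => //; rewrite scale0r subr0; exact: ih.
Qed.

(* Fourier-Motzkin elimination of the coefficient of one generator. *)
Lemma gcone_halfspaces l :
  exists s, gcone l = [set x | forall a, a \in s -> dotp x a <= 0].
Proof.
elim: l => [|v l [s sE]]/=.
  exists ([seq delta_mx 0 k | k <- enum 'I_m] ++ [seq - delta_mx 0 k | k <- enum 'I_m]).
  have dE x k : dotp x (delta_mx 0 k) = x 0 k by rewrite dotpC dotp_deltal.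
  apply/seteqP; split => [x -> a _|x h]; first by rewrite dotp0l.
  apply/rowP => k; rewrite mxE.
  have h1 : dotp x (delta_mx 0 k) <= 0.
    by apply: h; rewrite mem_cat map_f ?mem_enum.
  have h2 : dotp x (- delta_mx 0 k) <= 0.
    by apply: h; rewrite mem_cat (map_f (fun k => - delta_mx 0 k)) ?mem_enum ?orbT.
  by move: h1 h2; rewrite dotpNr dE; lra.
exists ([seq a <- s | dotp v a <= 0] ++
  [seq (- dotp v b) *: a + dotp v a *: b | a <- [seq a <- s | 0 < dotp v a],
       b <- [seq b <- s | dotp v b < 0]]).
rewrite sE; apply/seteqP; split => [x [t t0 h] a|x h].
  rewrite mem_cat => /orP[|/allpairsP[[b c] /= []]].
    rewrite mem_filter => /andP[va0 /h]; rewrite dotpBl dotpZl subr_le0 => /le_trans; apply.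
    by rewrite mulr_ge0_le0.
  rewrite !mem_filter => /andP[vb /h hb] /andP[vc /h hc] ->.
  move: hb hc; rewrite !dotpBl !dotpZl dotpDr !dotpZr !subr_le0 => hb hc.
  have := ler_wpM2l (ltW vb) hc.
  have vc' : 0 <= - dotp v c by rewrite oppr_ge0 ltW.
  by have := ler_wpM2l vc' hb; lra.
(* The least coefficient allowed by its sign and by the [a] with [0 < dotp v a]. The [a] with
   [dotp v a < 0] bound it from above; the first list compares these bounds with zero, the paired
   list with the other lower bounds. *)
pose t := \big[Num.max/0]_(a <- [seq a <- s | 0 < dotp v a]) (dotp x a / dotp v a).
have t0 : 0 <= t by exact: bigmax_ge_id.
exists t => // a as_; rewrite dotpBl dotpZl subr_le0.
have [va|va|va] := ltgtP (dotp v a) 0.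
- rewrite mulrC -ler_ndivlMl// mulrC /t big_seq; apply: bigmax_le.
    rewrite mulr_le0 ?invr_le0 ?(ltW va)//.
    by apply: h; rewrite mem_cat mem_filter (ltW va) as_.
  move=> b; rewrite mem_filter => /andP[vb bs].
  have := h (- dotp v a *: b + dotp v b *: a).
  have -> : (- dotp v a *: b + dotp v b *: a) \in ([seq a <- s | dotp v a <= 0] ++
    [seq (- dotp v b) *: a + dotp v a *: b | a <- [seq a <- s | 0 < dotp v a],
       b <- [seq b <- s | dotp v b < 0]]).
    rewrite mem_cat; apply/orP; right; apply/allpairsP; exists (b, a).
    by rewrite !mem_filter /= vb va as_ bs.
  move=> /(_ isT); rewrite dotpDr !dotpZr => hab.
  rewrite ler_ndivlMr// mulrAC ler_pdivlMr//; lra.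
- rewrite -ler_pdivrMr// /t.
  by rewrite (@bigmax_sup_seq _ _ _ _ _ a)// mem_filter va as_.
- by rewrite va mulr0; apply: h; rewrite mem_cat mem_filter va lexx as_.
Qed.

End finite_cone.

Section weyl.
Variables (R : realType) (d : nat).
Implicit Types (x y v : 'rV[R]_d).

Definition hrep (n : nat) (K : set 'rV[R]_d) := exists a (b : 'I_n -> R),
  K = [set x | forall i, dotp x (a i) <= b i].

Definition lift1 (t : R) x : 'rV[R]_d.+1 := row_mx (t%:M : 'rV[R]_1) x.

Lemma lift1D (t s : R) x y : lift1 t x + lift1 s y = lift1 (t + s) (x + y).
Proof.
apply: rowP1 => [|k]; first by rewrite mxE !row_mx_ord0.
by rewrite mxE !row_mx_lift mxE.
Qed.

Lemma lift1Z (t s : R) x : s *: lift1 t x = lift1 (s * t) (s *: x).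
Proof.
apply: rowP1 => [|k]; first by rewrite mxE !row_mx_ord0.
by rewrite mxE !row_mx_lift mxE.
Qed.

Lemma dotp_lift1 (t : R) x u : dotp (lift1 t x) u = t * u 0 ord0 + dotp x (base u).
Proof.
rewrite /dotp big_ord_recl row_mx_ord0; congr (_ + _).
by apply: eq_bigr => k _; rewrite row_mx_lift mxE.
Qed.

Lemma base_lift1 (t : R) x : base (lift1 t x) = x.
Proof. by apply/rowP => k; rewrite mxE row_mx_lift. Qed.

Lemma lift1_ord0 (t : R) x : lift1 t x 0 ord0 = t.
Proof. exact: row_mx_ord0. Qed.

Lemma lift1_base (u : 'rV[R]_d.+1) : u = lift1 (u 0 ord0) (base u).
Proof.
by apply: rowP1 => [|k]; rewrite ?row_mx_ord0 ?row_mx_lift ?mxE.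
Qed.

(** A conical combination of points at height one, of total height [t], is [t] times a convex
    combination. The induction merges the head with the barycentre [t'^-1 *: y'] of the tail, so
    binary convexity of [C] suffices. *)
Lemma gcone_lift1 (C : set 'rV[R]_d) (l : seq 'rV[R]_d) (t : R) y :
  convexR C -> (forall v, v \in l -> C v) ->
  gcone [seq lift1 1 v | v <- l] (lift1 t y) ->
  [/\ 0 <= t, t = 0 -> y = 0 & 0 < t -> C (t^-1 *: y)].
Proof.
move=> cC; elim: l t y => [|v l ih] t y lC /=.
  move=> /rowP ty0.
  have t0 : t = 0 by have := ty0 ord0; rewrite row_mx_ord0 mxE.
  rewrite t0 ltxx; split => // _; apply/rowP => k.
  by have := ty0 (lift ord0 k); rewrite row_mx_lift !mxE.
move=> [s s0]; rewrite lift1Z -[- _]scaleN1r lift1Z lift1D mulr1 !mulN1r scaleN1r.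
set t' := t - s; set y' := y - s *: v => hg.
have [|t'0 t'y' t'C] := ih t' y' _ hg; first by move=> w wl; apply: lC; rewrite inE wl orbT.
have tE : t = s + t' by rewrite /t' addrC subrK.
have yE : y = s *: v + y' by rewrite /y' addrC subrK.
have vC : C v by apply: lC; rewrite mem_head.
move: t'0; rewrite le_eqVlt => /predU1P[t'E|t'p].
  have y'0 := t'y' (esym t'E).
  rewrite tE yE y'0 -t'E !addr0; split => // [->|sp]; first by rewrite scale0r.
  by rewrite scalerA mulVf ?scale1r// gt_eqF.
have tp : 0 < t by rewrite tE ltr_wpDl.
split; [exact: ltW|by move=> t0; rewrite t0 ltxx in tp|move=> _].
have -> : t^-1 *: y = (s / t) *: v + (1 - s / t) *: (t'^-1 *: y').
  rewrite scalerA yE scalerDr scalerA [t^-1 * s]mulrC; congr (_ + _ *: _).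
  rewrite tE; field; rewrite -tE; apply/andP; split; exact: lt0r_neq0.
apply: cC => //; last exact: t'C.
by rewrite divr_ge0 ?(ltW tp)//= ler_pdivrMr// mul1r tE lerDl ltW.
Qed.

(** Weyl's theorem by homogenization: the cone over the polytope placed at height one is cut out by
    linear inequalities, and the slice at height one turns them into affine ones. *)
Lemma hrep_polytope (K : set 'rV[R]_d) : polytope K -> exists n, hrep n K.
Proof.
move=> [S /finite_seqP[l SE] ->].
have [s sE] := gcone_halfspaces [seq lift1 1 v | v <- l].
exists (size s); exists (fun i => base s`_i), (fun i => - s`_i 0 ord0).
have -> : [set x | forall i : 'I_(size s), dotp x (base s`_i) <= - s`_i 0 ord0] =
    [set x | gcone [seq lift1 1 v | v <- l] (lift1 1 x)].
  rewrite sE; apply/seteqP; split => x /= h.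
    move=> a /(nthP 0)[i il <-]; rewrite dotp_lift1 mul1r.
    by have := h (Ordinal il); rewrite -subr_le0 opprK addrC.
  move=> i; have := h _ (mem_nth 0 (ltn_ord i)).
  by rewrite dotp_lift1 mul1r -[dotp _ _ <= _]subr_le0 opprK addrC.
apply/seteqP; split.
  apply: conv_hull_min => [x y t /andP[t0 t1] hx hy|x].
    rewrite /=; have -> : lift1 1 (t *: x + (1 - t) *: y) = t *: lift1 1 x + (1 - t) *: lift1 1 y.
      by rewrite !lift1Z lift1D !mulr1 [t + (1 - t)]addrC subrK.
    by apply: gconeD; apply: gconeZ => //; rewrite subr_ge0.
  by rewrite SE /= => xl; apply: gcone_mem; exact: map_f.
move=> x hx; have lS v : v \in l -> conv_hull S v.
  by move=> vl; apply: sub_conv_hull; rewrite SE.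
have [_ _] := gcone_lift1 (@convex_conv_hull _ _ S) lS hx.
by rewrite invr1 scale1r; apply.
Qed.

End weyl.

Section minkowski.
Variables (R : realType) (d n : nat) (a : 'I_n -> 'rV[R]_d) (b : 'I_n -> R).
Implicit Types (x y v : 'rV[R]_d).

Let K : set 'rV[R]_d := [set x | forall i, dotp x (a i) <= b i].
Let active x : {set 'I_n} := [set i | dotp x (a i) == b i]%SET.
Let vertex : set 'rV[R]_d := [set v | K v /\
  forall y, (forall i, i \in active v -> dotp y (a i) = 0) -> y = 0].

Lemma convex_halfspaces : convexR [set x | forall i, dotp x (a i) <= b i].
Proof.
move=> x y t /andP[t0 t1] hx hy i; rewrite dotpDl !dotpZl.
apply: (@le_trans _ _ (t * b i + (1 - t) * b i)); last by rewrite -mulrDl addrC subrK mul1r.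
by apply: lerD; rewrite ler_wpM2l ?subr_ge0.
Qed.

Hypothesis Kb : exists M, forall x k, K x -> `|x 0 k| <= M.

(** The ratio test of the simplex method: active constraints stay active along [y] until the first
    other one becomes tight. This happens, since otherwise [K] would contain a ray. *)
Let reach x y : K x -> y != 0 -> (forall i, i \in active x -> dotp y (a i) = 0) ->
  exists2 t, 0 < t & K (x + t *: y) /\ active x \proper active (x + t *: y).
Proof.
move=> Kx y0 ya.
have [i0 yi0] : exists i, 0 < dotp y (a i).
  apply: contrapT => /forallNP h; have [M KM] := Kb.
  have [k yk] : exists k, y 0 k != 0.
    apply: contrapT => /forallNP yk; move/eqP: y0; apply; apply/rowP => k.
    by rewrite mxE; apply/eqP; move: (yk k) => /negP/negPn.
  pose t := (M + `|x 0 k| + 1) / `|y 0 k|.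
  have M0 : 0 <= M by apply: le_trans (KM x k Kx).
  have t0 : 0 <= t by rewrite divr_ge0// addr_ge0// addr_ge0.
  have /KM : K (x + t *: y).
    move=> i; rewrite dotpDl dotpZl; apply: le_trans (Kx i).
    rewrite gerDl mulr_ge0_le0// leNgt; exact/negP/h.
  move=> /(_ k); rewrite leNgt => /negP; apply; rewrite !mxE.
  have := ler_normD (x 0 k + t * y 0 k) (- x 0 k).
  rewrite addrAC subrr add0r normrN normrM (ger0_norm t0) /t divfK ?normr_eq0//; lra.
pose f i := (b i - dotp x (a i)) / dotp y (a i).
have [i yi imin] := @Order.TotalTheory.arg_minP _ R _ i0 (fun i => 0 < dotp y (a i)) f yi0.
have xi : dotp x (a i) < b i.
  rewrite lt_neqAle Kx andbT; apply/negP => xi.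
  by move: yi; rewrite ya ?ltxx// inE.
have t0 : 0 < f i by rewrite divr_gt0// subr_gt0.
exists (f i) => //; split.
  move=> j; rewrite dotpDl dotpZl; have [yj|yj] := ltP 0 (dotp y (a j)).
    have := imin j yj; rewrite {2}/f ler_pdivlMr//; lra.
  by apply: le_trans (Kx j); rewrite gerDl mulr_ge0_le0// ltW.
rewrite properE; apply/andP; split.
  apply/fintype.subsetP => j jx; have := jx; rewrite !inE => /eqP xj.
  by rewrite dotpDl dotpZl ya// mulr0 addr0 xj.
apply/fintype.subsetPn; exists i; rewrite !inE; last by rewrite lt_eqF.
by rewrite dotpDl dotpZl /f divfK ?lt0r_neq0// addrC subrK.
Qed.

(** A vertex is determined by its active set: the difference of two vertices with the same active
    set is orthogonal to all its normals. *)
Let vertex_finite : finite_set vertex.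
Proof.
have inj : {in vertex &, injective active}.
  move=> v w /set_mem[Kv hv] /set_mem[Kw hw] vw.
  apply/eqP; rewrite -subr_eq0; apply/eqP/hv => i iv; rewrite dotpBl.
  have := iv; rewrite vw inE => /eqP ->; move: iv; rewrite inE => /eqP ->.
  by rewrite subrr.
have : finite_set (active @` vertex) by exact: finite_finset.
have [f fE] := Pinj inj; rewrite fE => fin.
by rewrite -(eq_finite_set (card_image f)).
Qed.

(** Induction on the number of inactive constraints: a point that is no vertex lies between the
    points that [reach] finds in the directions [y] and [- y], each with more active constraints. *)
Let sub_hull x : K x -> conv_hull vertex x.
Proof.
have [m] := ubnP (n - #|active x|); elim: m x => // m ih x xm Kx.
have [vx|nv] := pselect (vertex x); first exact: sub_conv_hull.
have [y ya y0] : exists2 y, (forall i, i \in active x -> dotp y (a i) = 0) & y != 0.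
  apply: contrapT => h; apply: nv; split => // y ya.
  by apply: contrapT => y0; apply: h; exists y => //; exact/eqP.
have lt_active z : active x \proper active z -> (n - #|active z| < m)%N.
  move=> /proper_card az; move: xm; rewrite ltnS; apply: leq_trans.
  by apply: ltn_sub2l => //; apply: leq_trans az _; rewrite -[leqRHS](card_ord n) max_card.
have [t t0 [Kt /lt_active xt]] := reach Kx y0 ya.
have y0' : - y != 0 by rewrite oppr_eq0.
have ya' i : i \in active x -> dotp (- y) (a i) = 0.
  by move=> ix; rewrite dotpNl ya// oppr0.
have [s s0 [Ks /lt_active as_]] := reach Kx y0' ya'.
have ht := ih _ xt Kt; have hs := ih _ as_ Ks.
have ts0 : 0 < s + t by exact: addr_gt0.
have -> : x = (s / (s + t)) *: (x + t *: y) + (1 - s / (s + t)) *: (x + s *: - y).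
  apply/rowP => k; rewrite !mxE; field; exact: lt0r_neq0.
apply: convex_conv_hull => //.
by rewrite (divr_ge0 (ltW s0) (ltW ts0))/= ler_pdivrMr// mul1r lerDl ltW.
Qed.

Lemma bounded_halfspaces_polytope :
  polytope [set x | forall i, dotp x (a i) <= b i].
Proof.
exists vertex; first exact: vertex_finite.
apply/seteqP; split; first exact: sub_hull.
by apply: conv_hull_min; [exact: convex_halfspaces|move=> v []].
Qed.

End minkowski.

(** * Facets of an irredundant system of inequalities *)

Section hyperplane_frame.
Variables (R : realType) (q : nat).
Implicit Types (x u a : 'rV[R]_q.+1).

Lemma mulmx_tr_dotp m (M : 'M[R]_(m, q.+1)) u i :
  (M *m u^T) i 0 = dotp (row i M) u.
Proof. by rewrite mxE; apply: eq_bigr => j _; rewrite !mxE. Qed.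

Lemma mulmx_tr_eq0 m (M : 'M[R]_(m, q.+1)) u :
  (forall i, dotp (row i M) u = 0) -> M *m u^T = 0.
Proof. by move=> h; apply/colP => i; rewrite mulmx_tr_dotp h mxE. Qed.

(** The [q.+1] differences form a square matrix that kills [u], hence a singular one. This bounds
    the dimension of a facet from above. *)
Lemma hplane_aff_dep u t (p : 'I_q.+2 -> 'rV[R]_q.+1) : u != 0 ->
  (forall i, hplane u t (p i)) -> ~ aff_indep p.
Proof.
move=> u0 pu /row_freeP[B MB]; set M := (X in X *m B = _) in MB.
have Mu : M *m u^T = 0.
  apply: mulmx_tr_eq0 => i; rewrite rowK dotpBl.
  by rewrite (pu (lift ord0 i)) (pu ord0) subrr.
have : u^T = 0 by rewrite -[u^T]mul1mx -(mulmx1C MB) -mulmxA Mu mulmx0.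
by move=> /(congr1 trmx); rewrite trmxK trmx0 => /eqP; rewrite (negbTE u0).
Qed.

Lemma orthogonal_collinear (M : 'M[R]_(q, q.+1)) u a : row_free M -> a != 0 ->
  (forall i, dotp (row i M) u = 0) -> (forall i, dotp (row i M) a = 0) ->
  exists s, u = s *: a.
Proof.
move=> Mfree a0 /mulmx_tr_eq0 Mu /mulmx_tr_eq0 Ma; apply/sub_rVP.
have ker (w : 'rV[R]_q.+1) : M *m w^T = 0 -> (w <= kermx M^T)%MS.
  by move=> Mw; apply/sub_kermxP; rewrite -[w]trmxK -trmx_mul Mw trmx0.
have rk : \rank (kermx M^T) = 1%N.
  by rewrite mxrank_ker mxrank_tr (eqP Mfree) subSnn.
apply: (submx_trans (ker _ Mu)).
have [_] := mxrank_leqif_sup (ker _ Ma).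
by rewrite rk rank_rV a0 => <-.
Qed.

Lemma orthogonal_frame a : a != 0 -> exists e : 'I_q -> 'rV[R]_q.+1,
  (forall k, dotp (e k) a = 0) /\
  forall s : R, s != 0 -> row_free (\matrix_(k < q) (s *: e k)).
Proof.
move=> a0; have [j aj] : exists j, a 0 j != 0.
  apply: contrapT => /forallNP h; move/eqP: a0; apply; apply/rowP => j.
  by rewrite mxE; apply/eqP/negPn/negP.
(* Deleting the coordinate [j] turns these vectors into the standard basis; the matrix [B] below
   performs the deletion and so gives a right inverse. *)
pose e k := delta_mx 0 (lift j k) - (a 0 (lift j k) / a 0 j) *: delta_mx 0 j : 'rV[R]_q.+1.
exists e.
split => [k|s s0]; first by rewrite dotpBl dotpZl !dotp_deltal divfK// subrr.
have eE k l : e k 0 (lift j l) = (k == l)%:R.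
  rewrite !mxE !eqxx /= (inj_eq lift_inj) eq_sym.
  by rewrite [lift j l == j]eq_sym (negbTE (neq_lift j l)) mulr0 subr0.
pose B : 'M[R]_(q.+1, q) := \matrix_(i, k) (i == lift j k)%:R.
have BE i k : B i k = (i == lift j k)%:R by rewrite mxE.
apply/row_freeP; exists (s^-1 *: B).
rewrite -scalemxAr; apply/matrixP => k l; rewrite mxE mxE (bigD1 (lift j l))//=.
rewrite big1 ?addr0 => [|i il]; last by rewrite BE (negbTE il) mulr0.
by rewrite BE eqxx mulr1 mxE mxE eE mulKf// mxE.
Qed.

Lemma orthogonal_frame_aff_indep (x : 'rV[R]_q.+1) (e : 'I_q -> 'rV[R]_q.+1) :
  row_free (\matrix_(k < q) e k) ->
  aff_indep (fun i : 'I_q.+1 => if unlift ord0 i is Some k then x + e k else x).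
Proof.
move=> efree; rewrite /aff_indep; congr is_true: efree; congr row_free.
apply/matrixP => i j; rewrite !mxE liftK unlift_none !mxE.
by rewrite addrAC subrr add0r.
Qed.

End hyperplane_frame.

Section facets.
Variables (R : realType) (q n : nat) (a : 'I_n -> 'rV[R]_q.+1) (b : 'I_n -> R).
Implicit Types (x y u v : 'rV[R]_q.+1).

Let K : set 'rV[R]_q.+1 := [set x | forall i, dotp x (a i) <= b i].

Hypothesis irredundant :
  forall i, exists x, b i < dotp x (a i) /\ forall j, j != i -> dotp x (a j) <= b j.
Variable p : 'rV[R]_q.+1.
Hypothesis p_int : forall i, dotp p (a i) < b i.

Let F i := K `&` hplane (a i) (b i).

Let a_neq0 i : a i != 0.
Proof.
have [x [xi _]] := irredundant i; apply: contraTneq xi => ai0.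
by have := p_int i; rewrite ai0 !dotp0r -leNgt => /ltW.
Qed.

(** The segment from the interior point [p] to a point that violates the constraint [i] alone
    crosses the hyperplane of [i]. The other constraints are strict there because they are strict at
    [p]. *)
Let tight i : exists2 z, dotp z (a i) = b i & forall j, j != i -> dotp z (a j) < b j.
Proof.
have [x [xi xj]] := irredundant i; have pi := p_int i.
pose t := (b i - dotp p (a i)) / (dotp x (a i) - dotp p (a i)).
have D0 : 0 < dotp x (a i) - dotp p (a i) by lra.
have t1 : t < 1 by rewrite ltr_pdivrMr// mul1r; lra.
have t0 : 0 < t by rewrite divr_gt0// subr_gt0.
exists (p + t *: (x - p)) => [|j ji].
  by rewrite dotpDl dotpZl dotpBl divfK ?gt_eqF// addrC subrK.
rewrite dotpDl dotpZl dotpBl; have := xj j ji; have := p_int j; nra.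
Qed.

Let room (J : pred 'I_n) z u : (forall j, J j -> dotp z (a j) < b j) ->
  exists2 e, 0 < e & forall s, `|s| <= e -> forall j, J j -> dotp (z + s *: u) (a j) <= b j.
Proof.
move=> zJ; pose f j := (b j - dotp z (a j)) / (`|dotp u (a j)| + 1).
have f0 j : J j -> 0 < f j.
  by move=> Jj; rewrite divr_gt0 ?subr_gt0 ?zJ// ltr_wpDl.
exists (\big[Num.min/1]_(j | J j) f j).
  by apply/bigmin_gtP; split.
move=> s sf j Jj; rewrite dotpDl dotpZl -lerBrDl.
have sfj : `|s| <= f j by apply: le_trans sf _; exact: bigmin_le_cond.
apply: le_trans (ler_norm _) _; rewrite normrM.
have D0 : 0 < `|dotp u (a j)| + 1 by rewrite ltr_wpDl.
apply: (@le_trans _ _ (`|s| * (`|dotp u (a j)| + 1))).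
  by rewrite ler_wpM2l// lerDl.
by rewrite -ler_pdivlMr.
Qed.

Let F_facet i : facet K (F i).
Proof.
exists (a i), (b i); split => //; first by move=> x; apply.
have [z zi zj] := tight i; split; last first.
  by move=> [pp ppF]; apply: (@hplane_aff_dep _ _ (a i) (b i)) => // k; have [] := ppF k.
have [e [ea efree]] := orthogonal_frame (a_neq0 i).
have zJ : forall j, predC1 i j -> dotp z (a j) < b j by move=> j /= /zj.
have /fin_all_exists2[r r0 rK] k := room (e k) zJ.
pose s := \big[Num.min/1]_k r k.
have s0 : 0 < s by apply/bigmin_gtP; split.
have srk k : s <= r k by exact: bigmin_le.
exists (fun j : 'I_q.+1 => if unlift ord0 j is Some k then z + s *: e k else z).
  move=> j; case: unlift => [k|].
    split; last by rewrite /hplane/= dotpDl dotpZl ea mulr0 addr0.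
    move=> l; have [->|li] := eqVneq l i; first by rewrite dotpDl dotpZl ea mulr0 addr0 zi.
    by apply: (rK k) => //; rewrite ger0_norm// ltW.
  split; last exact: zi.
  by move=> l; have [->|/zj/ltW//] := eqVneq l i; rewrite zi.
by apply: (@orthogonal_frame_aff_indep R q z (fun k => s *: e k)); apply: efree; rewrite gt_eqF.
Qed.

Let F_inj : injective F.
Proof.
move=> i j Fij; apply/eqP; apply: contrapT => /negP ij.
have [z zi zj] := tight i.
have : F i z.
  by split => // l; have [->|/zj/ltW//] := eqVneq l i; rewrite zi.
rewrite Fij => -[_]; rewrite /hplane/= => zjb.
by have := zj j; rewrite eq_sym ij zjb ltxx => /(_ isT).
Qed.

Let facet_F G : facet K G -> exists i, G = F i.
Proof.
move=> [u [t [u0 Ku -> [[pp ppG ppfree] _]]]].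
(* A constraint tight at this barycentre is tight at every [pp k]. One is tight, as otherwise [g]
   could move along [u] out of the supporting halfspace; then [u] and its normal are orthogonal to
   the same [q] independent vectors, hence collinear. *)
pose g := (q.+1%:R^-1 : R) *: \sum_k pp k.
have dg v : dotp g v = q.+1%:R^-1 * \sum_k dotp (pp k) v.
  rewrite dotpZl; congr (_ * _).
  elim/big_ind2 : _ => [|x r y s xr ys|//]; first by rewrite dotp0l.
  by rewrite dotpDl xr ys.
have q0 : (0 : R) < q.+1%:R by rewrite ltr0n.
have ppK k : K (pp k) by have [] := ppG k.
have ppu k : dotp (pp k) u = t by have [] := ppG k.
have gK i : dotp g (a i) <= b i.
  rewrite dg mulrC ler_pdivrMr//.
  have -> : b i * q.+1%:R = \sum_(k < q.+1) b i by rewrite sumr_const card_ord mulr_natr.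
  by apply: ler_sum => k _; exact: ppK.
have gu : dotp g u = t.
  by rewrite dg (eq_bigr (fun=> t))// sumr_const card_ord -[t *+ _]mulr_natl mulKf ?gt_eqF.
have [i gi] : exists i, dotp g (a i) = b i.
  apply: contrapT => /forallNP h.
  have gJ j : predT j -> dotp g (a j) < b j.
    by move=> _; rewrite lt_neqAle gK andbT; apply/eqP/h.
  have [e e0 eK] := room u gJ.
  have /Ku/= : K (g + e *: u) by move=> j; apply: eK => //; rewrite ger0_norm// ltW.
  rewrite dotpDl (dotpZl e u) gu gerDl leNgt => /negP; apply.
  by rewrite mulr_gt0// lt_def dotp_eq0 u0 dotp_ge0.
have ppi k : dotp (pp k) (a i) = b i.
  have : \sum_k (b i - dotp (pp k) (a i)) == 0.
    rewrite big_split/= sumrN sumr_const card_ord -gi dg -[_ *+ _]mulr_natl.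
    by rewrite mulVKf ?subrr// gt_eqF.
  rewrite psumr_eq0 => [/allP/(_ k (mem_index_enum k))/=|j _]; last by rewrite subr_ge0 ppK.
  by rewrite subr_eq0 => /eqP.
have [s us] : exists s, u = s *: a i.
  apply: (orthogonal_collinear ppfree (a_neq0 i)) => k; rewrite rowK dotpBl.
    by rewrite !ppu subrr.
  by rewrite !ppi subrr.
have s0 : s != 0 by apply: contraNneq u0 => s0; rewrite us s0 scale0r.
have tE : t = s * b i by rewrite -(ppu ord0) us dotpZr ppi.
exists i; rewrite /F; congr (_ `&` _); apply/seteqP; split => x; rewrite /hplane/= us dotpZr tE.
  exact: mulfI.
by move=> ->.
Qed.

Lemma nfacets_irredundant :
  nfacets [set x | forall i, dotp x (a i) <= b i] = n%:R%:E :> \bar R.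
Proof.
apply/counting_finite.
have -> : facet [set x | forall i, dotp x (a i) <= b i] = F @` [set: 'I_n].
  apply/seteqP; split => [G /facet_F[i ->]|_ [i _ <-]]; first by exists i.
  exact: F_facet.
have Finj : {in [set: 'I_n] &, injective F} by move=> i j _ _; exact: F_inj.
have [f fE] := Pinj Finj.
rewrite -[F @` _]/(F @` setT) fE.
apply: card_eq_trans (card_image f) _.
by rewrite card_eq_sym card_II.
Qed.

End facets.

(** * Reduction and normalization of systems of inequalities *)

Section hrep.
Variables (R : realType) (q : nat).
Implicit Types (x y z u p : 'rV[R]_q.+1) (K L : set 'rV[R]_q.+1).

Lemma ball_coord d (x y : 'rV[R]_d) (e : R) : 0 < e ->
  (forall k, `|x 0 k - y 0 k| < e) -> ball x e y.
Proof. by move=> e0 h; split => // i j; rewrite ord1; exact: h. Qed.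

Lemma coord_ball d (x y : 'rV[R]_d) (e : R) k : ball x e y -> `|x 0 k - y 0 k| < e.
Proof. by move=> [_ /(_ 0 k)]. Qed.

Lemma interior_move p u K : nbhs p K ->
  exists2 s : R, 0 < s & forall t, 0 <= t <= s -> K (p + t *: u).
Proof.
move=> /nbhs_ballP[e /= e0 eK]; pose D : R := \sum_k `|u 0 k| + 1.
have D0 : 0 < D by rewrite ltr_wpDl// sumr_ge0.
exists (e / D) => [|t /andP[t0 te]]; first by rewrite divr_gt0.
apply: eK; apply: ball_coord => // k.
rewrite !mxE opprD addrA subrr sub0r normrN normrM ger0_norm//.
apply: (@le_lt_trans _ _ (e / D * `|u 0 k|)); first by rewrite ler_wpM2r.
rewrite mulrAC ltr_pdivrMr// ltr_pM2l// /D (bigD1 k)//=.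
by rewrite -addrA ltrDl ltr_wpDl// sumr_ge0.
Qed.

Lemma hrep_interior p u (b : R) K : nbhs p K -> u != 0 ->
  (forall x, K x -> dotp x u <= b) -> dotp p u < b.
Proof.
move=> /(@interior_move _ u)[s s0 Ks] u0 Kb.
have /Kb : K (p + s *: u) by apply: Ks; rewrite lexx ltW.
rewrite dotpDl dotpZl; apply: lt_le_trans.
by rewrite ltrDl mulr_gt0// lt_def dotp_eq0 u0 dotp_ge0.
Qed.

(** Redundant inequalities are dropped one at a time, and an irredundant system has as many facets
    as inequalities. So a polytope with interior has [n] facets exactly if [n] inequalities describe
    it and fewer do not, which reduces measurability to [hrep]. *)
Lemma hrep_reduce n K p : nbhs p K -> hrep n K ->
  exists k : nat, [/\ (k <= n)%N, hrep k K & nfacets K = k%:R%:E :> \bar R].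
Proof.
move=> pK; elim: n => [|n ih] [a [b KE]].
all: have [irr|] := pselect (forall i, exists x,
  b i < dotp x (a i) /\ forall j, j != i -> dotp x (a j) <= b j).
- exists 0%N; split => //; first by exists a, b.
  by rewrite KE; apply: (nfacets_irredundant irr (p := p)) => -[].
- by move=> /existsNP[[]].
- exists n.+1; split => //; first by exists a, b.
  rewrite KE; apply: (nfacets_irredundant irr (p := p)) => i.
  have Ka x : K x -> dotp x (a i) <= b i by rewrite KE; apply.
  apply: (hrep_interior pK) => //; have [x [xi _]] := irr i.
  apply: contraTneq xi => ai0; rewrite -leNgt ai0 dotp0r.
  by have := Ka p (nbhs_singleton pK); rewrite ai0 dotp0r.
move=> /existsNP[i /forallNP hi].
have /ih[k [kn hk nk]] : hrep n K.
  exists (a \o lift i), (b \o lift i); rewrite KE.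
  apply/seteqP; split => x /= h j; first exact: h.
  have [->|ji] := eqVneq j i; last first.
    by case: (unliftP i j) ji => [l ->|->]; rewrite ?eqxx// => _; exact: h.
  rewrite leNgt; apply/negP => xi; apply: (hi x); split => // l li.
  by case: (unliftP i l) li => [m ->|->]; rewrite ?eqxx// => _; exact: h.
by exists k; split => //; exact: leqW.
Qed.

Lemma compact_coord_bounded K : compact K ->
  exists2 C : R, 0 <= C & forall x k, K x -> `|x 0 k| <= C.
Proof.
move=> /compact_bounded[M [_ MK]]; exists (`|M| + 1); first by rewrite addr_ge0.
move=> x k Kx; have /MK/(_ x Kx) : M < `|M| + 1 by rewrite ltr_pwDr// ler_norm.
apply: le_trans; rewrite [leRHS]/Num.norm/= mx_normrE.
by apply: (le_trans _ (le_bigmax _ _ (0, k))).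
Qed.

Lemma enorm_le_coord (C : R) x : (forall k, `|x 0 k| <= C) -> enorm x <= q.+1%:R * C.
Proof.
move=> xC; apply: le_trans (enorm_le_sum x) _.
apply: le_trans (ler_sum _ (fun k _ => xC k)) _.
by rewrite sumr_const card_ord mulr_natl.
Qed.

Lemma closed_approx K z : closed K ->
  (forall e : R, 0 < e -> exists2 x, K x & enorm (z - x) <= e) -> K z.
Proof.
move=> Kc h; apply: Kc => B /nbhs_ballP[e /= e0 eB].
have [|x Kx xe] := h (e / 2); first exact: divr_gt0.
exists x; split => //; apply: eB; apply: ball_coord => // k.
have -> : z 0 k - x 0 k = (z - x) 0 k by rewrite !mxE.
apply: le_lt_trans (coord_le_enorm _ _) _; apply: le_lt_trans xe _.
by rewrite ltr_pdivrMr// ltr_pMr// ltr1n.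
Qed.

Lemma hausdorff_lt K L (e : R) : convex_body K -> convex_body L ->
  hausdorff_dist K L < e -> K `<=` parallel_set L e /\ L `<=` parallel_set K e.
Proof.
move=> [/compact_coord_bounded[C C0 KC] _ [x0 /interior_subset Kx0]].
move=> [/compact_coord_bounded[D D0 LD] _ [y0 /interior_subset Ly0]].
have bd x y : K x -> L y -> enorm (x - y) <= q.+1%:R * (C + D).
  move=> Kx Ly; apply: enorm_le_coord => k; rewrite !mxE.
  by apply: le_trans (ler_normB _ _) _; apply: lerD; [exact: KC|exact: LD].
move=> /inf_lt[|f [f0 KL LK] fe].
  exists (q.+1%:R * (C + D)); split; first by rewrite mulr_ge0// addr_ge0.
    by move=> x Kx; exists y0 => //; exact: bd.
  by move=> y Ly; exists x0 => //; rewrite -enormN opprB; exact: bd.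
split => [x /KL[y Ly xy]|x /LK[y Ky xy]]; exists y => //.
  exact: le_trans xy (ltW fe).
exact: le_trans xy (ltW fe).
Qed.

(** Puts the parameters of [L] into a compact set that depends on [C] only, ready for a limit. *)
Lemma hrep_normalize n L (C : R) x0 : hrep n L -> L x0 ->
  0 <= C -> (forall x k, L x -> `|x 0 k| <= C) ->
  exists a (b : 'I_n -> R), [/\ forall i, enorm (a i) = 1,
    forall i, `|b i| <= q.+1%:R * C & L = [set x | forall i, dotp x (a i) <= b i]].
Proof.
move=> [a [b LE]] Lx0 C0 LC.
have dC x u : enorm u = 1 -> L x -> `|dotp x u| <= q.+1%:R * C.
  move=> u1 Lx; apply: le_trans (norm_dotp_le _ _) _; rewrite u1 mulr1.
  apply: le_trans (ler_sum _ (fun k _ => LC x k Lx)) _.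
  by rewrite sumr_const card_ord mulr_natl.
have /fin_all_exists2[f f1 fL] : forall i, exists2 v : 'rV[R]_q.+1 * R,
    enorm v.1 = 1 /\ `|v.2| <= q.+1%:R * C &
    (forall x, L x -> dotp x v.1 <= v.2) /\
    (forall x, dotp x v.1 <= v.2 -> dotp x (a i) <= b i).
  move=> i; have La x : L x -> dotp x (a i) <= b i by rewrite LE; apply.
  (* A zero normal gives a constraint without content; it is replaced by a unit normal with a bound
     valid on [L]. *)
  have [ai0|ai0] := eqVneq (a i) 0.
    have u1 : enorm (delta_mx 0 ord0 : 'rV[R]_q.+1) = 1.
      rewrite /enorm /dotp big_ord_recl !mxE !eqxx mul1r big1 ?addr0 ?sqrtr1// => k _.
      by rewrite !mxE mul0r.
    exists (delta_mx 0 ord0, q.+1%:R * C) => /=.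
      by rewrite ger0_norm// mulr_ge0.
    split => [x Lx|x _]; first by have := dC x _ u1 Lx; rewrite ler_norml => /andP[].
    by have := La x0 Lx0; rewrite ai0 !dotp0r.
  have na : 0 < enorm (a i) by rewrite enorm_gt0.
  pose u := (enorm (a i))^-1 *: a i.
  have u1 : enorm u = 1 by rewrite enormZ gtr0_norm ?invr_gt0// mulVf// gt_eqF.
  have ub x s : (dotp x u <= s) = (dotp x (a i) <= s * enorm (a i)).
    by rewrite dotpZr mulrC ler_pdivrMr.
  (* Lowering the bound to [q.+1%:R * C] keeps it valid on [L], and the point [x0] bounds it from
     below. *)
  have Lu x : L x -> dotp x u <= Num.min (b i / enorm (a i)) (q.+1%:R * C).
    move=> Lx; rewrite le_min ub divfK ?gt_eqF// La//=.
    by have := dC x _ u1 Lx; rewrite ler_norml => /andP[].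
  exists (u, Num.min (b i / enorm (a i)) (q.+1%:R * C)) => /=.
    split => //; rewrite ler_norml ge_min lexx orbT andbT.
    apply: le_trans (Lu _ Lx0).
    by have := dC x0 _ u1 Lx0; rewrite ler_norml => /andP[].
  split => // x; rewrite le_min => /andP[+ _].
  by rewrite ub divfK// gt_eqF.
exists (fun i => (f i).1), (fun i => (f i).2); split.
- by move=> i; have [] := f1 i.
- by move=> i; have [] := f1 i.
rewrite [LHS]LE; apply/seteqP; split => x h i; have [f3 f4] := fL i; first by apply: f3; rewrite LE.
exact: f4.
Qed.

Lemma compact_unit_bounded (C : R) :
  compact [set v : 'rV[R]_q.+2 | enorm (base v) = 1 /\ `|v 0 ord0| <= C].
Proof.
have cb : continuous (fun v : 'rV[R]_q.+2 => enorm (base v)).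
  rewrite (_ : (fun v => _) = (fun v : 'rV[R]_q.+2 =>
    Num.sqrt (\sum_k v 0 (lift ord0 k) * v 0 (lift ord0 k)))).
    move=> v; apply: (@continuous_comp _ _ _
      (fun v : 'rV[R]_q.+2 => \sum_k v 0 (lift ord0 k) * v 0 (lift ord0 k)) Num.sqrt);
      last exact: sqrt_continuous.
    move: v; apply: continuous_sumr => k.
    by apply: continuous_mulr; exact: coord_continuous.
  by apply/funext => v; congr Num.sqrt; apply: eq_bigr => k _; rewrite !mxE.
have c0 : continuous (fun v : 'rV[R]_q.+2 => v 0 ord0) by exact: coord_continuous.
have cc (r : R) : continuous (fun v : 'rV[R]_q.+2 => r) by exact: continuous_constr.
apply: bounded_closed_compact.
  exists (`|C| + 1); split => // M CM v [v1 v0].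
  rewrite /= /Num.norm/= mx_normrE; apply/bigmax_leP; split.
    by apply: le_trans (ltW CM); rewrite addr_ge0.
  move=> [i j] _ /=; rewrite ord1; apply: le_trans (ltW CM).
  case: (unliftP ord0 j) => [k ->|->].
    apply: (@le_trans _ _ (enorm (base v))); last by rewrite v1 lerDr.
    by apply: le_trans (coord_le_enorm _ k); rewrite mxE.
  by apply: le_trans v0 _; apply: le_trans (ler_norm _) _; rewrite lerDl.
rewrite (_ : mkset _ = [set v | enorm (base v) <= 1] `&` [set v | 1 <= enorm (base v)]
  `&` ([set v : 'rV[R]_q.+2 | v 0 ord0 <= C] `&` [set v : 'rV[R]_q.+2 | - C <= v 0 ord0])).
  by apply: closedI; apply: closedI; exact: closed_le_fun.
apply/seteqP; split => v /=.
  by move=> [->]; rewrite ler_norml => /andP[].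
move=> [[h1 h2] [h3 h4]]; rewrite ler_norml h3 h4; split => //.
by apply/eqP; rewrite eq_le h1 h2.
Qed.

End hrep.

(** * Measurability of the number of facets *)

Section hausdorff.
Variables (R : realType) (q : nat).
Implicit Types (x y z u p : 'rV[R]_q.+1) (K L : set 'rV[R]_q.+1).

(** If bodies described by [n] inequalities came arbitrarily close to [K], their normalized
    parameters would have a cluster point [v], and [K] would be the polyhedron [cone v]. *)
Lemma hausdorff_open_hrepC n :
  hausdorff_open [set K : set 'rV[R]_q.+1 | convex_body K /\ ~ hrep n K].
Proof.
split => [K []//|K [Kbody nK]].
have [Kcompact Kconv [p /= pK]] := Kbody.
have Kclosed : closed K by apply: compact_closed => //; exact: norm_hausdorff.
have [C C0 KC] := compact_coord_bounded Kcompact.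
apply: contrapT => hfar.
pose cone (v : 'rV['rV[R]_q.+2]_n) : set 'rV[R]_q.+1 :=
  [set x | forall i : 'I_n, dotp x (base (v 0 i)) <= v 0 i 0 ord0].
pose C' : R := q.+1%:R * (C + 1).
pose A := [set w : 'rV[R]_q.+2 | enorm (base w) = 1 /\ `|w 0 ord0| <= C'].
have approx (k : nat) : exists v : 'rV['rV[R]_q.+2]_n, [/\ forall i, A (v 0 i),
    K `<=` parallel_set (cone v) k.+1%:R^-1 & cone v `<=` parallel_set K k.+1%:R^-1].
  have k0 : (0 : R) < k.+1%:R^-1 by rewrite invr_gt0 ltr0n.
  have [L [Lbody KLd hL]] : exists L, [/\ convex_body L,
      hausdorff_dist K L < k.+1%:R^-1 & hrep n L].
    apply: contrapT => h; apply: hfar; exists k.+1%:R^-1 => // L Lb KLd.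
    by split => // hL; apply: h; exists L.
  have [KL LK] := hausdorff_lt Kbody Lbody KLd.
  have LC x i : L x -> `|x 0 i| <= C + 1.
    move=> /LK[y Ky xy]; rewrite -[x](subrK y) mxE addrC.
    apply: le_trans (ler_normD _ _) _; apply: lerD; first exact: KC.
    apply: le_trans (coord_le_enorm _ _) _; apply: le_trans xy _.
    by rewrite invf_le1 ?ltr0n// ler1n.
  have [_ _ [x0 /interior_subset Lx0]] := Lbody.
  have [a [b [a1 bC LE]]] := hrep_normalize hL Lx0 (addr_ge0 C0 ler01) LC.
  pose v : 'rV['rV[R]_q.+2]_n := \row_i lift1 (b i) (a i).
  have vE i : v 0 i = lift1 (b i) (a i) by rewrite mxE.
  have coneE : cone v = L.
    rewrite LE; apply/seteqP; split => x h i; have := h i.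
      by rewrite vE base_lift1 lift1_ord0.
    by rewrite -{1}(base_lift1 (b i) (a i)) -{2}(lift1_ord0 (b i) (a i)) -vE.
  exists v; rewrite coneE; split => // i.
  by rewrite /A/= vE base_lift1 lift1_ord0.
have [v_ vP] := choice approx.
(* A cluster point replaces a convergent subsequence: [close] then finds arbitrarily late [k] with
   all parameters near those of [v]. *)
have /(_ (v_ @ \oo))[] : compact [set v : 'rV['rV[R]_q.+2]_n | forall i, A (v ord0 i)].
  by apply: (@rV_compact _ _ (fun=> A)) => _; exact: compact_unit_bounded.
  by exists 0%N => // k _; have [] := vP k.
move=> v [Av clv].
have close (e : R) (m : nat) : 0 < e ->
    exists2 k, (m <= k)%N & forall i, ball (v 0 i) e (v_ k 0 i).
  move=> e0; have [||w [[k mk <-] h]] := clv (v_ @` [set k | (m <= k)%N])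
      [set w | forall i, ball (v 0 i) e (w 0 i)].
  - by exists m => // k mk; exists k.
  - exists (fun _ i => ball (v 0 i) e) => [i j|w h i]; last exact: h.
    by rewrite ord1; exact: nbhsx_ballx.
  by exists k.
have inv_small (e : R) : 0 < e -> exists m : nat, forall k, (m <= k)%N -> k.+1%:R^-1 <= e :> R.
  move=> e0; exists (Num.truncn e^-1) => k mk.
  rewrite invf_ple ?posrE ?ltr0n//; apply: ltW.
  apply: lt_le_trans (_ : (Num.truncn e^-1).+1%:R <= _); last by rewrite ler_nat ltnS.
  by apply: Num.Theory.truncnS_gt.
apply: nK; exists (fun i => base (v 0 i)), (fun i => v 0 i 0 ord0).
have dotp_close x i k (e : R) : ball (v 0 i) e (v_ k 0 i) ->
    `|dotp x (base (v 0 i)) - dotp x (base (v_ k 0 i))| <= (\sum_l `|x 0 l|) * e.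
  move=> be; rewrite -dotpBr; apply: le_trans (ler_norm_sum _ _ _) _.
  rewrite mulr_suml; apply: ler_sum => l _; rewrite normrM ler_wpM2l//.
  by rewrite !mxE; apply: ltW; exact: coord_ball.
have Kv : K `<=` cone v.
  move=> x Kx i; rewrite leNgt; apply/negP => xi.
  pose g : R := dotp x (base (v 0 i)) - v 0 i 0 ord0.
  have g0 : 0 < g by rewrite subr_gt0.
  pose X : R := \sum_l `|x 0 l|; have X0 : 0 <= X by exact: sumr_ge0.
  pose e : R := g / (2 * (X + 1)).
  have e0 : 0 < e by rewrite divr_gt0// mulr_gt0// ltr_wpDl.
  have q4 : 0 < g / (4 * q.+1%:R) by rewrite divr_gt0// mulr_gt0// ltr0n.
  have [m mP] := inv_small _ q4.
  have [k /mP ke vk] := close e m e0.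
  have [Avk /(_ x Kx)[y yk xy] _] := vP k.
  have [a1 _] := Avk i.
  have h1 := dotp_close x i k e (vk i).
  have h2 : dotp (x - y) (base (v_ k 0 i)) <= g / 4.
    apply: le_trans (ler_norm _) _; apply: le_trans (norm_dotp_le _ _) _.
    rewrite a1 mulr1.
    apply: (@le_trans _ _ (\sum_(l < q.+1) (g / (4 * q.+1%:R)))).
      by apply: ler_sum => l _; apply: le_trans (coord_le_enorm _ _) _; exact: le_trans xy ke.
    have q0 : (q.+1%:R : R) != 0 by rewrite pnatr_eq0.
    by rewrite sumr_const card_ord -(mulr_natr (g / _)) invfM mulrA divfK.
  have h3 : `|v 0 i 0 ord0 - v_ k 0 i 0 ord0| < e by exact: coord_ball (vk i).
  have h4 := yk i.
  have eE : e * (2 * (X + 1)) = g by rewrite /e divfK// gt_eqF// mulr_gt0// ltr_wpDl.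
  move: h1 h2 h3; rewrite -/X dotpBl ler_norml ltr_norml => /andP[_ h1] h2 /andP[h3 _].
  have : g <= X * e + g / 4 + e by rewrite {1}/g; lra.
  lra.
rewrite -[RHS]/(cone v); apply/seteqP; split => // y vy.
have pv i : dotp p (base (v 0 i)) < v 0 i 0 ord0.
  apply: (hrep_interior pK) => [|x /Kv]; last exact.
  by rewrite -enorm_gt0; have [-> _] := Av i.
(* Only points strictly inside [cone v] are sure to lie in nearby [cone (v_ k)]. Hence [y] is first
   moved towards the interior point [p] of [K], and a small [t] is chosen afterwards. *)
have yt (t : R) : 0 < t <= 1 -> K ((1 - t) *: y + t *: p).
  move=> /andP[t0 t1]; set z := (1 - t) *: y + t *: p.
  have zv i : dotp z (base (v 0 i)) < v 0 i 0 ord0.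
    rewrite dotpDl !dotpZl; have := vy i; have := pv i; nra.
  pose Z : R := \sum_l `|z 0 l|; have Z0 : 0 <= Z by exact: sumr_ge0.
  pose g : R := \big[Num.min/1]_i (v 0 i 0 ord0 - dotp z (base (v 0 i))).
  have g0 : 0 < g by apply/bigmin_gtP; split => // i _; rewrite subr_gt0.
  pose e : R := g / (Z + 1).
  have Z1 : 0 < Z + 1 by rewrite ltr_wpDl.
  have e0 : 0 < e by rewrite divr_gt0.
  apply: closed_approx => // r /inv_small[m mP].
  have [k /mP kr vk] := close e m e0.
  have [_ _ coneK] := vP k.
  have /coneK[x Kx zx] : cone (v_ k) z.
    move=> i; have h1 := dotp_close z i k e (vk i).
    have h3 : `|v 0 i 0 ord0 - v_ k 0 i 0 ord0| < e by exact: coord_ball (vk i).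
    have h5 : g <= v 0 i 0 ord0 - dotp z (base (v 0 i)) by exact: bigmin_le.
    have eE : e * (Z + 1) = g by rewrite /e divfK// gt_eqF.
    move: h1 h3; rewrite -/Z ler_norml ltr_norml => /andP[h1 _] /andP[_ h3]; lra.
  by exists x => //; exact: le_trans zx kr.
apply: closed_approx => // r r0.
pose D : R := enorm (y - p) + 1; have D0 : 0 < D by rewrite ltr_wpDl// enorm_ge0.
pose t : R := Num.min 1 (r / D).
have t0 : 0 < t by rewrite lt_min ltr01 divr_gt0.
exists ((1 - t) *: y + t *: p); first by apply: yt; rewrite t0 ge_min lexx.
have -> : y - ((1 - t) *: y + t *: p) = t *: (y - p).
  by apply/rowP => k; rewrite !mxE; ring.
rewrite enormZ gtr0_norm//; apply: (@le_trans _ _ (t * D)).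
  by rewrite ler_wpM2l ?(ltW t0)// lerDl.
by rewrite -ler_pdivlMr// ge_min lexx orbT.
Qed.

Lemma borel_body_hrep n :
  borel_body [set K : set 'rV[R]_q.+1 | convex_body K /\ hrep n K].
Proof.
rewrite (_ : mkset _ = @convex_body R q.+1 `\` [set K | convex_body K /\ ~ hrep n K]).
  apply: sigma_algebraCD; apply: sub_sigma_algebra; exact: hausdorff_open_hrepC.
apply/seteqP; split => K /= [Kb h]; split => //; first by move=> [].
by apply: contrapT => nh; apply: h.
Qed.

Lemma borel_body_polytope :
  borel_body [set K : set 'rV[R]_q.+1 | convex_body K /\ polytope K].
Proof.
rewrite (_ : mkset _ = \bigcup_n [set K : set 'rV[R]_q.+1 | convex_body K /\ hrep n K]).
  by apply: sigma_algebra_bigcup => n; exact: borel_body_hrep.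
apply/seteqP; split => [K [Kb /hrep_polytope[n hn]]|K [n _ [Kb [a [b KE]]]]].
  by exists n.
split => //; have [/compact_coord_bounded[C _ KC] _ _] := Kb.
by rewrite KE; apply: bounded_halfspaces_polytope; exists C => x k; rewrite -KE; exact: KC.
Qed.

Lemma borel_body_nfacets n :
  borel_body [set K : set 'rV[R]_q.+1 |
    [/\ convex_body K, polytope K & nfacets K = n%:R%:E]].
Proof.
rewrite (_ : mkset _ = ([set K | convex_body K /\ polytope K] `&`
    [set K : set 'rV[R]_q.+1 | convex_body K /\ hrep n K]) `\`
  \bigcup_(m in [set: 'I_n]) [set K : set 'rV[R]_q.+1 | convex_body K /\ hrep m K]).
  apply: sigma_algebra_onD.
  - by move=> K [[]].
  - apply: sigma_algebra_onI; [by move=> K []|exact: borel_body_polytope|exact: borel_body_hrep].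
  - by apply: sigma_algebra_on_bigcupfin => m; exact: borel_body_hrep.
have reduce K m : convex_body K -> hrep m K -> exists k : nat,
    [/\ (k <= m)%N, hrep k K & nfacets K = k%:R%:E :> \bar R].
  by move=> [_ _ [p pK]] hm; exact: hrep_reduce pK hm.
apply/seteqP; split => K /=.
  move=> [Kb Kp Kn]; have [m /(reduce _ _ Kb)[k [_ hk]]] := hrep_polytope Kp.
  rewrite Kn => -[] /eqP; rewrite eqr_nat => /eqP kE; rewrite -kE in hk.
  split => // -[i _ [_ /(reduce _ _ Kb)[l [li _]]]].
  by rewrite Kn => -[] /eqP; rewrite eqr_nat => /eqP nE; rewrite -nE leqNgt ltn_ord in li.
move=> [[[Kb Kp] [_ hn]] nlt]; split => //.
have [k [kn hk ->]] := reduce K n Kb hn; congr (_%:R%:E).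
apply/eqP; rewrite eqn_leq kn leqNgt; apply/negP => kn'.
by apply: nlt; exists (Ordinal kn').
Qed.

End hausdorff.

(** * Cells *)

Section convex_topology.
Variables (R : realType) (d : nat).
Implicit Types (A K : set 'rV[R]_d) (x y u v : 'rV[R]_d).

Lemma line_continuous x u : continuous (fun t : R => x + t *: u).
Proof.
move=> t; apply: cvgD; first exact: cvg_cst.
exact: scalel_continuous.
Qed.

Lemma convexR_connected A : convexR A -> connected A.
Proof.
move=> cA; have [->|/set0P[x Ax]] := eqVneq A set0; first exact: connected0.
rewrite (_ : A = connected_component A x); first exact: component_connected.
apply/seteqP; split; last exact: connected_component_sub.
move=> y Ay; pose f (t : R) : 'rV[R]_d := x + t *: (y - x).
have fA : f @` `[0, 1] `<=` A.
  move=> _ [t /= + <-]; rewrite in_itv/= => t01.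
  have -> : f t = t *: y + (1 - t) *: x by rewrite /f; apply/rowP => k; rewrite !mxE; ring.
  exact: cA.
have fx : (f @` `[0, 1]) x by exists 0; rewrite /= ?in_itv/= ?lexx ?ler01// /f scale0r addr0.
apply: (@connected_component_max _ A _ x fx fA).
  apply: connected_continuous_connected; first exact: segment_connected.
  by apply: continuous_subspaceT; exact: line_continuous.
by exists 1; rewrite /= ?in_itv/= ?lexx ?ler01// /f scale1r addrC subrK.
Qed.

Lemma shift_continuous v : continuous (fun x => x + v).
Proof.
move=> x B /nbhs_ballP[e /= e0 eB]; apply/nbhs_ballP; exists e => // y yb.
by apply: eB; split => // i j; rewrite !mxE /ball/= opprD addrACA subrr addr0; exact: yb.2.
Qed.

Lemma convex_body_shift v K : convex_body K -> convex_body [set x + v | x in K].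
Proof.
move=> [Kc Kcv [p Kp]]; split.
- apply: continuous_compact => //; apply: continuous_subspaceT.
  exact: shift_continuous.
- move/convex_setP: Kcv => Kcv; apply/convex_setP => _ _ t t01 [x Kx <-] [y Ky <-].
  exists (t *: x + (1 - t) *: y); first exact: Kcv.
  by apply/rowP => k; rewrite !mxE; ring.
- exists (p + v); move/nbhs_ballP: Kp => [e e0 eK].
  apply/nbhs_ballP; exists e => // y yb; exists (y - v); last by rewrite subrK.
  apply: eK; split => // i j; have := yb.2 i j.
  by rewrite !mxE /ball/= opprB addrA.
Qed.

End convex_topology.

Lemma convex_comb_lt (R : realDomainType) (t x y c : R) :
  0 <= t <= 1 -> x < c -> y < c -> t * x + (1 - t) * y < c.
Proof.
move=> /andP[t0 t1] xc yc.
have [->|tn0] := eqVneq t 0; first by rewrite mul0r add0r subr0 mul1r.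
have t0' : 0 < t by rewrite lt_def tn0.
nra.
Qed.

Section cell_polytope.
Variables (R : realType) (q n : nat) (a : 'I_n -> 'rV[R]_q.+1) (b : 'I_n -> R).
Implicit Types (x y v p : 'rV[R]_q.+1).

Let K := [set x | forall i, dotp x (a i) <= b i].

Variable p : 'rV[R]_q.+1.
Hypothesis p_int : forall i, dotp p (a i) < b i.

Let I := [set x | forall i, dotp x (a i) < b i].

Lemma convex_open_halfspaces : convexR I.
Proof.
by move=> x y t t01 hx hy i; rewrite dotpDl !dotpZl; exact: convex_comb_lt.
Qed.

Lemma closed_halfspaces : closed K.
Proof.
rewrite (_ : K = \bigcap_(i in setT) [set x | dotp x (a i) <= b i]).
  apply: closed_bigI => i _; apply: closed_le_fun; first exact: dotp_continuous.
  exact: continuous_constr.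
by apply/seteqP; split => x h i => [_|]; [exact: h|exact: h].
Qed.

Lemma interior_halfspaces : nbhs p K.
Proof.
have pi i : exists2 e : R, 0 < e & forall x, ball p e x -> dotp x (a i) <= b i.
  have op : open [set x | dotp x (a i) < b i].
    by apply: open_lt_fun; [exact: dotp_continuous|exact: continuous_constr].
  have /nbhs_ballP[e /= e0 eb] : nbhs p [set x | dotp x (a i) < b i].
    by apply: open_nbhs_nbhs; split => //; exact: p_int.
  by exists e => // x /eb/ltW.
have [e e0 eb] := fin_all_exists2 pi.
apply/nbhs_ballP; exists (\big[Num.min/1]_i e i) => /=.
  by apply/bigmin_gtP; split.
move=> x px i; apply: eb; apply: le_ball px; exact: bigmin_le.
Qed.

Lemma closure_open_halfspaces : closure I = K.
Proof.
apply/seteqP; split.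
  have /closureS/subset_trans : I `<=` K by move=> x h i; exact: ltW.
  by apply; rewrite -(closure_id _).1//; exact: closed_halfspaces.
move=> x Kx B /(@interior_move _ _ x (p - x))[s s0 sB].
pose t : R := Num.min s 1.
have t0 : 0 < t by rewrite lt_min s0 ltr01.
have ts : t <= s by rewrite ge_min lexx.
have t1 : t <= 1 by rewrite ge_min lexx orbT.
exists (x + t *: (p - x)); split; last by apply: sB; rewrite ts ltW.
move=> i; rewrite dotpDl dotpZl dotpBl.
have := Kx i; have := p_int i; nra.
Qed.

(** The open polytope is convex and avoids the hyperplanes of [E], so it lies in the component of
    [p]. Conversely, the image of the component under the functional of [a i] is an interval; beyond
    [b i] it would contain [b i], a value taken only on a hyperplane of [E]. *)
Lemma cells_halfspaces (E : set (set 'rV[R]_q.+1)) (W : set 'rV[R]_q.+1) :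
  K `<=` W -> (forall i, E (hplane (a i) (b i))) ->
  (forall H, E H -> H `&` W !=set0 -> exists i, H = hplane (a i) (b i)) ->
  cells E K.
Proof.
move=> KW Eab Ehit; pose U := ~` (\bigcup_(H in E) H).
have IU : I `<=` U.
  move=> x Ix [H EH Hx]; have [|i HE] := Ehit H EH.
    by exists x; split => //; apply: KW => i; exact: ltW.
  by have := Ix i; rewrite HE in Hx; rewrite -{1}Hx ltxx.
exists p; first exact: IU.
rewrite -closure_open_halfspaces; congr closure; apply/seteqP; split.
  exact: connected_component_max IU (convexR_connected convex_open_halfspaces).
move=> x Cx i; rewrite ltNge; apply/negP => xi.
pose f y := dotp y (a i).
have : connected (f @` connected_component U p).
  apply: connected_continuous_connected; first exact: component_connected.
  by apply: continuous_subspaceT; exact: dotp_continuous.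
have Cp : connected_component U p p by apply: connected_component_refl; exact: IU.
move=> /connected_intervalP/(_ (f p) (f x)).
move=> /(_ (ex_intro2 _ _ p Cp erefl) (ex_intro2 _ _ x Cx erefl) (b i)).
rewrite xi (ltW (p_int i)) => /(_ isT)[z Cz fz].
have := connected_component_sub Cz; apply.
by exists (hplane (a i) (b i)); [exact: Eab|exact: fz].
Qed.

Hypothesis irredundant :
  forall i, exists x, b i < dotp x (a i) /\ forall j, j != i -> dotp x (a j) <= b j.
Hypothesis bounded : exists C, forall x k, K x -> `|x 0 k| <= C.

Lemma halfspaces_body : [/\ convex_body K, polytope K & nfacets K = n%:R%:E].
Proof.
split.
- split.
  + apply: bounded_closed_compact; last exact: closed_halfspaces.
    have [C KC] := bounded; exists `|C|; split => // M CM x Kx.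
    rewrite /= /Num.norm/= mx_normrE; apply/bigmax_leP; split.
      exact: le_trans (ltW CM).
    move=> [i k] _ /=; rewrite ord1; apply: le_trans (KC _ _ Kx) _.
    by apply: le_trans (ler_norm _) _; exact: ltW.
  + by apply/convex_setP; exact: convex_halfspaces.
  + by exists p; exact: interior_halfspaces.
- exact: bounded_halfspaces_polytope.
- by apply: (nfacets_irredundant irredundant (p := p)).
Qed.

End cell_polytope.

(** Translation changes only the bounds [b]. The law of the typical cell concerns cells moved to
    their center. *)
Lemma halfspaces_shift_body (R : realType) (q n : nat) (a : 'I_n -> 'rV[R]_q.+1)
    (b : 'I_n -> R) (p v : 'rV[R]_q.+1) :
  (forall i, dotp p (a i) < b i) ->
  (forall i, exists x, b i < dotp x (a i) /\ forall j, j != i -> dotp x (a j) <= b j) ->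
  (exists C, forall x k, (forall i, dotp x (a i) <= b i) -> `|x 0 k| <= C) ->
  let K := [set x - v | x in [set x | forall i, dotp x (a i) <= b i]] in
  [/\ convex_body K, polytope K & nfacets K = n%:R%:E].
Proof.
move=> p_int irr [C KC] K.
have -> : K = [set x | forall i, dotp x (a i) <= b i - dotp v (a i)].
  apply/seteqP; split => [_ [x Kx <-] i|x Kx].
    by rewrite dotpBl lerB.
  exists (x + v); last by rewrite addrK.
  by move=> i; rewrite dotpDl -lerBrDr; exact: Kx.
apply: (@halfspaces_body _ _ _ _ _ (p - v)).
- by move=> i; rewrite dotpBl ltrD2r.
- move=> i; have [x [xi xj]] := irr i; exists (x - v); split.
    by rewrite dotpBl ltrD2r.
  by move=> j /xj; rewrite dotpBl lerD2r.
exists (C + \sum_l `|v 0 l|) => x k Kx.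
have /(KC _ k) : forall i, dotp (x + v) (a i) <= b i.
  by move=> i; rewrite dotpDl -lerBrDr; exact: Kx.
rewrite mxE => h; rewrite -[x 0 k](addrK (v 0 k)); apply: le_trans (ler_normB _ _) _.
apply: lerD => //; rewrite (bigD1 k)//= lerDl sumr_ge0//.
Qed.

(** * The number of cells that meet a convex window *)

Section count_cells.
Variables (R : realType) (d : nat).
Implicit Types (E : set (set 'rV[R]_d)) (W : set 'rV[R]_d).

Lemma counting_le_nat (T : choiceType) (A : set T) (m : nat) :
  (A #<= `I_m)%card -> (counting A <= (m%:R : R)%:E)%E.
Proof.
move=> Am; rewrite /counting asboolT; last by apply/finite_set_leP; exists m.
by rewrite lee_fin ler_nat geq_card_fset_set.
Qed.

(** A cell meeting the open set [W] has a point of its component in [W], and the sides of the [k]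
    hyperplanes on which that point lies determine the cell: points of [W] on equal sides are joined
    inside [W] without crossing a hyperplane of [E]. *)
Lemma count_cells_le E W k : E `<=` @hyperplane R d -> open W -> convexR W ->
  counting (E `&` [set H | H `&` W !=set0]) = (k%:R : R)%:E ->
  forall S, S `<=` [set K | cells E K /\ K `&` W !=set0] ->
  (counting S <= ((2 ^+ k : R)%:E))%E.
Proof.
move=> EH Wo Wc; set F := E `&` _ => Fk S SK.
have fF : finite_set F.
  by move/counting_finite: Fk => Fk; exists k.
have Fcard : #|` fset_set F| = k by apply: card_fset_set; apply/counting_finite; exact: Fk.
have gex H : exists ut : 'rV[R]_d * R, E H -> H = hplane ut.1 ut.2.
  have [/EH[u [t [_ HE]]]|nE] := pselect (E H); first by exists (u, t).
  by exists (0, 0).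
have [g gP] := choice gex.
pose U := ~` (\bigcup_(H in E) H).
have ptex K : exists y, S K ->
    [/\ W y, U y & K = closure (connected_component U y)].
  have [/SK[[x Ux KE] [z [Kz Wz]]]|nS] := pselect (S K); last by exists 0.
  have [y [Cy Wy]] : connected_component U x `&` W !=set0.
    by rewrite KE in Kz; apply: Kz; apply: open_nbhs_nbhs.
  exists y => _; split => //; first exact: connected_component_sub Cy.
  by rewrite KE (same_connected_component Cy).
have [pt ptP] := choice ptex.
pose side H y := (g H).2 < dotp y (g H).1.
pose sgn K := [fset H in fset_set F | side H (pt K)]%fset.
have sgn_inj : {in S &, injective sgn}.
  move=> K L /set_mem SK' /set_mem SL KL.
  have [WK UK KE] := ptP K SK'; have [WL UL LE] := ptP L SL.
  have same H : F H -> side H (pt K) = side H (pt L).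
    move=> FH; have : H \in fset_set F by rewrite in_fset_set// mem_set.
    move=> HF; have := congr1 (fun A : {fset set 'rV[R]_d} => H \in A) KL.
    by rewrite /sgn !inE HF.
  (* Failure of [side] includes the hyperplane itself, so [B] has to exclude the hyperplanes
     separately. *)
  pose B := [set y | W y /\ forall H, F H ->
    ~ H y /\ side H y = side H (pt K)].
  have offH y H : U y -> F H -> ~ H y by move=> Uy [EH' _] Hy; apply: Uy; exists H.
  have Bc : connected B.
    apply: convexR_connected => y z t t01 [Wy hy] [Wz hz]; split; first exact: Wc.
    move=> H FH; have [ny sy] := hy H FH; have [nz sz] := hz H FH.
    have HE := gP H FH.1.
    have ny' : dotp y (g H).1 != (g H).2 by apply/eqP => e; apply: ny; rewrite HE.
    have nz' : dotp z (g H).1 != (g H).2 by apply/eqP => e; apply: nz; rewrite HE.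
    rewrite -sy; rewrite -sy in sz; rewrite /side in sy sz *.
    rewrite {1}HE /hplane/= dotpDl !dotpZl.
    case: (ltgtP (dotp y (g H).1) (g H).2) ny' sz => // h2 _ sz.
      have h1 : dotp z (g H).1 < (g H).2.
        by rewrite lt_neqAle nz' leNgt sz.
      have h3 := convex_comb_lt t01 h2 h1.
      by split; [apply/eqP; rewrite lt_eqF|apply/negbTE; rewrite -leNgt ltW].
    have h3 := convex_comb_lt t01 (etrans (ltrN2 _ _) h2) (etrans (ltrN2 _ _) sz).
    rewrite !mulrN -opprD ltrN2 in h3.
    by split => //; apply/eqP; rewrite gt_eqF.
  have BU : B `<=` U.
    move=> y [Wy hy] [H EH' Hy].
    have FH : F H by split => //; exists y.
    by have [] := hy H FH.
  have BK : B (pt K) by split => // H FH; split => //; exact: offH UK FH.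
  have BL : B (pt L) by split => // H FH; split; [exact: offH UL FH|rewrite same].
  rewrite KE LE; congr closure; apply: same_connected_component.
  exact: (connected_component_max BK BU Bc BL).
have -> : (2 ^+ k : R) = (2 ^ k)%N%:R by rewrite natrX.
apply: counting_le_nat.
have [f fE] := Pinj sgn_inj.
rewrite -(card_le_eql (card_image f)) -fE.
apply: (@card_le_trans _ _ _ [set` fpowerset (fset_set F)]).
  apply: subset_card_le => _ [K _ <-]; rewrite /= fpowersetE.
  by apply/fsubsetP => H; rewrite !inE => /andP[].
have /card_eq_fsetP h : #|` fpowerset (fset_set F)| = (2 ^ k)%N.
  by rewrite card_fpowerset Fcard.
by rewrite (card_le_eql h).
Qed.

End count_cells.

(** * A polytope with many facets, and its perturbations *)

Section ideal_facets.
Variables (R : realType) (q m N : nat) (g : 'I_m -> 'I_q.+1 -> nat).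
Implicit Types (p z : 'rV[R]_q.+1).

Definition norm1 p := \sum_k `|p 0 k|.

(* The paraboloid below has curvature [curv], small enough to stay high above
   the apex of the cone; facets may move by [slack * mesh^2] without ceasing
   to be facets. *)
Definition curv : R := (8 * (2 * q.+1%:R + 1))^-1.
Definition slack : R := curv / 8.
(** The nodes lie in the unit cube, over which the cone rises to at most [q.+1%:R + 1]; the
    paraboloid stays above that. *)
Definition height : R := q.+1%:R + 3.

(** Here [d] is [q.+2]: the [option] part indexes the [d] faces of the cone, which leaves [n - d]
    tangents. *)
Definition facet_index := (option 'I_q.+1 + 'I_m)%type.

Definition mesh (i : facet_index) : R := if i is inr _ then N%:R^-1 else 1.

Definition node (i : facet_index) : 'rV[R]_q.+1 :=
  if i is inr j then \row_k (N%:R^-1 * (g j k)%:R) else 0.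

Definition slope (i : facet_index) : 'rV[R]_q.+1 :=
  match i with
  | inl None => const_mx (-1)
  | inl (Some k) => delta_mx 0 k
  | inr _ => (2 * curv) *: node i
  end.

Definition offset (i : facet_index) : R :=
  if i is inr _ then height + curv * dotp (node i) (node i) else 1.

(* The affine functions bounding the ideal polytope: [q.+2] faces of a cone
   from below, and from above the tangents at the grid points [node (inr j)]
   of the paraboloid [height - curv * |p|^2]. *)
Definition ideal (i : facet_index) p : R := offset i - dotp (slope i) p.

(** The right-hand side is what an affine error can reach if it is at most [slack * mesh^2] at the
    node and at the points one mesh away along the axes. *)
Definition near_ideal (i : facet_index) (f : 'rV[R]_q.+1 -> R) := forall p,
  `|f p - ideal i p| <= slack * (mesh i ^+ 2 + 2 * mesh i * norm1 (p - node i)).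

Hypothesis N0 : (0 < N)%N.
Hypothesis gN : forall j k, (g j k < N)%N.
Hypothesis g_inj : forall i j, i != j -> exists k, g i k != g j k.

Let q0 : (1 : R) <= q.+1%:R. Proof. by rewrite ler1n. Qed.

Lemma curv_gt0 : 0 < curv.
Proof. by rewrite invr_gt0; have := q0; lra. Qed.

Let curvQ : curv * q.+1%:R * 16 + curv * 8 = 1.
Proof.
have h : 8 * (2 * q.+1%:R + 1) != 0 :> R by apply: lt0r_neq0; have := q0; lra.
have := mulVf h; rewrite -/curv; lra.
Qed.

Let slackE : curv = 8 * slack. Proof. by rewrite /slack; field. Qed.

Lemma slack_gt0 : 0 < slack. Proof. by rewrite divr_gt0// curv_gt0. Qed.

Let slackQ : slack * q.+1%:R * 128 + slack * 64 = 1.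
Proof. by have := curvQ; rewrite slackE; lra. Qed.

Lemma mesh_gt0 i : 0 < mesh i.
Proof. by case: i => [?|?] //=; rewrite invr_gt0 ltr0n. Qed.

Lemma mesh_le1 i : mesh i <= 1.
Proof. by case: i => [?|?] //=; rewrite invf_le1 ?ltr0n// ler1n. Qed.

Lemma node01 i k : 0 <= node i 0 k <= 1.
Proof.
case: i => [?|j] /=; rewrite mxE ?lexx ?ler01//.
rewrite mulr_ge0 ?invr_ge0//= mulrC ler_pdivrMr ?ltr0n// mul1r ler_nat.
exact: ltnW.
Qed.

Lemma norm1_ge0 p : 0 <= norm1 p. Proof. exact: sumr_ge0. Qed.

Lemma norm1D p z : norm1 (p + z) <= norm1 p + norm1 z.
Proof.
rewrite -big_split; apply: ler_sum => k _; rewrite mxE; exact: ler_normD.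
Qed.

Lemma norm1N p : norm1 (- p) = norm1 p.
Proof. by apply: eq_bigr => k _; rewrite mxE normrN. Qed.

Lemma norm1_node i : norm1 (node i) <= q.+1%:R.
Proof.
apply: (@le_trans _ _ (\sum_(k < q.+1) 1)); last by rewrite sumr_const card_ord.
by apply: ler_sum => k _; have := node01 i k; rewrite ler_norml; lra.
Qed.

Lemma coord_le_norm1 p k : `|p 0 k| <= norm1 p.
Proof. by rewrite /norm1 (bigD1 k)//= lerDl sumr_ge0. Qed.

Lemma dotp_le_norm1 (B : R) z p : (forall k, `|z 0 k| <= B) -> `|dotp z p| <= B * norm1 p.
Proof.
move=> zB; apply: le_trans (ler_norm_sum _ _ _) _; rewrite mulr_sumr.
by apply: ler_sum => k _; rewrite normrM ler_wpM2r.
Qed.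

Lemma dotp_node i p : `|dotp (node i) p| <= norm1 p.
Proof.
rewrite -[leRHS]mul1r; apply: dotp_le_norm1 => k.
by have := node01 i k; rewrite ler_norml; lra.
Qed.

Lemma sqr_node i : 0 <= dotp (node i) (node i) <= q.+1%:R.
Proof.
rewrite dotp_ge0/=; apply: le_trans (ler_norm _) _.
exact: le_trans (dotp_node i _) (norm1_node i).
Qed.

Lemma dotp_const (c : R) p : dotp (const_mx c) p = c * \sum_k p 0 k.
Proof. by rewrite /dotp mulr_sumr; apply: eq_bigr => k _; rewrite mxE. Qed.

Lemma norm1_delta k : norm1 (delta_mx 0 k) = 1.
Proof.
rewrite /norm1 (bigD1 k)//= mxE !eqxx normr1 big1 ?addr0// => i ik.
by rewrite mxE (negbTE ik) andbF normr0.
Qed.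

(** The error is affine. Two values of size [slack * mesh^2] at distance [mesh] allow slopes up to
    [2 * slack * mesh], which are then multiplied by the l1-distance to the node. *)
Lemma near_ideal_affine i (s : R) z :
  `|s - dotp z (node i) - ideal i (node i)| <= slack * mesh i ^+ 2 ->
  (forall k, `|s - dotp z (node i + mesh i *: delta_mx 0 k)
             - ideal i (node i + mesh i *: delta_mx 0 k)| <= slack * mesh i ^+ 2) ->
  near_ideal i (fun p => s - dotp z p).
Proof.
move=> h0 hk p; set e := mesh i in h0 hk *; have e0 : 0 < e := mesh_gt0 i.
set c := node i in h0 hk *.
pose v := slope i - z.
have DE p' : s - dotp z p' - ideal i p' = (s - offset i) + dotp v p'.
  by rewrite /ideal dotpBl; ring.
rewrite DE in h0.
have vk k : e * `|v 0 k| <= 2 * (slack * e ^+ 2).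
  have := hk k; rewrite DE dotpDr dotpZr [dotp v (delta_mx 0 k)]dotpC dotp_deltal => h1.
  rewrite -[e in e * _]gtr0_norm// -normrM.
  have -> : e * v 0 k = ((s - offset i) + (dotp v c + e * v 0 k)) - ((s - offset i) + dotp v c) by ring.
  by apply: le_trans (ler_normB _ _) _; lra.
rewrite DE; have -> : s - offset i + dotp v p = (s - offset i + dotp v c) + dotp v (p - c).
  by rewrite dotpBr; ring.
apply: le_trans (ler_normD _ _) _; rewrite mulrDr; apply: lerD => //.
have vB k : `|v 0 k| <= 2 * slack * e.
  by rewrite -(ler_pM2l e0); have := vk k; lra.
by apply: le_trans (dotp_le_norm1 _ vB) _; rewrite le_eqVlt; apply/orP; left; apply/eqP; ring.
Qed.

Lemma near_lower (f : 'rV[R]_q.+1 -> R) l p : near_ideal (inl l) f ->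
  `|f p - ideal (inl l) p| <= slack * (1 + 2 * norm1 p).
Proof. by move=> /(_ p); rewrite /= subr0 expr1n mulr1. Qed.

Lemma near_upper (f : 'rV[R]_q.+1 -> R) j p : near_ideal (inr j) f ->
  `|f p - ideal (inr j) p| <= slack * (1 + 2 * norm1 p + 2 * q.+1%:R).
Proof.
move=> /(_ p) h; apply: le_trans h _; rewrite ler_pM2l ?slack_gt0//.
have e0 := mesh_gt0 (inr j); have e1 := mesh_le1 (inr j).
have := norm1D p (- node (inr j)); rewrite norm1N.
have := norm1_node (inr j); have := norm1_ge0 (p - node (inr j)).
move: (norm1 (p - _)) (norm1 (node _)) (mesh _) e0 e1 => x y e e0 e1 x0 yq xy.
have : e ^+ 2 <= 1 by rewrite expr_le1// ltW.
have : e * x <= x by rewrite ler_piMl.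
lra.
Qed.

Lemma ideal_upper_bounds j p :
  height - 2 * curv * norm1 p <= ideal (inr j) p <= height + 2 * curv * norm1 p + 1.
Proof.
rewrite /ideal /offset/= dotpZl; set c := node (inr j).
have := dotp_node (inr j) p; rewrite ler_norml => /andP[h1 h2].
have /andP[h3 h4] := sqr_node (inr j).
have c0 := curv_gt0; have cQ := curvQ; rewrite -/c in h1 h2 h3 h4.
have h5 : curv * dotp c c <= curv * q.+1%:R by rewrite ler_pM2l.
have h6 : 0 <= curv * dotp c c by rewrite mulr_ge0// ltW.
have h7 : curv * dotp c p <= curv * norm1 p by rewrite ler_pM2l.
have h8 : curv * - norm1 p <= curv * dotp c p by rewrite ler_pM2l.
lra.
Qed.

(* The tangent at the node of [j] lies above the paraboloid by
   [curv * |p - node j|^2], which at another node is at least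
   [curv * mesh^2] and at least [curv * mesh] times the l1-distance. *)
Lemma ideal_gap (fi fj : 'rV[R]_q.+1 -> R) i j : i != j ->
  let c := node (inr i) in
  near_ideal (inr i) fi -> near_ideal (inr j) fj ->
  fi c <= ideal (inr i) c + slack * N%:R^-1 ^+ 2 /\
  ideal (inr i) c + 5 * slack * N%:R^-1 ^+ 2 <= fj c.
Proof.
move=> ij c /(_ c) ni /(_ c) nj; set e : R := N%:R^-1 in ni nj *.
have e0 : 0 < e by rewrite invr_gt0 ltr0n.
split.
  move: ni; rewrite subrr (_ : norm1 0 = 0); last first.
    by rewrite /norm1 big1// => k _; rewrite mxE normr0.
  by rewrite mulr0 addr0 ler_norml /= -/e; lra.
pose D k : R := (g i k)%:R - (g j k)%:R.
have dE k : (c - node (inr j)) 0 k = e * D k.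
  by rewrite !mxE -mulrBr.
have n1E : norm1 (c - node (inr j)) = e * \sum_k `|D k|.
  by rewrite mulr_sumr; apply: eq_bigr => k _; rewrite dE normrM gtr0_norm.
have sqE : dotp (c - node (inr j)) (c - node (inr j)) = e ^+ 2 * \sum_k `|D k| ^+ 2.
  rewrite mulr_sumr; apply: eq_bigr => k _; rewrite dE real_normK ?num_real//; ring.
(* [D k] is a difference of integers. *)
have D1 k : `|D k| <= `|D k| ^+ 2.
  have [d0|d0] := eqVneq (g i k) (g j k).
    by rewrite /D d0 subrr normr0 expr0n.
  have h1 : 1 <= `|D k|.
    move: d0; rewrite neq_ltn => /orP[] lt.
      by rewrite /D distrC -natrB ?(ltnW lt)// ger0_norm// ler1n subn_gt0.
    by rewrite /D -natrB ?(ltnW lt)// ger0_norm// ler1n subn_gt0.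
  by rewrite expr2 ler_peMl.
have S12 : \sum_k `|D k| <= \sum_k `|D k| ^+ 2 by exact: ler_sum.
have S2 : 1 <= \sum_k `|D k| ^+ 2.
  have [k gk] := g_inj ij; rewrite (bigD1 k)//=.
  have : 1 <= `|D k| ^+ 2.
    have h : D k != 0 by rewrite subr_eq0 eqr_nat.
    have := D1 k; have : 0 < `|D k| by rewrite normr_gt0.
    nra.
  have : 0 <= \sum_(i < q.+1 | i != k) `|D i| ^+ 2 by apply: sumr_ge0 => l _; rewrite exprn_ge0.
  lra.
have gapE : ideal (inr j) c = ideal (inr i) c + curv * dotp (c - node (inr j)) (c - node (inr j)).
  rewrite /ideal /offset /slope !dotpZl -/c dotpBl !dotpBr [dotp c (node (inr j))]dotpC; ring.
move: nj; rewrite n1E gapE sqE ler_norml -/(mesh (inr j)) (_ : mesh (inr j) = e)// slackE => /andP[h _].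
set S := \sum_k `|D k| ^+ 2 in S12 S2 h *; set S' := \sum_k `|D k| in S12 h *.
have a0 : 0 < slack * e ^+ 2 by rewrite mulr_gt0// ?slack_gt0// exprn_gt0.
set A := slack * e ^+ 2 in a0 *.
(* As [curv] is [8 * slack], what remains is [8 * A * S - A - 2 * A * S']. This is at least [5 * A],
   since [S' <= S] and [1 <= S]. *)
have h' : - (A + 2 * A * S') <= fj c - (ideal (inr i) c + 8 * A * S).
  by move: h; rewrite /A; lra.
have : A * S' <= A * S by rewrite ler_pM2l.
have : A * 1 <= A * S by rewrite ler_pM2l.
have -> : 5 * slack * e ^+ 2 = 5 * A by rewrite /A; ring.
lra.
Qed.

Lemma ideal_None p : ideal (inl None) p = 1 + \sum_k p 0 k.
Proof. by rewrite /ideal /= dotp_const mulN1r opprK. Qed.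

Lemma ideal_Some k p : ideal (inl (Some k)) p = 1 - p 0 k.
Proof. by rewrite /ideal /= dotp_deltal. Qed.

(** Over [tip l] the face [l] of the cone has height 2 and the others at most 1, so the level 3/2
    separates them in spite of the tolerance. *)
Let tip (l : option 'I_q.+1) : 'rV[R]_q.+1 :=
  if l is Some k then - delta_mx 0 k else delta_mx 0 ord0.

Let sum_delta (k : 'I_q.+1) : \sum_i (delta_mx 0 k : 'rV[R]_q.+1) 0 i = 1.
Proof.
rewrite (bigD1 k)//= mxE !eqxx big1 ?addr0// => i ik.
by rewrite mxE (negbTE ik) andbF.
Qed.

Let norm1_tip l : norm1 (tip l) = 1.
Proof. by case: l => [k|] /=; rewrite ?norm1N norm1_delta. Qed.

Let ideal_tip l l' : l != l' -> ideal (inl l') (tip l) <= 1.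
Proof.
case: l' l => [k'|] [k|]; rewrite ?ideal_None ?ideal_Some //=.
- by rewrite (inj_eq (@Some_inj _)) !mxE eqxx eq_sym => /negbTE -> /=; lra.
- by move=> _; rewrite mxE; case: (_ && _) => /=; lra.
- by move=> _; under eq_bigr do rewrite mxE; rewrite sumrN sum_delta; lra.
Qed.

Let ideal_tipE l : ideal (inl l) (tip l) = 2.
Proof.
case: l => [k|]; rewrite ?ideal_None ?ideal_Some /=.
  by rewrite !mxE !eqxx /=; lra.
by rewrite sum_delta; lra.
Qed.

(** Makes the classes of hyperplanes disjoint. Two cone faces differ over a tip, two tangents over a
    node, a cone face and a tangent over the origin. *)
Lemma near_ideal_inj i i' (f0 : 'rV[R]_q.+1 -> R) :
  near_ideal i f0 -> near_ideal i' f0 -> i = i'.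
Proof.
have a0 := slack_gt0; have aQ := slackQ.
have aq : 0 <= slack * q.+1%:R by rewrite mulr_ge0// ltW.
have lower_upper l j : near_ideal (inl l) f0 -> ~ near_ideal (inr j) f0.
  move=> /(@near_lower f0 l 0) n1 /(@near_upper f0 j 0) n2.
  have n0 : norm1 (0 : 'rV[R]_q.+1) = 0 by rewrite /norm1 big1// => k _; rewrite mxE normr0.
  have := ideal_upper_bounds j 0; move: n1 n2; rewrite /ideal/= !dotp0r !n0 !ler_norml.
  rewrite /height; have := q0; lra.
case: i i' => [l|j] [l'|j'] ni ni'; [|by case: (lower_upper l j')|by case: (lower_upper l' j)|].
  congr inl; apply/eqP; apply: contrapT => /negP ll'.
  have := @near_lower f0 l (tip l) ni; have := @near_lower f0 l' (tip l) ni'.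
  rewrite norm1_tip ideal_tipE; have := @ideal_tip l l' ll'; rewrite !ler_norml.
  have := q0; lra.
congr inr; apply/eqP; apply: contrapT => /negP jj'.
have [h1 h2] := @ideal_gap f0 f0 j j' jj' ni ni'.
have : 0 < slack * N%:R^-1 ^+ 2 by rewrite mulr_gt0// exprn_gt0// invr_gt0 ltr0n.
lra.
Qed.

Variable f : facet_index -> 'rV[R]_q.+1 -> R.

Hypothesis near_f : forall i, near_ideal i (f i).

Lemma near_inner_point :
  (forall l, f (inl l) 0 < 2) /\ forall j, 2 < f (inr j) 0.
Proof.
have a0 := slack_gt0; have aQ := slackQ.
have aq : 0 <= slack * q.+1%:R by rewrite mulr_ge0// ltW.
have n0 : norm1 (0 : 'rV[R]_q.+1) = 0 by rewrite /norm1 big1// => k _; rewrite mxE normr0.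
split => [l|j].
  have := near_lower 0 (near_f (inl l)); rewrite n0 /ideal/= dotp0r ler_norml; lra.
have := near_upper 0 (near_f (inr j)); have := ideal_upper_bounds j 0.
rewrite n0 ler_norml /height; have := q0; lra.
Qed.

Lemma near_upper_irredundant j : exists h p, [/\ f (inr j) p < h,
  forall j', j' != j -> h <= f (inr j') p & forall l, f (inl l) p <= h].
Proof.
have a0 := slack_gt0; have aQ := slackQ.
have aq : 0 <= slack * q.+1%:R by rewrite mulr_ge0// ltW.
set c := node (inr j); set e : R := N%:R^-1.
have e0 : 0 < slack * e ^+ 2 by rewrite mulr_gt0// exprn_gt0// invr_gt0 ltr0n.
(* Over the node of [j] its own tangent exceeds the ideal value by at most one tolerance and every
   other tangent by at least five, so the level two tolerances up violates [j] alone. *)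
exists (ideal (inr j) c + 2 * slack * e ^+ 2), c; split.
- have := near_f (inr j) c; rewrite subrr (_ : norm1 0 = 0).
    by rewrite mulr0 addr0 ler_norml /= -/e; lra.
  by rewrite /norm1 big1// => k _; rewrite mxE normr0.
- move=> j' jj'; rewrite eq_sym in jj'.
  have [_] := ideal_gap jj' (near_f _) (near_f _); rewrite -/c -/e; lra.
move=> l; have := near_lower c (near_f (inl l)).
have n1 : norm1 c <= q.+1%:R := norm1_node (inr j).
have an1 : slack * norm1 c <= slack * q.+1%:R by rewrite ler_pM2l.
have il : ideal (inl l) c <= 1 + q.+1%:R.
  case: l => [k|]; rewrite ?ideal_None ?ideal_Some.
    by have := node01 (inr j) k; rewrite -/c; have := q0; lra.
  rewrite lerD2l; apply: le_trans n1; apply: ler_sum => k _; exact: ler_norm.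
have : height - curv * q.+1%:R <= ideal (inr j) c.
  rewrite /ideal /offset /slope dotpZl -/c; have /andP[h1 h2] := sqr_node (inr j).
  have := curv_gt0; rewrite -/c in h1 h2 *; nra.
rewrite ler_norml /height slackE; lra.
Qed.

Lemma near_lower_irredundant l : exists h p, [/\ h < f (inl l) p,
  forall l', l' != l -> f (inl l') p <= h & forall j, h <= f (inr j) p].
Proof.
have a0 := slack_gt0; have aQ := slackQ; have cQ := curvQ; have c0 := curv_gt0.
have aq : 0 <= slack * q.+1%:R by rewrite mulr_ge0// ltW.
have cq : 0 <= curv * q.+1%:R by rewrite mulr_ge0// ltW.
exists (3 / 2), (tip l); split.
- have := near_lower (tip l) (near_f (inl l)); rewrite norm1_tip ideal_tipE ler_norml.
  have := q0; lra.
- move=> l' l'l; have := near_lower (tip l) (near_f (inl l')); rewrite norm1_tip ler_norml.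
  by rewrite eq_sym in l'l; have := @ideal_tip l l' l'l; have := q0; lra.
move=> j; have := near_upper (tip l) (near_f (inr j)); have := ideal_upper_bounds j (tip l).
rewrite norm1_tip ler_norml /height; have := q0; lra.
Qed.

Definition size_bound : R := (height + 1) / curv + 2 * height + 4.

(** The cone rises at rate at least [8 * curv] in the l1-norm, the tangents at most at rate
    [2 * curv], and the errors, of rate [2 * slack], do not close the gap. So the two sides meet at
    bounded distance. *)
Lemma near_bounded h p (j0 : 'I_m) :
  (forall l, f (inl l) p <= h) -> (forall j, h <= f (inr j) p) ->
  `|h| <= size_bound /\ norm1 p <= size_bound.
Proof.
move=> lo up; have a0 := slack_gt0; have aQ := slackQ; have cQ := curvQ; have c0 := curv_gt0.
have aq : 0 <= slack * q.+1%:R by rewrite mulr_ge0// ltW.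
have cq : 0 <= curv * q.+1%:R by rewrite mulr_ge0// ltW.
set S := norm1 p; have S0 : 0 <= S := norm1_ge0 p.
(* The origin of [curv]: if all faces stayed below this, each [- p 0 k] and the sum of the [p 0 k]
   would be less than [8 * curv * S]. Then [S] would be less than
   [8 * curv * S * (2 * q.+1%:R + 1)], which is [S]. *)
have [l hl] : exists l, 1 + 8 * curv * S <= ideal (inl l) p.
  apply: contrapT => /forallNP hl.
  have h1 k : - p 0 k < 8 * curv * S.
    by have := hl (Some k); rewrite ideal_Some => /negP; rewrite -ltNge; lra.
  have h2 : \sum_k p 0 k < 8 * curv * S.
    by have := hl None; rewrite ideal_None => /negP; rewrite -ltNge; lra.
  have h3 : S <= \sum_k (p 0 k + 2 * (8 * curv * S)).
    apply: ler_sum => k _; have := h1 k.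
    have : 0 <= 8 * curv * S by rewrite !mulr_ge0// ltW.
    by case: ler0P => _; lra.
  move: h3; rewrite big_split/= sumr_const card_ord -(mulr_natr (2 * _)).
  have : curv * q.+1%:R * 16 * S + curv * 8 * S = S by rewrite -mulrDl cQ mul1r.
  lra.
have := near_lower p (near_f (inl l)); have := near_upper p (near_f (inr j0)).
have := ideal_upper_bounds j0 p; have := lo l; have := up j0.
rewrite !ler_norml -/S => u1 u2 /andP[i1 i2] /andP[n1 n2] /andP[n3 n4].
have cS : curv * S = 8 * (slack * S) by rewrite slackE; ring.
have aS : 0 <= slack * S by rewrite mulr_ge0// ltW.
have hq := q0.
have key : curv * S <= height + 1 by rewrite /height in i1 i2 *; lra.
have Sb : S <= (height + 1) / curv by rewrite ler_pdivlMr// mulrC.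
have T0 : 0 <= (height + 1) / curv by apply: le_trans Sb.
rewrite /size_bound /height in key Sb T0 i1 i2 *.
split; last lra.
apply/andP; split; lra.
Qed.

End ideal_facets.

(** * Classes of hyperplanes *)

Section graph_coordinates.
Variables (R : realType) (q : nat) (w : 'rV[R]_q.+2) (s0 r : R).
Hypotheses (w0 : w 0 ord0 != 0) (s0_gt0 : 0 < s0) (r_gt0 : 0 < r).
Implicit Types (x u : 'rV[R]_q.+2) (p z : 'rV[R]_q.+1) (h t : R).

(* In these coordinates the hyperplane of normal [tilt w z] at level [t] is
   the graph of [graph z t]. *)
Definition hgt x : R := dotp x w / (s0 * r).
Definition pos x : 'rV[R]_q.+1 := r^-1 *: base x.
Definition point h p : 'rV[R]_q.+2 :=
  lift1 ((s0 * r * h - dotp (r *: p) (base w)) / w 0 ord0) (r *: p).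
Definition graph z t p : R := t / (s0 * r) - dotp (s0^-1 *: z) p.

Let sr_gt0 : 0 < s0 * r. Proof. exact: mulr_gt0. Qed.

Lemma base_point h p : base (point h p) = r *: p.
Proof. exact: base_lift1. Qed.

Lemma pos_point h p : pos (point h p) = p.
Proof. by rewrite /pos base_point scalerA mulVf ?scale1r// gt_eqF. Qed.

Lemma dotp_point h p : dotp (point h p) w = s0 * r * h.
Proof. by rewrite dotp_lift1 divfK// subrK. Qed.

Lemma hgt_point h p : hgt (point h p) = h.
Proof. by rewrite /hgt dotp_point mulrAC mulfV ?mul1r// gt_eqF. Qed.

Lemma base_pos x : base x = r *: pos x.
Proof. by rewrite /pos scalerA mulfV ?scale1r// gt_eqF. Qed.

Lemma dotp_tilt_graph x z t :
  dotp x (tilt w z) - t = s0 * r * (hgt x - graph z t (pos x)).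
Proof.
rewrite dotp_tilt base_pos (dotpZl r) /graph (dotpZl s0^-1) [dotp z _]dotpC /hgt.
by field; rewrite !gt_eqF.
Qed.

Lemma tilt_graphP x z t :
  dotp x (tilt w z) = t <-> hgt x = graph z t (pos x).
Proof.
split => [|xE]; last first.
  by apply/eqP; rewrite -subr_eq0 dotp_tilt_graph xE subrr mulr0.
move=> /eqP; rewrite -subr_eq0 dotp_tilt_graph mulf_eq0 gt_eqF//= subr_eq0.
by move/eqP.
Qed.

Lemma point_continuous p : continuous (point ^~ p).
Proof.
have e0 : point ^~ p = fun h => point 0 p + h *: lift1 (s0 * r / w 0 ord0) 0.
  apply/funext => h; rewrite lift1Z lift1D scaler0 addr0 /point; congr lift1.
  by field.
by rewrite e0; exact: line_continuous.
Qed.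

Definition vseg p h h' : set 'rV[R]_q.+2 := point ^~ p @` `[h, h'].

Lemma vseg_compact p h h' : compact (vseg p h h').
Proof.
apply: continuous_compact; last exact: segment_compact.
by apply: continuous_subspaceT; exact: point_continuous.
Qed.

(** The first coordinate is recovered from [hgt] and [pos] through a division by [w 0 ord0]; this
    factor bounds all coordinates at once, in units of [r]. *)
Definition window : R := 1 + (s0 + \sum_k `|w 0 k|) / `|w 0 ord0|.

Lemma window_ge1 : 1 <= window.
Proof.
by rewrite lerDl divr_ge0// addr_ge0 ?(ltW s0_gt0)// sumr_ge0.
Qed.

Lemma coord_le_window x (C : R) k : 0 <= C -> `|hgt x| <= C -> norm1 (pos x) <= C ->
  `|x 0 k| <= r * (C * window).
Proof.
move=> C0 hC pC; case: (unliftP ord0 k) => [l ->|->].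
  have -> : x 0 (lift ord0 l) = r * pos x 0 l by rewrite !mxE mulVKf// gt_eqF.
  rewrite normrM (gtr0_norm r_gt0) ler_pM2l//.
  apply: le_trans (coord_le_norm1 _ _) _; apply: le_trans pC _.
  by rewrite ler_peMr// window_ge1.
have xE : x 0 ord0 * w 0 ord0 = r * (s0 * hgt x - dotp (base w) (pos x)).
  have : dotp x w = s0 * r * hgt x by rewrite /hgt mulrC divfK// gt_eqF.
  rewrite [x in dotp x w]lift1_base dotp_lift1 base_pos (dotpZl r) [dotp (pos x) _]dotpC.
  lra.
have wB k' : `|base w 0 k'| <= \sum_k `|w 0 k|.
  by rewrite mxE (bigD1 (lift ord0 k'))//= lerDl sumr_ge0.
have W0 : 0 <= \sum_k `|w 0 k| by exact: sumr_ge0.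
have d1 : `|dotp (base w) (pos x)| <= (\sum_k `|w 0 k|) * C.
  by apply: le_trans (dotp_le_norm1 _ wB) _; rewrite ler_wpM2l.
have -> : x 0 ord0 = (r * (s0 * hgt x - dotp (base w) (pos x))) / w 0 ord0.
  by rewrite -xE mulfK.
rewrite normrM normrM (gtr0_norm r_gt0) normfV -mulrA ler_pM2l//.
rewrite ler_pdivrMr ?normr_gt0// /window mulrDr mulr1 mulrDl.
rewrite -[X in _ <= _ + X]mulrA divfK ?normr_eq0//.
apply: le_trans (ler_normB _ _) _; rewrite normrM (gtr0_norm s0_gt0).
have : s0 * `|hgt x| <= s0 * C by rewrite ler_pM2l.
have : 0 <= C * `|w 0 ord0| by rewrite mulr_ge0.
lra.
Qed.

End graph_coordinates.

Section classes.
Variables (R : realType) (q m N : nat) (g : 'I_m -> 'I_q.+1 -> nat).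
Hypothesis N0 : (0 < N)%N.
Hypothesis gN : forall j k, (g j k < N)%N.
Hypothesis g_inj : forall i j, i != j -> exists k, g i k != g j k.
Variables (w : 'rV[R]_q.+2) (s0 r : R).
Hypotheses (w0 : w 0 ord0 != 0) (s0_gt0 : 0 < s0) (r_gt0 : 0 < r).
Implicit Types (x u : 'rV[R]_q.+2) (p z : 'rV[R]_q.+1) (i : facet_index q m).

Local Notation node_ := (@node R q m N g).
Local Notation mesh_ := (@mesh R q m N).
Local Notation ideal_ := (@ideal R q m N g).
Local Notation near_ideal_ := (@near_ideal R q m N g).
Local Notation slack_ := (@slack R q).

Definition frame i (o : option 'I_q.+1) : 'rV[R]_q.+1 :=
  if o is Some k then node_ i + mesh_ i *: delta_mx 0 k else node_ i.

Definition tol i : R := slack_ * mesh_ i ^+ 2.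

(* The hyperplanes meeting [q.+2] vertical segments, whose base points are
   affinely independent: they are graphs close to [ideal_ i]. *)
Definition hclass i : set (set 'rV[R]_q.+2) := [set H | hyperplane H /\
  forall o, H `&` vseg w s0 r (frame i o)
    (ideal_ i (frame i o) - tol i) (ideal_ i (frame i o) + tol i) !=set0].

(** A hyperplane is outside the class exactly if it misses one of the compact segments, and missing
    a compact set is a generator of the sigma-algebra. *)
Lemma hclass_borel i : borel_hyperplane (hclass i).
Proof.
pose C o := vseg w s0 r (frame i o) (ideal_ i (frame i o) - tol i) (ideal_ i (frame i o) + tol i).
pose hit (o : 'I_q.+2) : set (set 'rV[R]_q.+2) :=
  [set H | hyperplane H /\ H `&` C (unlift ord0 o) = set0].
rewrite (_ : hclass i = @hyperplane R q.+2 `\` \bigcup_(o in [set: 'I_q.+2]) hit o).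
  apply: sigma_algebraCD; apply: sigma_algebra_on_bigcupfin => o.
  by apply: sub_sigma_algebra; left; exists (C (unlift ord0 o)) => //; exact: vseg_compact.
apply/seteqP; split => [H [HH HC]|H [HH nH]]; split => //.
  by move=> [ o _ [_ HC0]]; have [x] := HC (unlift ord0 o); rewrite -/(C _) HC0.
move=> o; apply/set0P/eqP => HC0; apply: nH.
exists (if o is Some k then lift ord0 k else ord0) => //; split => //.
by case: o HC0 => [k|]; rewrite ?liftK ?unlift_none.
Qed.

Lemma hclass_graph i H : hclass i H -> exists z t,
  H = [set x | dotp x (tilt w z) = t] /\ near_ideal_ i (graph s0 r z t).
Proof.
move=> [[u [t [u1 HE]]] hits].
pose a := u 0 ord0 / w 0 ord0.
pose v : 'rV[R]_q.+1 := \row_k (u 0 (lift ord0 k) - a * w 0 (lift ord0 k)).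
have uE x : dotp x u = a * dotp x w + dotp (base x) v.
  rewrite [x in LHS]lift1_base [x in dotp x w]lift1_base !dotp_lift1 /v /a.
  have -> : base u = (\row_k (u 0 (lift ord0 k) - a * w 0 (lift ord0 k))) + a *: base w.
    by apply/rowP => k; rewrite !mxE subrK.
  rewrite dotpDr dotpZr mulrDr /a; field.
  exact: w0.
have hitP o : exists h, ideal_ i (frame i o) - tol i <= h <= ideal_ i (frame i o) + tol i /\
    a * (s0 * r * h) + r * dotp (frame i o) v = t.
  have [x [Hx [h hI xE]]] := hits o; exists h; split; first by move: hI; rewrite /= in_itv.
  by move: Hx; rewrite HE /hplane/= uE -xE dotp_point// base_point dotpZl.
(* For [a = 0] the hyperplane would be vertical and its trace in the base would contain the [q.+2]
   affinely independent points of the frame, which forces a zero normal. *)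
have a0 : a != 0.
  apply/negP => /eqP a0; have v0 : v = 0.
    apply/rowP => k; rewrite [RHS]mxE.
    have [h1 [_ e1]] := hitP None; have [h2 [_ e2]] := hitP (Some k).
    have : r * (mesh_ i * v 0 k) = 0.
      move: e1 e2; rewrite a0 !mul0r !add0r /frame dotpDl dotpZl dotp_deltal; lra.
    by move=> /eqP; rewrite !mulf_eq0 gt_eqF//= gt_eqF ?mesh_gt0//= => /eqP.
  have /eqP := enorm_sphere_neq0 u1; apply; apply: rowP1 => [|k].
    by rewrite mxE; move/eqP: a0; rewrite /a mulf_eq0 invr_eq0 (negbTE w0) orbF => /eqP.
  by move/rowP: v0 => /(_ k); rewrite !mxE a0 mul0r subr0.
exists (a^-1 *: v), (t / a); split.
  rewrite HE; apply/seteqP; split => x; rewrite /hplane/= uE dotp_tilt dotpZr.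
    by move=> <-; field.
  by move=> h; rewrite -[t](divfK a0) -h; field.
have fE o : `|graph s0 r (a^-1 *: v) (t / a) (frame i o) - ideal_ i (frame i o)| <= tol i.
  have [h [hI e]] := hitP o.
  have -> : graph s0 r (a^-1 *: v) (t / a) (frame i o) = h.
    rewrite /graph !dotpZl -e [dotp (frame i o) v]dotpC.
    by field; rewrite a0 !gt_eqF.
  by rewrite ler_distl.
by apply: near_ideal_affine => // [|k]; [exact: (fE None)|exact: (fE (Some k))].
Qed.

Lemma graph_hclass i z t : tilt w z != 0 ->
  (forall o, `|graph s0 r z t (frame i o) - ideal_ i (frame i o)| <= tol i) ->
  hclass i [set x | dotp x (tilt w z) = t].
Proof.
move=> tz0 near; split.
  have n0 : 0 < enorm (tilt w z) by rewrite enorm_gt0.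
  exists (unit_tilt w z), (t / enorm (tilt w z)); split.
    by rewrite /sphere/= enormZ gtr0_norm ?invr_gt0// mulVf// gt_eqF.
  apply/seteqP; split => x; rewrite /hplane/= dotpZr; first by move=> ->; rewrite mulrC.
  by move=> h; rewrite -[LHS](mulVKf (lt0r_neq0 n0)) h mulrC divfK// gt_eqF.
move=> o; exists (point w s0 r (graph s0 r z t (frame i o)) (frame i o)); split.
  by apply/(tilt_graphP w s0_gt0 r_gt0); rewrite hgt_point// pos_point.
by exists (graph s0 r z t (frame i o)); rewrite //= in_itv/= -ler_distl.
Qed.

Lemma hclass_inj i j H : hclass i H -> hclass j H -> i = j.
Proof.
move=> /hclass_graph[z [t [HE ni]]] /hclass_graph[z' [t' [HE' nj]]].
apply: (near_ideal_inj N0 gN g_inj ni); suff -> : graph s0 r z t = graph s0 r z' t' by [].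
apply/funext => p; pose x := point w s0 r (graph s0 r z t p) p.
have : H x.
  by rewrite HE; apply/(tilt_graphP w s0_gt0 r_gt0); rewrite hgt_point// pos_point.
by rewrite HE' => /(tilt_graphP w s0_gt0 r_gt0); rewrite hgt_point// pos_point.
Qed.

Lemma ideal_frame i p : norm1 p <= q.+1%:R + 1 -> `|ideal_ i p| <= height R q + q.+1%:R + 2.
Proof.
move=> pq; have c0 := @curv_gt0 R q; have hq : (1 : R) <= q.+1%:R by rewrite ler1n.
have cQ : curv R q * (2 * q.+1%:R + 1) = 8^-1.
  by rewrite /curv invfM -mulrA mulVf ?mulr1// lt0r_neq0//; lra.
have p0 := norm1_ge0 p.
case: i => [l|j].
  have sp : `|\sum_k p 0 k| <= norm1 p by exact: ler_norm_sum.
  rewrite ler_norml in sp; rewrite /height.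
  case: l => [k|]; rewrite ?ideal_None ?ideal_Some ler_norml; last lra.
  by have := coord_le_norm1 p k; rewrite ler_norml; lra.
have := ideal_upper_bounds N0 gN j p; rewrite ler_norml /height.
have : curv R q * norm1 p <= curv R q * (q.+1%:R + 1) by rewrite ler_pM2l.
have : 0 <= curv R q * norm1 p by rewrite mulr_ge0// ltW.
have : curv R q <= curv R q * q.+1%:R by rewrite ler_peMr// ltW.
lra.
Qed.

Lemma tol_bounds i : 0 < tol i <= 1.
Proof.
have a0 := @slack_gt0 R q; have m0 := mesh_gt0 R N0 i; have m1 := mesh_le1 R N0 i.
rewrite /tol mulr_gt0 ?exprn_gt0//=.
have hq : (1 : R) <= q.+1%:R by rewrite ler1n.
have cQ : curv R q * (2 * q.+1%:R + 1) = 8^-1.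
  by rewrite /curv invfM -mulrA mulVf ?mulr1// lt0r_neq0//; lra.
have a1 : slack_ <= 1.
  have : curv R q <= curv R q * (2 * q.+1%:R + 1).
    by rewrite ler_peMr ?(ltW (@curv_gt0 R q))//; lra.
  by rewrite cQ /slack; lra.
by apply: mulr_ile1 => //; [exact: ltW|rewrite exprn_ge0// ltW|rewrite exprn_ile1// ltW].
Qed.

(** The segment over the node lies in the ball already. *)
Lemma hclass_window i H : hclass i H ->
  H `&` ball (0 : 'rV[R]_q.+2) (r * ((height R q + q.+1%:R + 3) * window w s0 + 1)) !=set0.
Proof.
move=> [_ /(_ None)[x [Hx [h hI xE]]]]; exists x; split => //.
have hh : 0 <= height R q + q.+1%:R + 3 by rewrite /height; have : (0 : R) <= q.+1%:R by []; lra.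
have nn : norm1 (node_ i) <= q.+1%:R := norm1_node R N0 gN i.
have /andP[t0 t1] := tol_bounds i.
have hb : `|hgt w s0 r x| <= height R q + q.+1%:R + 3.
  rewrite -xE hgt_point//; move: hI; rewrite /= in_itv/=.
  have : `|ideal_ i (frame i None)| <= height R q + q.+1%:R + 2.
    by apply: ideal_frame; apply: le_trans nn _; rewrite lerDl.
  rewrite !ler_norml; lra.
have pb : norm1 (pos r x) <= height R q + q.+1%:R + 3.
  rewrite -xE pos_point//= /height; have : (0 : R) <= q.+1%:R by [].
  by move: nn; lra.
apply: ball_coord => [|k].
  by rewrite mulr_gt0// ltr_wpDl// mulr_ge0// (le_trans ler01) ?window_ge1.
rewrite mxE sub0r normrN; apply: le_lt_trans (coord_le_window w0 s0_gt0 r_gt0 k hh hb pb) _.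
by rewrite ltr_pM2l// ltrDl.
Qed.

End classes.

Section class_measure.
Variables (R : realType) (q m N : nat) (g : 'I_m -> 'I_q.+1 -> nat).
Hypothesis N0 : (0 < N)%N.
Hypothesis gN : forall j k, (g j k < N)%N.
Variables (w : 'rV[R]_q.+2) (s0 r : R).
Hypotheses (w0 : w 0 ord0 != 0) (s0_gt0 : 0 < s0) (r_gt0 : 0 < r).
Implicit Types (x u : 'rV[R]_q.+2) (p z : 'rV[R]_q.+1) (i : facet_index q m).

Local Notation node_ := (@node R q m N g).
Local Notation mesh_ := (@mesh R q m N).
Local Notation ideal_ := (@ideal R q m N g).
Local Notation slope_ := (@slope R q m N g).
Local Notation slack_ := (@slack R q).

Let hq : (1 : R) <= q.+1%:R. Proof. by rewrite ler1n. Qed.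

Let cQ : curv R q * (2 * q.+1%:R + 1) = 8^-1.
Proof. by rewrite /curv invfM -mulrA mulVf ?mulr1// lt0r_neq0//; have := hq; lra. Qed.

Lemma slope_le1 i k : `|slope_ i 0 k| <= 1.
Proof.
case: i => [[k'|]|j] /=; rewrite !mxE.
- by case: (_ && _); rewrite ?normr1 ?normr0.
- by rewrite normrN normr1.
have := node01 R N0 gN (inr j) k; rewrite /node/= mxE => /andP[h1 h2].
have c0 := @curv_gt0 R q.
have c1 : 2 * curv R q <= 1.
  have : curv R q <= curv R q * (2 * q.+1%:R + 1) by rewrite ler_peMr ?(ltW c0)//; have := hq; lra.
  by rewrite cQ; lra.
rewrite ger0_norm; last by rewrite mulr_ge0// mulr_ge0// ltW.
by rewrite mulr_ile1// mulr_ge0// ltW.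
Qed.

(** Up to the units [s0] and [s0 * r], slopes range over a cube of side [slack * mesh] and levels
    over an interval of length [slack * mesh^2]. At a frame point the level uses up half of the
    tolerance, and the slope, acting over the distance [mesh], the other half. *)
Lemma hclass_measure_ge (phi : probability (borelRV R q.+2) R) (a1 : R) i :
  (forall (c : 'rV[R]_q.+1) (l dl : R) (s : 'rV[R]_q.+1 -> R) (B : set (set 'rV[R]_q.+2)),
       0 <= l -> 0 <= dl ->
       (forall k, - (2 * s0) <= c 0 k /\ c 0 k + l <= 2 * s0) ->
       (forall z, cube c l z -> 0 < s z) ->
       (forall z s', cube c l z -> s z <= s' <= s z + dl ->
          B [set x | dotp x (tilt w z) = s']) ->
       ((a1 * l ^+ q.+1 * dl)%:E <= hyperplane_measure phi B)%E) ->
  ((a1 * (s0 * slack_ * mesh_ i) ^+ q.+1 * (s0 * r * (slack_ * mesh_ i ^+ 2)))%:E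
    <= hyperplane_measure phi (hclass N g w s0 r i))%E.
Proof.
move=> ge; have a0 : 0 < slack_ := @slack_gt0 R q.
have m0 : 0 < mesh_ i := mesh_gt0 R N0 i; have m1 : mesh_ i <= 1 := mesh_le1 R N0 i.
have /andP[t0 t1] := tol_bounds R N0 i; set T := tol R N i in t0 t1.
have TE : slack_ * mesh_ i ^+ 2 = T by [].
have sl0 : slack_ * mesh_ i <= slack_ by rewrite ler_piMr// ltW.
have slq : slack_ * q.+1%:R <= 128^-1.
  rewrite /slack; have c0 := @curv_gt0 R q.
  have : curv R q * (2 * q.+1%:R + 1) = 8^-1 := cQ.
  have : 0 <= curv R q * q.+1%:R by rewrite mulr_ge0// ltW.
  lra.
have sl1 : slack_ <= 128^-1.
  by apply: le_trans slq; rewrite ler_peMr// ltW.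
pose D : R := s0 * slack_ * mesh_ i.
have D0 : 0 < D by apply: mulr_gt0 => //; exact: mulr_gt0.
have Ds : D <= s0 / 128.
  by rewrite /D -mulrA ler_pM2l//; apply: le_trans sl0 sl1.
pose c : 'rV[R]_q.+1 := \row_k (s0 * slope_ i 0 k - D / 2).
(* Levels are measured from the graph through the ideal point over the node, so a change of slope
   turns the graph about that point, however far it is from the origin. *)
pose s z := s0 * r * (ideal_ i (node_ i) + dotp (s0^-1 *: z) (node_ i) - T / 2).
have cubeP z : cube c D z -> forall k, `|slope_ i 0 k - s0^-1 * z 0 k| <= slack_ * mesh_ i / 2.
  move=> zc k; have := zc k; rewrite mxE => h.
  rewrite -(ler_pM2l s0_gt0) -[X in X * `|_|](gtr0_norm s0_gt0) -normrM.
  rewrite mulrBr mulVKf ?gt_eqF// ler_norml /D in h *; rewrite /D in h; lra.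
rewrite TE; apply: (ge c D (s0 * r * T) s).
- exact: ltW.
- by apply: mulr_ge0; apply: ltW => //; exact: mulr_gt0.
- move=> k; rewrite mxE; have := slope_le1 i k; rewrite ler_norml => /andP[h1 h2].
  have h3 : s0 * - 1 <= s0 * slope_ i 0 k by rewrite ler_pM2l.
  have h4 : s0 * slope_ i 0 k <= s0 * 1 by rewrite ler_pM2l.
  split; lra.
- move=> z zc; rewrite /s; apply: mulr_gt0; first exact: mulr_gt0.
  (* The level is positive because the value over the origin differs from [offset], which is at
     least 1, by at most 1/4, and [T / 2] is at most 1/2. *)
  have offE : ideal_ i (node_ i) + dotp (s0^-1 *: z) (node_ i) =
      offset R N g i - dotp (slope_ i - s0^-1 *: z) (node_ i).
    by rewrite /ideal dotpBl; ring.
  have dB : `|dotp (slope_ i - s0^-1 *: z) (node_ i)| <= slack_ * mesh_ i / 2 * norm1 (node_ i).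
    by apply: dotp_le_norm1 => k; rewrite !mxE; exact: cubeP.
  have nq : norm1 (node_ i) <= q.+1%:R := norm1_node R N0 gN i.
  have h : slack_ * mesh_ i / 2 * norm1 (node_ i) <= 1 / 4.
    apply: (@le_trans _ _ (slack_ / 2 * q.+1%:R)); last by lra.
    by apply: ler_pM => //; [rewrite divr_ge0// mulr_ge0// ltW|exact: norm1_ge0|rewrite ler_pM2r//].
  have o1 : 1 <= offset R N g i.
    case: (i) => [l|j] //=; rewrite /height.
    have : 0 <= curv R q * dotp (node R N g (inr j)) (node R N g (inr j)).
      by rewrite mulr_ge0 ?dotp_ge0// ltW// curv_gt0.
    by move=> /=; have := hq; lra.
  rewrite ler_norml in dB; rewrite offE; lra.
move=> z s' zc s'I; apply: graph_hclass => //.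
  by apply: contraNneq w0 => /rowP/(_ ord0); rewrite tilt_ord0 mxE => ->.
move=> o; have sr0 : 0 < s0 * r by rewrite mulr_gt0.
pose th := s' / (s0 * r) - (ideal_ i (node_ i) + dotp (s0^-1 *: z) (node_ i)).
have thT : `|th| <= T / 2.
  have h1 : ideal_ i (node_ i) + dotp (s0^-1 *: z) (node_ i) - T / 2 <= s' / (s0 * r).
    by rewrite ler_pdivlMr// mulrC; case/andP: s'I.
  have h2 : s' / (s0 * r) <= ideal_ i (node_ i) + dotp (s0^-1 *: z) (node_ i) + T / 2.
    rewrite ler_pdivrMr// mulrC; case/andP: s'I => _; rewrite /s => /le_trans; apply.
    by rewrite le_eqVlt; apply/orP; left; apply/eqP; field.
  by rewrite /th ler_norml; lra.
have gE p : graph s0 r z s' p - ideal_ i p = th + dotp (slope_ i - s0^-1 *: z) (p - node_ i).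
  rewrite /graph /th /ideal dotpBl !dotpBr; ring.
rewrite gE; case: o => [k|] /=; last first.
  by rewrite subrr dotp0r addr0; apply: le_trans thT _; rewrite ler_pdivrMr// ler_pMr// ler1n.
have -> : node_ i + mesh_ i *: delta_mx 0 k - node_ i = mesh_ i *: delta_mx 0 k.
  by rewrite addrAC subrr add0r.
rewrite dotpZr [dotp _ (delta_mx 0 k)]dotpC dotp_deltal !mxE.
apply: le_trans (ler_normD _ _) _; rewrite -/T.
have h := cubeP z zc k.
have : `|mesh_ i * (slope_ i 0 k - s0^-1 * z 0 k)| <= T / 2.
  rewrite normrM gtr0_norm//; apply: (@le_trans _ _ (mesh_ i * (slack_ * mesh_ i / 2))).
    by rewrite ler_pM2l.
  by rewrite /T /tol le_eqVlt; apply/orP; left; apply/eqP; ring.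
by have := thT; lra.
Qed.

End class_measure.

Section polytope_of_graphs.
Variables (R : realType) (q m N : nat) (g : 'I_m -> 'I_q.+1 -> nat).
Hypothesis N0 : (0 < N)%N.
Hypothesis gN : forall j k, (g j k < N)%N.
Hypothesis g_inj : forall i j, i != j -> exists k, g i k != g j k.
Variables (w : 'rV[R]_q.+2) (s0 r : R).
Hypotheses (w0 : w 0 ord0 != 0) (s0_gt0 : 0 < s0) (r_gt0 : 0 < r).
Implicit Types (x u : 'rV[R]_q.+2) (p : 'rV[R]_q.+1) (i : facet_index q m).
Variables (z : facet_index q m -> 'rV[R]_q.+1) (t : facet_index q m -> R).
Hypothesis near_zt : forall i, near_ideal N g i (graph s0 r (z i) (t i)).
Variable j0 : 'I_m.

Let f i := graph s0 r (z i) (t i).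
(** The cone faces bound the polytope from below, so their inequalities are reversed; the
    hyperplanes are the same for either sign. *)
Let sg i : R := if i is inl _ then -1 else 1.
Let n := #|{: facet_index q m}|.
Let a (i : 'I_n) := sg (enum_val i) *: tilt w (z (enum_val i)).
Let b (i : 'I_n) := sg (enum_val i) * t (enum_val i).
Let K : set 'rV[R]_q.+2 := [set x | forall i : 'I_n, dotp x (a i) <= b i].

Let sr0 : 0 < s0 * r. Proof. by rewrite mulr_gt0. Qed.

Let sideE x (i : 'I_n) : dotp x (a i) - b i =
  s0 * r * (sg (enum_val i) * (hgt w s0 r x - f (enum_val i) (pos r x))).
Proof. by rewrite dotpZr -mulrBr (dotp_tilt_graph w s0_gt0 r_gt0) mulrCA. Qed.

Let side_le x (i : 'I_n) : (dotp x (a i) <= b i) =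
  (sg (enum_val i) * (hgt w s0 r x - f (enum_val i) (pos r x)) <= 0).
Proof. by rewrite -subr_le0 sideE pmulr_rle0. Qed.

Let side_lt x (i : 'I_n) : (dotp x (a i) < b i) =
  (sg (enum_val i) * (hgt w s0 r x - f (enum_val i) (pos r x)) < 0).
Proof. by rewrite -subr_lt0 sideE pmulr_rlt0. Qed.

Let interior (i : 'I_n) : dotp (point w s0 r 2 0) (a i) < b i.
Proof.
rewrite side_lt hgt_point// pos_point//.
have [lo up] := near_inner_point N0 gN near_zt.
case: (enum_val i) => [l|j] /=; last by have := up j; rewrite -/(f _) mul1r; lra.
by have := lo l; rewrite -/(f _) mulN1r; lra.
Qed.

Let irredundant (i : 'I_n) : exists x,
  b i < dotp x (a i) /\ forall j, j != i -> dotp x (a j) <= b j.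
Proof.
suff [h [p [h1 h2]]] : exists h p, 0 < sg (enum_val i) * (h - f (enum_val i) p) /\
    forall j, j != enum_val i -> sg j * (h - f j p) <= 0.
  exists (point w s0 r h p); split.
    by rewrite ltNge side_le hgt_point// pos_point// -ltNge.
  move=> j ji; rewrite side_le hgt_point// pos_point//; apply: h2.
  by rewrite (inj_eq enum_val_inj).
case: (enum_val i) => [l|j].
  have [h [p [h1 h2 h3]]] := near_lower_irredundant N0 gN near_zt l.
  exists h, p; split; first by rewrite /= /f; lra.
  move=> [l'|j'] ne /=; last by have := h3 j'; rewrite /f; lra.
  have : f (inl l') p <= h by apply: h2; apply: contraNneq ne => ->.
  lra.
have [h [p [h1 h2 h3]]] := near_upper_irredundant N0 gN g_inj near_zt j.
exists h, p; split; first by rewrite /= /f; lra.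
move=> [l'|j'] ne /=; first by have := h3 l'; rewrite /f; lra.
have : h <= f (inr j') p by apply: h2; apply: contraNneq ne => ->.
lra.
Qed.

Let bound x : K x -> forall k, `|x 0 k| <= r * (size_bound R q * window w s0).
Proof.
move=> Kx k; have Kf i : sg i * (hgt w s0 r x - f i (pos r x)) <= 0.
  by rewrite -(enum_rankK i) -side_le; exact: Kx.
have [||h1 h2] := near_bounded N0 gN near_zt (h := hgt w s0 r x) (p := pos r x) j0.
- by move=> l; have := Kf (inl l); rewrite /= mulN1r /f; lra.
- by move=> j; have := Kf (inr j); rewrite /= mul1r /f; lra.
by apply: coord_le_window => //; apply: le_trans h1.
Qed.

(** Nearness alone gives the polytope; the absence of other hyperplanes in the ball makes it a cell.
    All translates are treated because the center may be any point of it. *)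
Lemma cell_of_graphs (E : set (set 'rV[R]_q.+2)) (M : R) :
  r * (size_bound R q * window w s0) < M ->
  (forall i, E [set x | dotp x (tilt w (z i)) = t i]) ->
  (forall H, E H -> H `&` ball 0 M !=set0 ->
     exists i, H = [set x | dotp x (tilt w (z i)) = t i]) ->
  exists K', [/\ cells E K', convex_body K', K' `<=` ball 0 M &
    forall v, let L := [set x - v | x in K'] in
      [/\ convex_body L, polytope L & nfacets L = n%:R%:E]].
Proof.
move=> M_gt EH hitE.
have hplaneE (i : 'I_n) : hplane (a i) (b i) =
    [set x | dotp x (tilt w (z (enum_val i))) = t (enum_val i)].
  apply/seteqP; split => x; rewrite /hplane/= dotpZr; last by move=> ->.
  apply: mulfI; rewrite /sg; case: (enum_val i) => _; rewrite ?oppr_eq0; exact: oner_neq0.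
have KM : K `<=` ball 0 M.
  move=> x Kx; have M0 : 0 < M.
    by apply: le_lt_trans M_gt; apply: le_trans (bound Kx ord0).
  apply: ball_coord => // k; rewrite mxE sub0r normrN.
  exact: le_lt_trans (bound Kx k) M_gt.
have Kbounded : exists C, forall x k, K x -> `|x 0 k| <= C.
  by exists (r * (size_bound R q * window w s0)) => x k Kx; exact: bound.
exists K; split => //.
- apply: (cells_halfspaces interior KM) => [i|H EHH HM]; first by rewrite hplaneE.
  have [i ->] := hitE H EHH HM; exists (enum_rank i).
  by rewrite hplaneE enum_rankK.
- by have [] := halfspaces_body interior irredundant Kbounded.
- by move=> v; exact: (@halfspaces_shift_body _ _ _ _ _ _ v interior irredundant Kbounded).
Qed.

End polytope_of_graphs.

(** * The typical cell *)

Section tessellation.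
Local Open Scope ereal_scope.

Lemma counting_eq1 (R : realType) (T : choiceType) (A : set T) :
  counting A = 1 :> \bar R -> exists x, A = [set x].
Proof.
move=> A1'; have A1 : (A #= `I_1)%card by apply/(@counting_finite R).
have fA : finite_set A by exists 1%N.
have /eqP/cardfs1P[x xE] := card_fset_set A1.
by exists x; rewrite -(fset_setK fA) xE; apply/seteqP; split => y /=; rewrite inE => /eqP.
Qed.

Lemma counting_ge1 (R : realType) (T : choiceType) (A : set T) x :
  A x -> 1 <= counting A :> \bar R.
Proof.
move=> Ax; rewrite /counting; case: asboolP => fA; last exact: leey.
rewrite lee_fin ler1n cardfs_gt0; apply/fset0Pn; exists x.
by rewrite in_fset_set// mem_set.
Qed.

Definition hitting (R : realType) d (M : R) : set (set 'rV[R]_d) :=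
  [set H | hyperplane H /\ H `&` ball 0%R M !=set0].

Lemma hitting_borel (R : realType) d (M : R) : borel_hyperplane (@hitting R d M).
Proof.
apply: sub_sigma_algebra; right; exists (ball 0%R M) => //.
exact: ball_open.
Qed.

(** A hyperplane with unit normal that meets the ball, taken in the maximum norm, has level at most
    [d%:R * M]. *)
Lemma hyperplane_measure_hitting_le (R : realType) d
    (phi : probability (borelRV R d) R) (M : R) : (0 <= M)%R ->
  hyperplane_measure phi (hitting M) <= (d%:R * M)%:E.
Proof.
move=> M0; have dM0 : (0 <= d%:R * M)%R by rewrite mulr_ge0.
apply: (@le_trans _ _ ((d%:R * M)%:E * phi (setT `&` @sphere R d))); last first.
  rewrite -[leRHS]mule1; apply: lee_wpmul2l; first by rewrite lee_fin.
  by apply: probability_le1; rewrite setTI; exact: sphere_measurable.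
apply: integral_le_on => //; [exact: sphere_measurable| | |by move=> u _ []].
  by move=> u _; apply: integral_ge0 => t _; rewrite lee_fin.
move=> u u1; pose I := `[0%R, (d%:R * M)%R]%classic.
apply: (@le_trans _ _ (1%:E * lebesgue_measure (I `&` `]0%R, +oo[%classic))).
  apply: integral_le_on => //; first exact: measurable_itv.
    by move=> t _; rewrite lee_fin indicE lern1 leq_b1.
  move=> t /=; rewrite in_itv/= andbT => t0 nI; rewrite indicE memNset// => -[_ [x [xt xM]]].
  apply: nI; rewrite /I/= in_itv/= (ltW t0)/= -xt.
  apply: le_trans (ler_norm _) _; apply: le_trans (norm_dotp_le _ _) _.
  rewrite u1 mulr1; apply: (@le_trans _ _ (\sum_(k < d) M)%R).
    by apply: ler_sum => k _; have := coord_ball k xM; rewrite mxE sub0r normrN => /ltW.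
  by rewrite sumr_const card_ord mulr_natl.
rewrite mul1e; apply: (@le_trans _ _ (lebesgue_measure I)).
  apply: le_measure; last exact: subIsetl.
    by apply: mem_set; apply: measurableI; exact: measurable_itv.
  by apply: mem_set; exact: measurable_itv.
rewrite lebesgue_measure_itv/= lte_fin; case: ifP => _; first by rewrite -EFinB subr0.
by rewrite lee_fin.
Qed.

(** One factor [expR (- (gamma * (q.+2%:R * M)))] pays for the absence of further hyperplanes in the
    window, the other for dividing by the mean number of cells with center there. *)
Lemma prob_facets_ge (R : realType) (q m N : nat) (g : 'I_m -> 'I_q.+1 -> nat)
    (phi : probability (borelRV R q.+2) R) (gamma : R)
    (dO : measure_display) (Omega : measurableType dO)
    (P : probability Omega R) (eta : Omega -> set (set 'rV[R]_q.+2))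
    (center : set 'rV[R]_q.+2 -> 'rV[R]_q.+2)
    (dZ : measure_display) (OmegaZ : measurableType dZ)
    (PZ : probability OmegaZ R) (Z : OmegaZ -> set 'rV[R]_q.+2)
    (w : 'rV[R]_q.+2) (s0 r M mu : R) :
  (0 < gamma)%R -> poisson_hyperplane_process phi gamma P eta ->
  center_function center -> typical_cell P eta center PZ Z ->
  (0 < N)%N -> (forall j k, (g j k < N)%N) ->
  (forall i j, i != j -> exists k, g i k != g j k) -> (0 < m)%N ->
  (w 0 ord0 != 0)%R -> (0 < s0)%R -> (0 < r)%R ->
  M = (r * (size_bound R q * window w s0 + 1))%R -> (0 <= mu)%R ->
  (forall i : facet_index q m, mu%:E <= hyperplane_measure phi (hclass N g w s0 r i)) ->
  (expR (- (2 * (gamma * (q.+2%:R * M)))) * (gamma * mu) ^+ #|{: facet_index q m}|)%:E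
    <= PZ [set v | nfacets (Z v) = #|{: facet_index q m}|%:R%:E].
Proof.
move=> gamma0 etaP centerP ZP N0 gN g_inj m0 w0 s00 r0 ME mu0 mu_le.
set n := #|{: facet_index q m}|.
have W1 : (1 <= window w s0)%R by exact: window_ge1.
have c0 := @curv_gt0 R q.
have sb : (height R q + q.+1%:R + 3 <= size_bound R q)%R.
  rewrite /size_bound; have : (0 <= (height R q + 1) / curv R q)%R.
    by rewrite divr_ge0 ?(ltW c0)// /height; have : (0 <= q.+1%:R :> R)%R by []; lra.
  by rewrite /height; have : (0 <= q.+1%:R :> R)%R by []; lra.
have sb0 : (0 <= size_bound R q)%R.
  by apply: le_trans sb; rewrite /height; have : (0 <= q.+1%:R :> R)%R by []; lra.
have M0 : (0 < M)%R.
  by rewrite ME mulr_gt0// ltr_wpDl// mulr_ge0// (le_trans ler01).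
pose W := @hitting R q.+2 M.
pose B (i : 'I_n) := hclass N g w s0 r (enum_val i).
have bW : borel_hyperplane W by exact: hitting_borel.
have bB i : borel_hyperplane (B i) by exact: hclass_borel.
have BW i : B i `<=` W.
  move=> H HB; split; first by case: HB.
  have [x [Hx xb]] := hclass_window N0 gN w0 s00 r0 HB; exists x; split => //.
  apply: le_ball xb; rewrite ME ler_pM2l// lerD2r ler_wpM2r// (le_trans ler01)//.
have tB : trivIset [set: 'I_n] B.
  apply/trivIsetP => i j _ _ ij; apply/seteqP; split => // H [Hi Hj].
  have := hclass_inj N0 gN g_inj w0 s00 r0 Hi Hj => /enum_val_inj ijE.
  by rewrite ijE eqxx in ij.
have hW : hyperplane_measure phi W <= (q.+2%:R * M)%:E.
  by apply: hyperplane_measure_hitting_le; exact: ltW.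
have gW : gamma%:E * hyperplane_measure phi W <= (gamma * (q.+2%:R * M))%:E.
  by rewrite EFinM; apply: lee_wpmul2l => //; rewrite lee_fin ltW.
have fW : gamma%:E * hyperplane_measure phi W < +oo by apply: le_lt_trans gW _; exact: ltry.
pose mean A := fine (gamma%:E * hyperplane_measure phi A).
have gW0 A : 0 <= gamma%:E * hyperplane_measure phi A.
  by rewrite mule_ge0 ?hyperplane_measure_ge0// lee_fin ltW.
have meanW : (mean W <= gamma * (q.+2%:R * M))%R.
  by rewrite -lee_fin /mean fineK// (ge0_fin_numE (gW0 W)).
have meanB i : (gamma * mu <= mean (B i))%R.
  rewrite -lee_fin /mean fineK; last first.
    rewrite (ge0_fin_numE (gW0 (B i))).
    by apply: (le_lt_trans _ fW); apply: lee_wpmul2l (le_hyperplane_measure _ (BW i)); rewrite lee_fin ltW.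
  by rewrite EFinM; apply: lee_wpmul2l; [rewrite lee_fin ltW|exact: mu_le].
have [mE PE] := prob_one_each etaP gamma0 bW bB BW tB fW.
set Ev := [set v | _ /\ _] in mE PE.
(* The law of the typical cell is applied twice with the same ball: to [Call], whose preimage under
   [Z] is everything, to identify [V], and to [Cn]. *)
pose Call : set (set 'rV[R]_q.+2) :=
  [set K | convex_body K /\ polytope K] `&` (@convex_body R q.+2 `&` center @^-1` [set 0%R]).
pose Cn : set (set 'rV[R]_q.+2) :=
  [set K | [/\ convex_body K, polytope K & nfacets K = n%:R%:E]] `&`
  (@convex_body R q.+2 `&` center @^-1` [set 0%R]).
have bc0 : borel_body (@convex_body R q.+2 `&` center @^-1` [set 0%R]).
  apply: (cf_measurable centerP); apply: closed_borelRV.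
  exact: (@accessible_closed_set1 _ (hausdorff_accessible (@norm_hausdorff _ _))).
have bCall : borel_body Call.
  apply: sigma_algebra_onI => //; first by move=> K [].
  exact: borel_body_polytope.
have bCn : borel_body Cn.
  apply: sigma_algebra_onI => //; first by move=> K [].
  exact: borel_body_nfacets.
have mball : measurable (ball (0%R : 'rV[R]_q.+2) M : set (borelRV R q.+2)).
  by apply: open_borelRV; exact: ball_open.
have law C : borel_body C -> C `<=` [set K | polytope K /\ center K = 0%R] ->
    \int[P]_v counting [set K | [/\ cells (eta v) K,
      C [set (x - center K)%R | x in K] & (ball (0%R : 'rV[R]_q.+2) M : set _) (center K)]] =
    cell_intensity P eta center * lebesgueRV (ball (0%R : 'rV[R]_q.+2) M) * PZ (Z @^-1` C).
  by move=> bC CP; exact: (tc_law ZP mball bC CP).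
set V := cell_intensity P eta center * _ in law.
have VZ : V <= (expR (mean W))%:E.
  have := law Call bCall _; have -> : Z @^-1` Call = setT.
    apply/seteqP; split => // v _; have [h1 h2 h3] := tc_polytope ZP v.
    by split; split.
  rewrite probability_setT mule1 => <- => [|K [[_ Kp] [_ K0]]//].
  apply: (integral_count_le etaP gamma0 bW fW) => [v|v k vk]; first exact: counting_ge0.
  apply: (@count_cells_le _ _ (eta v) (ball 0%R M) k) => //.
  - exact: (php_hyperplane etaP).
  - exact: ball_open.
  - move=> x y t /andP[t0 t1] xM yM; have t1' : (0 <= 1 - t)%R by rewrite subr_ge0.
    apply: ball_coord => // l.
    have := coord_ball l xM; have := coord_ball l yM; rewrite !mxE !sub0r !normrN => yl xl.
    apply: le_lt_trans (ler_normD _ _) _; rewrite !normrM (ger0_norm t0) (ger0_norm t1').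
    by apply: convex_comb_lt => //; rewrite t0.
  - rewrite -vk; congr counting; apply/seteqP; split => H [EH] //; last by move=> [_ HM].
    by move=> HM; split => //; split => //; exact: (php_hyperplane etaP EH).
  - move=> K [cK [[Kb _] _] KM]; split => //; exists (center K); split => //.
    have Kbody : convex_body K.
      have := convex_body_shift (center K) Kb; congr convex_body.
      apply/seteqP; split => [_ [_ [x Kx <-] <-]|x Kx]; first by rewrite subrK.
      by exists (x - center K)%R; rewrite ?subrK//; exists x.
    exact: (cf_in centerP Kbody).
(* On [Ev] at least one cell with [n] facets has its center in the ball. *)
have PEV : P Ev <= V * PZ (Z @^-1` Cn).
  rewrite -(law Cn bCn) => [|K [[_ Kp _] [_ K0]]//].
  rewrite -[leLHS]mul1e; apply: integral_ge_on => //; first by move=> v _; exact: counting_ge0.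
  move=> v [one none].
  have Hex (i : facet_index q m) : exists zt : 'rV[R]_q.+1 * R,
      [/\ eta v `&` hclass N g w s0 r i = [set [set x | dotp x (tilt w zt.1) = zt.2]]
        & near_ideal N g i (graph s0 r zt.1 zt.2)].
    have := one (enum_rank i); rewrite /B enum_rankK => /counting_eq1[H HE].
    have : (eta v `&` hclass N g w s0 r i) H by rewrite HE.
    move=> [_ /(hclass_graph N0 w0 s00 r0)[z [t [HE' nzt]]]].
    by exists (z, t); split => //; rewrite HE HE'.
  have [zt ztP] := choice Hex.
  have nzt i : near_ideal N g i (graph s0 r (zt i).1 (zt i).2) by have [] := ztP i.
  have := @cell_of_graphs R q m N g N0 gN g_inj w s0 r w0 s00 r0 (fun i => (zt i).1)
    (fun i => (zt i).2) nzt (Ordinal m0) (eta v) M.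
  case.
  - by rewrite ME ltr_pM2l// ltrDl.
  - move=> i; have [ztE _] := ztP i.
    have : [set [set x | dotp x (tilt w (zt i).1) = (zt i).2]]
        [set x | dotp x (tilt w (zt i).1) = (zt i).2] by [].
    by rewrite -ztE => -[].
  - move=> H EH HM; have WH : W H by split => //; exact: (php_hyperplane etaP EH).
    have [[i _ Bi]|nB] := pselect ((\bigcup_(i in [set: 'I_n]) B i) H).
      exists (enum_val i); have [ztE _] := ztP (enum_val i).
      have : (eta v `&` hclass N g w s0 r (enum_val i)) H by split.
      by rewrite ztE.
    have /counting_finite := none : counting _ = 0%:R%:E.
    rewrite II0 card_eq0 => /eqP E0.
    by have : set0 H by rewrite -E0; split.
  move=> K [cK Kb KM Kshift]; apply: (@counting_ge1 _ _ _ K); split => //.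
  - have [Lb Lp Ln] := Kshift (center K); split; split => //.
    have /(_ K 1%R (- center K)%R Kb ltr01) := cf_affine centerP.
    rewrite scale1r subrr => <-; rewrite /preimage/=; congr center.
    by apply/seteqP; split => [_ [x Kx <-]|_ [x Kx <-]]; exists x; rewrite ?scale1r.
  - by apply: KM; exact: (cf_in centerP Kb).
have CnE : Z @^-1` Cn = [set v | nfacets (Z v) = n%:R%:E].
  apply/seteqP; split => v /=; first by case => -[].
  by have [h1 h2 h3] := tc_polytope ZP v; move=> h; split; split => //; exact: h.
rewrite -CnE; set pz := PZ (Z @^-1` Cn).
have pz0 : 0 <= pz by exact: measure_ge0.
have pzf : pz \is a fin_num by apply: fin_num_measure; apply: (tc_measurable ZP).
have : P Ev <= (expR (mean W))%:E * pz.
  by apply: le_trans PEV _; apply: lee_wpmul2r.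
rewrite PE -[pz](fineK pzf) -EFinM !lee_fin => h.
have h2 : (expR (- mean W) * (expR (- mean W) * \prod_(i < n) mean (B i)) <= fine pz)%R.
  by rewrite {1}expRN mulrC ler_pdivrMr ?expR_gt0// [leRHS]mulrC; exact: h.
apply: le_trans h2; rewrite [leRHS]mulrA -expRD; apply: ler_pM.
- exact: expR_ge0.
- by rewrite exprn_ge0// mulr_ge0// ltW.
- by rewrite ler_expR; lra.
rewrite -[n in (_ ^+ n)%R]card_ord -prodr_const; apply: ler_prod => i _.
by rewrite mulr_ge0 ?(ltW gamma0)//=; exact: meanB.
Qed.

End tessellation.

(** * The grid, the scale and the constant *)

Lemma exists_grid (q m : nat) : (0 < m)%N ->
  exists N (g : 'I_m -> 'I_q.+1 -> nat), [/\ (0 < N)%N,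
    (N ^ q.+1 <= 2 ^ q.+1 * m)%N, forall j k, (g j k < N)%N
    & forall i j, i != j -> exists k, g i k != g j k].
Proof.
move=> m0; have ex : exists N, (m <= N ^ q.+1)%N.
  by exists m; rewrite -[X in (X <= _)%N]expn1 leq_pexp2l.
(* For the least [N] either [N] is 1 or [(N - 1) ^ q.+1 < m], and then [N <= 2 * (N - 1)] bounds [N]
   from above. *)
have [N mN Nmin] := ex_minnP ex.
have N0 : (0 < N)%N by case: N mN {Nmin} => //; rewrite exp0n// leqNgt m0.
have NN : (N ^ q.+1 <= 2 ^ q.+1 * m)%N.
  case: N N0 Nmin {mN} => // -[_ _|N _ Nmin].
    by rewrite exp1n muln_gt0 expn_gt0.
  have : (N.+1 ^ q.+1 < m)%N.
    by rewrite ltnNge; apply/negP => /Nmin; rewrite ltnn.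
  move=> /ltnW h; apply: leq_trans (leq_mul (leqnn _) h); rewrite -expnMn.
  by rewrite leq_exp2r// mul2n -addnn addSn addnS !ltnS leq_addr.
have mF : (m <= #|{: {ffun 'I_q.+1 -> 'I_N}}|)%N by rewrite card_ffun !card_ord.
exists N, (fun j k => (enum_val (widen_ord mF j) : {ffun 'I_q.+1 -> 'I_N}) k).
split => // i j ij; apply: contrapT => /forallNP h; move/eqP: ij; apply.
apply: val_inj; apply: (congr1 val (x := widen_ord mF i) (y := widen_ord mF j)).
apply: enum_val_inj; apply/ffunP => k; apply: val_inj.
by apply/eqP; apply: contrapT => /negP; exact: h.
Qed.

Lemma card_facet_index (q m : nat) : #|{: facet_index q m}| = (q.+2 + m)%N.
Proof. by rewrite /facet_index card_sum card_option !card_ord. Qed.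

(** The bound on [N] makes the mesh at least half of n^(-1/(d-1)). So n times mesh^(d-1) is bounded
    from below, and mesh^2 alone produces the power of n. *)
Lemma grid_mesh_ge (R : realType) (q n N : nat) : (0 < N)%N -> (0 < n)%N ->
  (N ^ q.+1 <= 2 ^ q.+1 * n)%N ->
  (2 ^- q.+1 / 4 : R) * n%:R `^ (- 2 / q.+1%:R) <= n%:R * N%:R^-1 ^+ q.+1 * N%:R^-1 ^+ 2.
Proof.
move=> N0 n0 Nn; set e : R := N%:R^-1.
have e0 : 0 < e by rewrite invr_gt0 ltr0n.
have n0' : (0 : R) < n%:R by rewrite ltr0n.
have h1 : 2 ^- q.+1 <= n%:R * e ^+ q.+1.
  rewrite -[leLHS]mul1r ler_pdivrMr ?exprn_gt0// exprVn mulrAC ler_pdivlMr ?exprn_gt0 ?ltr0n//.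
  by rewrite mul1r -!natrX -natrM ler_nat mulnC.
have h2 : n%:R `^ (- 2 / q.+1%:R) <= (2 * e) ^+ 2.
  have h3 : n%:R^-1 <= (2 * e) ^+ q.+1.
    rewrite exprMn -[leLHS]mul1r ler_pdivrMr// mulrC mulrCA -ler_pdivrMl ?exprn_gt0//.
    by rewrite mulr1.
  have e20 : 0 < 2 * e by rewrite mulr_gt0.
  have h4 : n%:R `^ (- 1 / q.+1%:R) <= 2 * e.
    have -> : 2 * e = ((2 * e) ^+ q.+1) `^ (q.+1%:R^-1).
      by rewrite -powR_mulrn ?(ltW e20)// -powRrM mulfV ?pnatr_eq0// powRr1// ltW.
    have -> : n%:R `^ (- 1 / q.+1%:R) = n%:R^-1 `^ (q.+1%:R^-1) :> R.
      by rewrite -[n%:R^-1]powR_inv1 ?ler0n// -powRrM.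
    by apply: ge0_ler_powR; rewrite ?nnegrE ?invr_ge0// exprn_ge0// ltW.
  have -> : n%:R `^ (- 2 / q.+1%:R) = (n%:R `^ (- 1 / q.+1%:R)) ^+ 2 :> R.
    by rewrite -powR_mulrn ?powR_ge0// -powRrM; congr (_ `^ _); field.
  by rewrite ler_pXn2r// nnegrE ?powR_ge0// ltW.
have -> : n%:R * e ^+ q.+1 * e ^+ 2 = (n%:R * e ^+ q.+1) / 4 * (2 * e) ^+ 2 by field.
apply: ler_pM => //.
by rewrite ler_pM2r.
Qed.

Theorem theorem1p2 (R : realType) (d : nat) (phi : probability (borelRV R d) R) :
  (2 <= d)%N -> directional_distribution phi -> well_spread phi ->
  exists2 c : R, 0 < c &
  forall (gamma : R) (dO : measure_display) (Omega : measurableType dO)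
    (P : probability Omega R) (eta : Omega -> set (set 'rV[R]_d))
    (center : set 'rV[R]_d -> 'rV[R]_d)
    (dZ : measure_display) (OmegaZ : measurableType dZ)
    (PZ : probability OmegaZ R) (Z : OmegaZ -> set 'rV[R]_d) (n : nat),
  0 < gamma ->
  poisson_hyperplane_process phi gamma P eta ->
  center_function center ->
  typical_cell P eta center PZ Z ->
  (d + 1 <= n)%N ->
  ((c ^+ n * n%:R `^ (- (2 * n%:R) / (d%:R - 1)))%:E
     < PZ [set w | nfacets (Z w) = n%:R%:E])%E.
Proof.
case: d phi => [|[|q]] phi // _ _ /hyperplane_measure_ge[w [rho [a1 [w0 rho0 a10 ge]]]].
(* Half of the chart: slopes reach 1 in units of [s0], and the rest leaves room for the
   perturbations. *)
pose s0 : R := rho / 2.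
have s00 : 0 < s0 by rewrite divr_gt0.
have rhoE : rho = 2 * s0 by rewrite /s0 mulrC divfK.
pose W1 : R := size_bound R q * window w s0 + 1.
pose D : R := q.+2%:R * W1.
have sl0 : 0 < slack R q by exact: slack_gt0.
pose c1 : R := a1 * (s0 * slack R q) ^+ q.+1 * (s0 * slack R q).
have c10 : 0 < c1.
  have h : 0 < s0 * slack R q by exact: mulr_gt0.
  by apply: mulr_gt0 => //; apply: mulr_gt0 => //; exact: exprn_gt0.
pose c2 : R := c1 * (2 ^- q.+1 / 4).
have c20 : 0 < c2 by rewrite mulr_gt0// divr_gt0// invr_gt0 exprn_gt0.
pose E : R := expR (- (2 * D)).
have E0 : 0 < E by exact: expR_gt0.
(* The factor 1/2 makes the final inequality strict. *)
exists (E * (c2 / 2)); first by rewrite mulr_gt0// divr_gt0.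
move=> gamma dO Omega P eta center dZ OmegaZ PZ Z n gamma0 etaP centerP ZP nd.
pose m := (n - q.+2)%N.
have m0 : (0 < m)%N by rewrite subn_gt0 -addn1.
have mn : (q.+2 + m)%N = n by rewrite subnKC// ltnW// -addn1.
have n0 : (0 < n)%N by rewrite -mn addSn.
have n0' : (0 : R) < n%:R by rewrite ltr0n.
have [N [g [N0 NN gN g_inj]]] := exists_grid q m0.
pose r : R := n%:R / gamma.
have r0 : 0 < r by rewrite divr_gt0.
pose e : R := N%:R^-1.
have e0 : 0 < e by rewrite invr_gt0 ltr0n.
pose mu : R := a1 * (s0 * slack R q * e) ^+ q.+1 * (s0 * r * (slack R q * e ^+ 2)).
have mu_le (i : facet_index q m) : (mu%:E <= hyperplane_measure phi (hclass N g w s0 r i))%E.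
  rewrite rhoE in ge; apply: le_trans (hclass_measure_ge N0 gN w0 s00 r0 i ge).
  (* The faces of the cone have mesh 1, which only enlarges their classes, so one [mu] serves all
     indices. *)
  have em : e <= mesh R N i.
    by case: i => [l|j] //=; rewrite invf_le1 ?ltr0n// ler1n.
  have sls : 0 < s0 * slack R q by exact: mulr_gt0.
  have s0r : 0 < s0 * r by exact: mulr_gt0.
  have se : 0 <= s0 * slack R q * e by apply: ltW; exact: mulr_gt0.
  rewrite lee_fin /mu; apply: ler_pM.
  - by apply: mulr_ge0; [exact: ltW|exact: exprn_ge0].
  - by apply: mulr_ge0; [exact: ltW|apply: mulr_ge0; [exact: ltW|rewrite exprn_ge0// ltW]].
  - rewrite (ler_pM2l a10); apply: lerXn2r; rewrite ?nnegrE//.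
      by apply: ltW; apply: mulr_gt0 => //; exact: lt_le_trans em.
    by rewrite (ler_pM2l sls).
  rewrite (ler_pM2l s0r) (ler_pM2l sl0); apply: lerXn2r => //; rewrite nnegrE ltW//.
  exact: lt_le_trans em.
have mu0 : 0 <= mu.
  apply: mulr_ge0; apply: mulr_ge0; try exact: ltW.
  - by apply: exprn_ge0; apply: ltW; apply: mulr_gt0 => //; exact: mulr_gt0.
  - by apply: ltW; exact: mulr_gt0.
  - by apply: mulr_ge0; [exact: ltW|rewrite exprn_ge0// ltW].
have := prob_facets_ge gamma0 etaP centerP ZP N0 gN g_inj m0 w0 s00 r0 erefl mu0 mu_le.
rewrite card_facet_index mn; apply: lt_le_trans; rewrite lte_fin.
have -> : expR (- (2 * (gamma * (q.+2%:R * (r * (size_bound R q * window w s0 + 1)))))) = E ^+ n.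
  rewrite /E -expRM_natl; congr expR; rewrite /D /W1 /r; field.
  by rewrite gt_eqF.
pose Y : R := n%:R `^ (- 2 / q.+1%:R).
have Y0 : 0 < Y by exact: powR_gt0.
have -> : n%:R `^ (- (2 * n%:R) / (q.+2%:R - 1)) = Y ^+ n.
  rewrite /Y -powR_mulrn ?powR_ge0// -powRrM; congr (_ `^ _).
  by rewrite -[q.+2%:R]natr1 addrK; field.
have muY : c2 * Y <= gamma * mu.
  have -> : gamma * mu = c1 * (n%:R * e ^+ q.+1 * e ^+ 2).
    rewrite /mu /c1 [(s0 * slack R q * e) ^+ _]exprMn /r; field.
    by rewrite gt_eqF.
  rewrite /c2 -mulrA ler_pM2l//; apply: grid_mesh_ge => //.
  by apply: leq_trans NN _; rewrite leq_mul// -mn leq_addl.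
rewrite -!exprMn; apply: (@lt_le_trans _ _ ((E * (c2 * Y)) ^+ n)).
  rewrite ltrXn2r ?gt_eqF// -?lt0n//; last 2 first.
    by rewrite mulr_ge0 ?(ltW Y0)// mulr_ge0 ?(ltW E0)// divr_ge0// ltW.
  rewrite -mulrA ltr_pM2l// ltr_pM2r// ltr_pdivrMr// ltr_pMr// ltr1n//.
apply: lerXn2r; rewrite ?nnegrE.
- by rewrite mulr_ge0 ?(ltW E0)// mulr_ge0 ?(ltW Y0)// ltW.
- by rewrite mulr_ge0 ?(ltW E0)// mulr_ge0 ?(ltW gamma0).
by rewrite ler_pM2l.
Qed.
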